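(* Let $d_1,d_2$ be positive integers, let $F\in\Omega_2(d_1,d_2)$ and assume that $F$ has a generalized cusp at $a\in\mathbb{C}^2$. Then $F$ has a cusp at $a$ if and only if $\mu_a(F)=1$.
   Context: $\Omega_2(d_1,d_2)$ is the set of polynomial mappings $(f,g):\mathbb{C}^2\to\mathbb{C}^2$ with $\deg f\le d_1$, $\deg g\le d_2$. For $F=(f,g)$ put $J(F)=f_xg_y-f_yg_x$ and $J_{1,1}(F)=J(F)_xf_y-J(F)_yf_x$. $F$ has a cusp at $a$ if the germ of $F$ at $a$ is biholomorphically equivalent (biholomorphic changes in source and target) to $(x,y)\mapsto(x,y^3+xy)$ at $0$. $F$ has a generalized cusp at $a$ if the germ $F_a$ is proper (finite), the curve $\{J(F)=0\}$ is reduced near $a$, and the discriminant of $F_a$ (image of the critical locus germ) is not smooth at $F(a)$. Index: for a generic $T\in GL(2)$, $F'=(f',g')=T\circ F$ has $\nabla f'$ not vanishing identically on any branch of $\{J(F)=0\}$ near $a$, and $\mu_a(F):=\dim_{\mathbb{C}}\mathcal{O}_a/(J(F'),J_{1,1}(F'))-\dim_{\mathbb{C}}\mathcal{O}_a/(f'_x,f'_y)$. *)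

(* Defs.v *)
(* MathComp + MathComp-Analysis; complex numbers = R[i] (mathcomp-real-closed)
   for an arbitrary R : realType, viewed as a normed module over itself (R[i]^o).
   Differentiability of maps between normed C-modules is Frechet differentiability
   with a C-linear differential, i.e. holomorphy. *)
From mathcomp Require Import all_boot all_order all_algebra.
From mathcomp Require Import complex.
From mathcomp Require Import all_classical all_reals all_analysis.
Import Order.TTheory GRing.Theory Num.Theory.
Import numFieldNormedType.Exports.

Set Implicit Arguments.
Unset Strict Implicit.
Unset Printing Implicit Defensive.

Local Open Scope classical_set_scope.
Local Open Scope ring_scope.

Section Cusps.
Variable R : realType.

Definition CC := (R[i])^o.
Definition C2 := (CC * CC)%type.

Definition poly2_le (d : nat) (h : C2 -> CC) : Prop :=
  exists c : nat -> nat -> CC, forall p : C2,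
    h p = \sum_(i < d.+1) \sum_(j < d.+1 | (i + j <= d)%N)
            c i j * p.1 ^+ i * p.2 ^+ j.

Definition Omega2 (d1 d2 : nat) (f g : C2 -> CC) : Prop :=
  poly2_le d1 f /\ poly2_le d2 g.

Definition ex1 : C2 := (1, 0).
Definition ey1 : C2 := (0, 1).

Definition pdx (h : C2 -> CC) (p : C2) : CC := 'D_ex1 h p.
Definition pdy (h : C2 -> CC) (p : C2) : CC := 'D_ey1 h p.

Definition Jac (f g : C2 -> CC) (p : C2) : CC :=
  pdx f p * pdy g p - pdy f p * pdx g p.

Definition J11 (f g : C2 -> CC) (p : C2) : CC :=
  pdx (Jac f g) p * pdy f p - pdy (Jac f g) p * pdx f p.

Definition holo_near (h : C2 -> CC) (a : C2) : Prop :=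
  \forall z \near a, differentiable h z.

Definition biholo_germ (phi : C2 -> C2) (p q : C2) : Prop :=
  phi p = q /\
  exists psi : C2 -> C2, psi q = p /\
    (\forall z \near p, differentiable phi z) /\
    (\forall w \near q, differentiable psi w) /\
    (\forall z \near p, psi (phi z) = z) /\
    (\forall w \near q, phi (psi w) = w).

Definition cusp_model (p : C2) : C2 := (p.1, p.2 ^+ 3 + p.1 * p.2).

Definition has_cusp (F : C2 -> C2) (a : C2) : Prop :=
  exists phi psi : C2 -> C2,
    biholo_germ phi 0 a /\ biholo_germ psi (F a) 0 /\
    \forall z \near (0 : C2), psi (F (phi z)) = cusp_model z.

Definition proper_germ (F : C2 -> C2) (a : C2) : Prop :=
  exists U V : set C2, [/\ open U, U a, open V, V (F a) & F @` U `<=` V] /\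
    forall K : set C2, K `<=` V -> compact K -> compact (U `&` F @^-1` K).

Definition reduced_at (h : C2 -> CC) (p : C2) : Prop :=
  ~ exists k u : C2 -> CC, [/\ k p = 0, holo_near k p, holo_near u p &
      \forall z \near p, h z = k z ^+ 2 * u z].

Definition smooth_set_at (S : set C2) (q : C2) : Prop :=
  exists (W : set C2) (phi : C2 -> CC),
    [/\ open W, W q, (forall w, W w -> differentiable phi w),
        (exists v : C2, 'D_v phi q != 0) &
        (forall w, W w -> (S w <-> phi w = 0))].

Definition singular_at (S : set C2) (q : C2) : Prop :=
  S q /\ ~ smooth_set_at S q.

(* the discriminant germ of F_a (image of the critical-locus germ) is not smooth
   at F(a): for every small enough neighbourhood U of a, the set
   F(U /\ {J(F)=0}) is singular at F(a) *)
Definition disc_singular (f g : C2 -> CC) (a : C2) : Prop :=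
  exists U0 : set C2, open U0 /\ U0 a /\
    forall U : set C2, open U -> U a -> U `<=` U0 ->
      singular_at ((fun p => (f p, g p)) @` (U `&` [set p | Jac f g p = 0]))
                  (f a, g a).

Definition gen_cusp (f g : C2 -> CC) (a : C2) : Prop :=
  [/\ proper_germ (fun p => (f p, g p)) a,
      (\forall p \near a, reduced_at (Jac f g) p) &
      disc_singular f g a].

Definition in_ideal2 (a : C2) (g1 g2 h : C2 -> CC) : Prop :=
  exists u1 u2 : C2 -> CC, [/\ holo_near u1 a, holo_near u2 a &
    \forall z \near a, h z = u1 z * g1 z + u2 z * g2 z].

Definition quot_dim (a : C2) (g1 g2 : C2 -> CC) (n : nat) : Prop :=
  exists e : 'I_n -> C2 -> CC,
    [/\ (forall i, holo_near (e i) a),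
        (forall h, holo_near h a -> exists c : 'I_n -> CC,
            in_ideal2 a g1 g2 (fun z => h z - \sum_(i < n) c i * e i z)) &
        (forall c : 'I_n -> CC,
            in_ideal2 a g1 g2 (fun z => \sum_(i < n) c i * e i z) ->
            forall i, c i = 0)].

(* grad f' does not vanish identically on any branch of {J = 0} through a:
   near a, the only common zero of J, f'_x, f'_y is (at most) a itself *)
Definition grad_ok_on_branches (J f' : C2 -> CC) (a : C2) : Prop :=
  exists U : set C2, open U /\ U a /\
    forall p, U p -> J p = 0 -> pdx f' p = 0 -> pdy f' p = 0 -> p = a.

Definition polyM (P : 'M[CC]_2 -> CC) : Prop :=
  exists (d : nat) (c : 'I_d.+1 -> 'I_d.+1 -> 'I_d.+1 -> 'I_d.+1 -> CC),
    forall T : 'M[CC]_2,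
      P T = \sum_(i < d.+1) \sum_(j < d.+1) \sum_(k < d.+1) \sum_(l < d.+1)
              c i j k l * T 0 0 ^+ i * T 0 1 ^+ j * T 1 0 ^+ k * T 1 1 ^+ l.

Definition generic_GL2 (Q : 'M[CC]_2 -> Prop) : Prop :=
  exists P : 'M[CC]_2 -> CC, [/\ polyM P, (exists T, P T != 0) &
    forall T : 'M[CC]_2, \det T != 0 -> P T != 0 -> Q T].

(* the index condition mu_a(F) = 1: for generic T, with F' = (f',g') = T o F,
   grad f' is non-degenerate on the branches of {J(F)=0} and
   dim O_a/(J(F'), J_{1,1}(F')) - dim O_a/(f'_x, f'_y) = 1 (both finite) *)
Definition mu_eq1 (f g : C2 -> CC) (a : C2) : Prop :=
  generic_GL2 (fun T =>
    let f' := fun p => T 0 0 * f p + T 0 1 * g p in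
    let g' := fun p => T 1 0 * f p + T 1 1 * g p in
    grad_ok_on_branches (Jac f g) f' a /\
    exists n : nat, quot_dim a (Jac f' g') (J11 f' g') n.+1 /\
                    quot_dim a (pdx f') (pdy f') n).

End Cusps.

(* Main.v *)
(** Write [J] for the Jacobian of [F' = T o F = (f', g')] and [K] for
    [J_x f'_y - J_y f'_x].

    If [F] is a cusp, then [F' o phi = psi o m] with [m (x, y) = (x, y^3 + x y)], so
    [J o phi = u k] with [k = x + 3 y^2] and [u = det D(psi) / det D(phi)] nowhere
    zero.  Since [k] vanishes on the critical curve, continuity of [u] suffices to
    differentiate there, and restricting [K o phi] to [(- 3 t^2, t)] shows that the
    gradients of [J] and [K] at [a] are independent.  For generic [T] the gradient of
    [f'] does not vanish at [a], hence the two dimensions are 1 and 0.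

    Conversely, let the index be 1.  If [DF a != 0], a generic [T] makes the gradient
    of [f'] nonzero at [a], so [O_a / (J, K)] has dimension 1 and the gradients of [J]
    and [K] are independent; in affine coordinates this reads
    [f' = x + x^2 A + x y B + y^3 C] and [g' = x^2 A' + x y B' + y^3 C'] with [B'] and
    [C'] invertible at 0.  Looking for [x = x0 + x1 Y + x2 Y^2], [y = y0 + Y] in the
    algebra [C[Y] / (Y^3 + X Y - T)] such that [f'] and [g'] become constants is a
    system in six unknowns which the inverse function theorem solves; the solution
    provides both coordinate changes.  If [DF a = 0], then [J] and [K] lie in
    [m (f'_x, f'_y)], and a difference of dimensions equal to 1 puts a nontrivial
    combination of [f'_x] and [f'_y] in the ideal [(J, K)]; then one of them is a
    multiple of the other, and [f'] is critical along a curve through [a], which is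
    excluded.

    The analytic input is Cauchy's formula, obtained from Goursat's argument for
    trapezoidal sums on circles; iterating it on a torus, with a generalized limit of
    the sums as the mean, gives that holomorphic functions of two variables have
    continuous partial derivatives and satisfy Hadamard's lemma. *)
From HB Require Import structures.
Require Import Defs.
From mathcomp Require Import all_boot all_order all_algebra.
From mathcomp Require Import complex.
From mathcomp Require Import all_classical all_reals all_analysis.
From mathcomp Require Import ring lra.
Import Order.TTheory GRing.Theory Num.Theory.
Import numFieldNormedType.Exports.

Set Implicit Arguments.
Unset Strict Implicit.
Unset Printing Implicit Defensive.

Local Open Scope classical_set_scope.
Local Open Scope ring_scope.


(** * Complex modulus and the trapezoidal Goursat theorem *)

(** The dimensions in the index quantify over all holomorphic germs, although the map is polynomial;
    this is what calls for function theory of two variables. Hadamard's lemma for germs shows that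
    two functions with independent gradients generate the maximal ideal, and the continuity of
    partial derivatives of holomorphic coordinate changes controls the Jacobian of a cusp in its
    chart. The algebra [C[Y] / (Y^3 + X Y - T)] takes the place of a preparation theorem. Over
    functions of [(X, T)] it has the basis [1, Y, Y^2], and evaluation at [Y] with [T = Y^3 + X Y]
    turns an element without [Y] and [Y^2] components into a function of the cusp map. Killing these
    components for [f'] and [g'] gives four equations for [x0, x1, x2, y0]; [X] and [T], carried
    along as unknowns, make the system square of size six. The critical curve through [a] comes from
    an elementary bound: if all roots in [y] stayed away from 0, the constant term would dominate
    every coefficient, yet it tends to 0. *)

Section ComplexModulus.
Variable R : realType.
Local Notation C := (R[i]).

(** The norm of [R[i]] takes its values in [R[i]], whose order is partial; a modulus with values in
    [R] opens the estimates to linear arithmetic. *)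
Definition cmod (z : C) : R := Normc.normc z.

Lemma normCE (z : C) : `|z| = (cmod z)%:C%C.
Proof. by []. Qed.

Lemma cmodD (z w : C) : cmod (z + w) <= cmod z + cmod w.
Proof. by rewrite -lecR rmorphD -!normCE ler_normD. Qed.

Lemma cmodM (z w : C) : cmod (z * w) = cmod z * cmod w.
Proof. exact: Normc.normcM. Qed.

Lemma cmodN (z : C) : cmod (- z) = cmod z.
Proof. by apply: complexI; rewrite -!normCE normrN. Qed.

Lemma cmodV (z : C) : cmod z^-1 = (cmod z)^-1.
Proof. exact: Normc.normcV. Qed.

Lemma cmod0 : cmod 0 = 0.
Proof. exact: Normc.normc0. Qed.

Lemma cmod1 : cmod 1 = 1.
Proof. exact: Normc.normc1. Qed.

Lemma cmod_ge0 (z : C) : 0 <= cmod z.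
Proof. by rewrite -lecR -normCE normr_ge0. Qed.

Lemma cmod_eq0 (z : C) : (cmod z == 0) = (z == 0).
Proof.
by apply/eqP/eqP => [/Normc.eq0_normc//|->]; rewrite cmod0.
Qed.

Lemma cmod_gt0 (z : C) : (0 < cmod z) = (z != 0).
Proof. by rewrite lt_neqAle eq_sym cmod_eq0 cmod_ge0 andbT. Qed.

Lemma cmodX (z : C) n : cmod (z ^+ n) = cmod z ^+ n.
Proof. by elim: n => [|n IH]; rewrite ?expr0 ?cmod1 // !exprS cmodM IH. Qed.

Lemma cmodB (z w : C) : cmod (z - w) = cmod (w - z).
Proof. by rewrite -cmodN opprB. Qed.

Lemma cmod_le_sum n (F : 'I_n -> C) :
  cmod (\sum_i F i) <= \sum_i cmod (F i).
Proof.
elim/big_ind2: _ => [|x x' y y' h h'|//]; first by rewrite cmod0.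
exact: le_trans (cmodD _ _) (lerD h h').
Qed.

Lemma cmod_real (x : R) : cmod (x%:C%C) = `|x|.
Proof. by rewrite /cmod /= expr0n /= addr0 sqrtr_sqr. Qed.

Lemma cmod_i : cmod 'i%C = 1.
Proof. by rewrite /cmod /= expr0n expr1n /= add0r sqrtr1. Qed.

Lemma cmod_le_parts (a b : R) : cmod (a +i* b)%C <= `|a| + `|b|.
Proof.
have -> : (a +i* b)%C = a%:C%C + 'i%C * b%:C%C.
  by simpc.
by apply: le_trans (cmodD _ _) _; rewrite cmodM cmod_i mul1r !cmod_real.
Qed.

Lemma Re_le_cmod (a b : R) : `|a| <= cmod (a +i* b)%C.
Proof.
by rewrite /cmod /= -sqrtr_sqr ler_wsqrtr // lerDl sqr_ge0.
Qed.

Lemma Im_le_cmod (a b : R) : `|b| <= cmod (a +i* b)%C.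
Proof.
by rewrite /cmod /= -sqrtr_sqr ler_wsqrtr // lerDr sqr_ge0.
Qed.

Lemma cmod_sub_le (z w : C) : cmod z <= cmod w + cmod (z - w).
Proof. by rewrite -[X in cmod X <= _](subrK w) addrC cmodD. Qed.

Lemma cmod_triangle (z w v : C) : cmod (z - v) <= cmod (z - w) + cmod (w - v).
Proof. by have := cmodD (z - w) (w - v); rewrite addrA subrK. Qed.

End ComplexModulus.

Arguments cmod {R} z : simpl never.

(** * Bisection of intervals and rectangles *)

Section Bisection.
Variable R : realType.

Lemma nested_intervals (u v : nat -> R) :
  (forall n, u n <= u n.+1) -> (forall n, v n.+1 <= v n) ->
  (forall n, u n <= v n) -> exists x, forall n, u n <= x <= v n.
Proof.
move=> hu hv huv.
have mu n k : u n <= u (n + k)%N.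
  by elim: k => [|k IH]; rewrite ?addn0 // addnS; apply: le_trans IH (hu _).
have mv n k : v (n + k)%N <= v n.
  by elim: k => [|k IH]; rewrite ?addn0 // addnS; apply: le_trans (hv _) IH.
have uv n k : u n <= v k.
  apply: le_trans (mu n k) _; apply: le_trans (huv _) _.
  by rewrite addnC mv.
pose S := [set y | exists n, y = u n]%classic.
have S0 : (S !=set0)%classic by exists (u 0%N), 0%N.
exists (sup S) => n; apply/andP; split.
  apply: ub_le_sup; last by exists n.
  by exists (v 0%N) => _ [k ->].
by apply: ge_sup => // _ [k ->].
Qed.

Lemma exp2V_small (e : R) : 0 < e -> exists n, 2^-1 ^+ n < e.
Proof.
move=> e0; pose n := Num.bound (e^-1).
exists n; have h : e^-1 < n%:R by rewrite archi_boundP // invr_ge0 ltW.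
have h2 : (n%:R : R) <= 2 ^+ n.
  by rewrite -natrX ler_nat ltnW // ltn_expl.
rewrite exprVn invf_plt ?posrE ?exprn_gt0 //.
exact: lt_le_trans h h2.
Qed.

(** A failing rectangle has a failing quarter, and nested failures shrink to a point where the local
    hypothesis contradicts them. Only rectangles similar to the first one occur, hence the single
    scale [k]. Zero sides are allowed, so that the lemma also serves intervals. *)
Lemma cousin_rect (P : R -> R -> R -> R -> Prop) (s0 t0 a0 b0 : R) :
  0 <= a0 -> 0 <= b0 ->
  (forall s t a b, P s t (a / 2) (b / 2) -> P (s + a / 2) t (a / 2) (b / 2) ->
     P s (t + b / 2) (a / 2) (b / 2) ->
     P (s + a / 2) (t + b / 2) (a / 2) (b / 2) -> P s t a b) ->
  (forall x y, s0 <= x <= s0 + a0 -> t0 <= y <= t0 + b0 ->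
     exists2 d : R, 0 < d & forall s t k, 0 < k < d ->
       s <= x <= s + a0 * k -> t <= y <= t + b0 * k -> P s t (a0 * k) (b0 * k)) ->
  P s0 t0 a0 b0.
Proof.
move=> a00 b00 Hq Hl; apply: contrapT => nP.
pose bad (n : nat) (p : R * R) :=
  ~ P p.1 p.2 (a0 * 2^-1 ^+ n) (b0 * 2^-1 ^+ n).
(* The implication sits under the existential so that [choice] yields a total step function. *)
have step n p : exists q : R * R, bad n p ->
    [/\ bad n.+1 q, p.1 <= q.1 <= p.1 + a0 * 2^-1 ^+ n.+1 &
        p.2 <= q.2 <= p.2 + b0 * 2^-1 ^+ n.+1].
  have [k0 kE] : 0 <= (2^-1 : R) ^+ n.+1 /\ (2^-1 : R) ^+ n.+1 = 2^-1 ^+ n / 2.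
    by rewrite exprn_ge0 ?invr_ge0 // exprSr.
  have ha : 0 <= a0 * 2^-1 ^+ n.+1 by rewrite mulr_ge0.
  have hb : 0 <= b0 * 2^-1 ^+ n.+1 by rewrite mulr_ge0.
  pose q00 : R * R := (p.1, p.2).
  pose q10 : R * R := (p.1 + a0 * 2^-1 ^+ n.+1, p.2).
  pose q01 : R * R := (p.1, p.2 + b0 * 2^-1 ^+ n.+1).
  pose q11 : R * R := (p.1 + a0 * 2^-1 ^+ n.+1, p.2 + b0 * 2^-1 ^+ n.+1).
  have [h00|/contrapT h00] := pselect (bad n.+1 q00).
    by exists q00 => _; split=> //=; apply/andP; split; lra.
  have [h10|/contrapT h10] := pselect (bad n.+1 q10).
    by exists q10 => _; split=> //=; apply/andP; split; lra.
  have [h01|/contrapT h01] := pselect (bad n.+1 q01).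
    by exists q01 => _; split=> //=; apply/andP; split; lra.
  have [h11|/contrapT h11] := pselect (bad n.+1 q11).
    by exists q11 => _; split=> //=; apply/andP; split; lra.
  exists p => hbad; exfalso; apply: hbad.
  by apply: Hq; rewrite -!mulrA -!kE.
have [nx nxP] := choice (fun np : nat * (R * R) => step np.1 np.2).
pose sq := fix sq n := if n is m.+1 then nx (m, sq m) else (s0, t0).
have sqbad : forall n, bad n (sq n).
  elim=> [|n IH]; first by rewrite /bad expr0 !mulr1.
  by have [] := nxP (n, sq n) IH.
have kE n : (2^-1 : R) ^+ n.+1 = 2^-1 ^+ n / 2 by rewrite exprSr.
have kp n : 0 < (2^-1 : R) ^+ n by rewrite exprn_gt0 ?invr_gt0 ?ltr0n.
have sq1 n : (sq n).1 <= (sq n.+1).1 <= (sq n).1 + a0 * 2^-1 ^+ n.+1.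
  by have [] := nxP (n, sq n) (sqbad n).
have sq2 n : (sq n).2 <= (sq n.+1).2 <= (sq n).2 + b0 * 2^-1 ^+ n.+1.
  by have [] := nxP (n, sq n) (sqbad n).
have [x hx] : exists x, forall n, (sq n).1 <= x <= (sq n).1 + a0 * 2^-1 ^+ n.
  apply: nested_intervals => n.
  - by case/andP: (sq1 n).
  - by case/andP: (sq1 n); rewrite kE; lra.
  - by rewrite lerDl mulr_ge0 // ltW.
have [y hy] : exists y, forall n, (sq n).2 <= y <= (sq n).2 + b0 * 2^-1 ^+ n.
  apply: nested_intervals => n.
  - by case/andP: (sq2 n).
  - by case/andP: (sq2 n); rewrite kE; lra.
  - by rewrite lerDl mulr_ge0 // ltW.
have hx0 : s0 <= x <= s0 + a0 by have := hx 0%N; rewrite expr0 mulr1.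
have hy0 : t0 <= y <= t0 + b0 by have := hy 0%N; rewrite expr0 mulr1.
have [d d0 hd] := Hl x y hx0 hy0.
have [n hn] := exp2V_small d0.
by apply: (sqbad n); apply: hd => //; rewrite kp.
Qed.

End Bisection.

(** * Trapezoidal sums along segments and rectangles *)

Section Trapezoid.
Variable R : realType.
Local Notation C := (R[i]).
Implicit Types (phi psi : R -> C) (g : R -> R -> C).

(** The trapezoidal rule with [2^m] equal panels. Recursion by halving makes refinement match the
    quartering of rectangles exactly. *)
Fixpoint trap (m : nat) phi (s a : R) : C :=
  if m is m'.+1 then trap m' phi s (a / 2) + trap m' phi (s + a / 2) (a / 2)
  else (a / 2)%:C%C * (phi s + phi (s + a)).

Lemma trapD m phi psi s a :
  trap m (fun t => phi t + psi t) s a = trap m phi s a + trap m psi s a.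
Proof.
by elim: m s a => [|m IH] s a /=; rewrite ?IH; ring.
Qed.

Lemma trapZ m c phi s a : trap m (fun t => c * phi t) s a = c * trap m phi s a.
Proof.
by elim: m s a => [|m IH] s a /=; rewrite ?IH; ring.
Qed.

Lemma trap_affine m (al be : C) s a :
  trap m (fun t => al + be * t%:C%C) s a =
  a%:C%C * (al + be * (s + a / 2)%:C%C).
Proof.
elim: m s a => [|m IH] s a /=; rewrite ?IH !(rmorphD, rmorphM, fmorphV, rmorph_nat).
  by field.
by field.
Qed.

Lemma eq_trap m phi psi s a : phi =1 psi -> trap m phi s a = trap m psi s a.
Proof. by move=> e; elim: m s a => [|m IH] s a /=; rewrite ?IH ?e. Qed.

Lemma trap_bound m phi s a B : 0 <= a ->
  (forall t, s <= t <= s + a -> cmod (phi t) <= B) ->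
  cmod (trap m phi s a) <= a * B.
Proof.
elim: m s a => [|m IH] s a a0 h /=.
  rewrite cmodM cmod_real ger0_norm; last by lra.
  have := h s; have := h (s + a); rewrite !lexx !lerDl a0 => /(_ isT) h1 /(_ isT) h2.
  have := cmodD (phi s) (phi (s + a)); set u := cmod (_ + _); nra.
have -> : a * B = a / 2 * B + a / 2 * B by field.
apply: le_trans (cmodD _ _) _; apply: lerD; apply: IH; try lra.
  by move=> t /andP[t1 t2]; apply: h; apply/andP; split; lra.
by move=> t /andP[t1 t2]; apply: h; apply/andP; split; lra.
Qed.

(** Stands for the contour integral of [g (dx + i dy)], counterclockwise: bottom, right, top,
    left. *)
Definition rect_sum m g (s t a b : R) : C :=
  trap m (g^~ t) s a + 'i%C * trap m (g (s + a)) t b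
  - trap m (g^~ (t + b)) s a - 'i%C * trap m (g s) t b.

(** The inner edges are run through twice in opposite directions. The cancellation is exact because
    level [m.+1] on an edge is the sum of level [m] on its halves. *)
Lemma rect_sumS m g s t a b :
  rect_sum m.+1 g s t a b =
  rect_sum m g s t (a / 2) (b / 2) + rect_sum m g (s + a / 2) t (a / 2) (b / 2)
  + rect_sum m g s (t + b / 2) (a / 2) (b / 2)
  + rect_sum m g (s + a / 2) (t + b / 2) (a / 2) (b / 2).
Proof.
have h (x y : R) : x + y / 2 + y / 2 = x + y by lra.
by rewrite /rect_sum /= !h; ring.
Qed.

Lemma rect_sumD m g g' s t a b :
  rect_sum m (fun x y => g x y + g' x y) s t a b =
  rect_sum m g s t a b + rect_sum m g' s t a b.
Proof. by rewrite /rect_sum !trapD; ring. Qed.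

Lemma rect_sum_affine m (al be : C) s t a b :
  rect_sum m (fun x y => al + be * (x%:C%C + 'i%C * y%:C%C)) s t a b = 0.
Proof.
rewrite /rect_sum.
have hx y : (fun x : R => al + be * (x%:C%C + 'i%C * y%:C%C)) =1
            (fun x => (al + be * 'i%C * y%:C%C) + be * x%:C%C) by move=> x; ring.
have hy x : (fun y : R => al + be * (x%:C%C + 'i%C * y%:C%C)) =1
            (fun y => (al + be * x%:C%C) + (be * 'i%C) * y%:C%C) by move=> y; ring.
rewrite !(eq_trap _ _ _ (hx _)) !(eq_trap _ _ _ (hy _)) !trap_affine.
rewrite !(rmorphD, rmorphM, fmorphV, rmorph_nat).
by ring.
Qed.

Lemma rect_sum_bound m g s t a b B : 0 <= a -> 0 <= b ->
  (forall x y, s <= x <= s + a -> t <= y <= t + b -> cmod (g x y) <= B) ->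
  cmod (rect_sum m g s t a b) <= 2 * (a + b) * B.
Proof.
move=> a0 b0 h.
have hs : s <= s <= s + a by rewrite lexx lerDl.
have hsa : s <= s + a <= s + a by rewrite lexx lerDl a0.
have ht : t <= t <= t + b by rewrite lexx lerDl.
have htb : t <= t + b <= t + b by rewrite lexx lerDl b0.
have h1 := @trap_bound m (g^~ t) s a B a0 (fun x hx => h x t hx ht).
have h2 := @trap_bound m (g^~ (t + b)) s a B a0 (fun x hx => h x _ hx htb).
have h3 := @trap_bound m (g s) t b B b0 (fun y hy => h s y hs hy).
have h4 := @trap_bound m (g (s + a)) t b B b0 (fun y hy => h _ y hsa hy).
rewrite /rect_sum.
set A := trap _ _ _ _ in h1 *; set D := trap _ _ _ _ in h4 *.
set E := trap _ _ _ _ in h2 *; set F := trap _ _ _ _ in h3 *.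
have k1 := cmodD (A + 'i%C * D - E) (- ('i%C * F)).
have k2 := cmodD (A + 'i%C * D) (- E).
have k3 := cmodD A ('i%C * D).
rewrite !cmodN !cmodM !cmod_i !mul1r in k1 k2 k3.
by lra.
Qed.

(* Goursat's argument: the trapezoidal rule is additive and exact on affine
   functions, so no integral is needed. *)
Lemma goursat_rect g s0 t0 a0 b0 : 0 < a0 -> 0 < b0 ->
  (forall x y, s0 <= x <= s0 + a0 -> t0 <= y <= t0 + b0 ->
     exists L : C, forall e, 0 < e -> exists2 d : R, 0 < d & forall s t,
       `|s - x| < d -> `|t - y| < d ->
       cmod (g s t - g x y - L * ((s - x)%:C%C + 'i%C * (t - y)%:C%C))
         <= e * (`|s - x| + `|t - y|)) ->
  forall e, 0 < e -> exists N, forall m, (N <= m)%N ->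
    cmod (rect_sum m g s0 t0 a0 b0) <= e.
Proof.
move=> a00 b00 Hd e e0.
pose e1 := e / (a0 * b0).
have ab0 : 0 < a0 * b0 by rewrite mulr_gt0.
have e10 : 0 < e1 by rewrite divr_gt0.
(* A bound proportional to the area adds up exactly over the quarters; each rectangle may have its
   own threshold [N]. *)
pose P s t a b := exists N, forall m, (N <= m)%N ->
    cmod (rect_sum m g s t a b) <= e1 * (a * b).
suff : P s0 t0 a0 b0 by rewrite /P /e1 divfK // gt_eqF.
apply: (@cousin_rect R P); rewrite ?(ltW a00) ?(ltW b00) //.
  move=> s t a b [N1 h1] [N2 h2] [N3 h3] [N4 h4].
  exists (maxn (maxn N1 N2) (maxn N3 N4)).+1 => -[//|m].
  rewrite ltnS !geq_max => /andP[/andP[m1 m2] /andP[m3 m4]].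
  rewrite rect_sumS.
  have := h1 _ m1; have := h2 _ m2; have := h3 _ m3; have := h4 _ m4.
  set A := rect_sum _ _ _ _ _ _; set B := rect_sum _ _ _ _ _ _.
  set D := rect_sum _ _ _ _ _ _; set E := rect_sum _ _ _ _ _ _.
  have k1 := cmodD (E + D + B) A; have k2 := cmodD (E + D) B.
  have k3 := cmodD E D.
  have -> : a / 2 * (b / 2) = (a * b) / 4 by lra.
  by set w := a * b; lra.
move=> x y hx hy; have [L hL] := Hd x y hx hy.
(* Perimeter times deviation, [2 (a0 + b0) k] times [e2 (a0 + b0) k], is then [e k^2], which equals
   [e1] times the area of the small rectangle. *)
pose e2 := e / (2 * (a0 + b0) ^+ 2).
have s20 : 0 < 2 * (a0 + b0) ^+ 2 by rewrite mulr_gt0 // exprn_gt0 // addr_gt0.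
have e20 : 0 < e2 by rewrite divr_gt0.
have [d d0 hd] := hL _ e20.
have ab1 : 0 < a0 + b0 + 1 by lra.
exists (d / (a0 + b0 + 1)); first by rewrite divr_gt0.
move=> s t k /andP[k0 kd] /andP[hs1 hs2] /andP[ht1 ht2].
have kd' : (a0 + b0 + 1) * k < d by rewrite mulrC -ltr_pdivlMr.
have ka : a0 * k < d by nra.
have kb : b0 * k < d by nra.
have ka0 : 0 < a0 * k by rewrite mulr_gt0.
have kb0 : 0 < b0 * k by rewrite mulr_gt0.
exists 0%N => m _.
(* The affine approximation at [(x, y)], whose contour sum is 0; only the deviation [gr] remains to
   be bounded. *)
pose gl := fun s t => (g x y - L * (x%:C%C + 'i%C * y%:C%C))
                      + L * (s%:C%C + 'i%C * t%:C%C).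
pose gr := fun s t => g s t - gl s t.
have -> : rect_sum m g s t (a0 * k) (b0 * k) = rect_sum m gr s t (a0 * k) (b0 * k).
  rewrite -[RHS]addr0 -[X in _ = _ + X](rect_sum_affine m (g x y - L * (x%:C%C + 'i%C * y%:C%C)) L s t (a0 * k) (b0 * k)).
  rewrite -rect_sumD; congr rect_sum; apply/funext => p; apply/funext => q.
  by rewrite /gr /gl subrK.
apply: le_trans (@rect_sum_bound _ _ _ _ _ _ (e2 * (a0 * k + b0 * k)) (ltW ka0) (ltW kb0) _) _.
  move=> p q /andP[p1 p2] /andP[q1 q2].
  have hp : `|p - x| <= a0 * k by rewrite ler_norml; apply/andP; split; lra.
  have hq : `|q - y| <= b0 * k by rewrite ler_norml; apply/andP; split; lra.
  have := hd p q (le_lt_trans hp ka) (le_lt_trans hq kb).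
  have -> : g p q - g x y - L * ((p - x)%:C%C + 'i%C * (q - y)%:C%C) = gr p q.
    by rewrite /gr /gl !rmorphB; ring.
  move=> h; apply: le_trans h _; rewrite ler_pM2l //; exact: lerD.
rewrite /e1 /e2 le_eqVlt; apply/orP; left; apply/eqP.
by field; rewrite !gt_eqF //; lra.
Qed.

End Trapezoid.

Lemma diff_of_littleo (K : numFieldType) (V W : normedModType K) (f : V -> W)
    (df : {linear V -> W}) (x : V) : continuous df ->
  (forall e : K, 0 < e ->
     \forall h \near (0 : V), `|f (h + x) - f x - df h| <= e * `|h|) ->
  differentiable f x /\ 'd f x = df :> (V -> W).
Proof.
move=> cdf H.
have E : f \o shift x = cst (f x) + df +o_ 0 id.
  apply/eqaddoP => e e0; apply: filterS (H e e0) => h.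
  by rewrite -![(_ - _ : _ -> _) _]/(_ - _) -![(_ + _ : _ -> _) _]/(_ + _) opprD addrA.
have D := diff_unique cdf E.
by split=> //; apply/diff_locallyP; rewrite D.
Qed.

(** * Neighbourhoods and differentiability in real epsilon-delta form *)

Section Interface.
Variable R : realType.
Local Notation C := (R[i]).
Local Notation CC := (CC R).
Local Notation C2 := (C2 R).

Definition dist2 (z a : C2) : R :=
  cmod ((z.1 : C) - (a.1 : C)) + cmod ((z.2 : C) - (a.2 : C)).

Lemma posC_real (e : C) : 0 < e -> exists2 d : R, 0 < d & e = d%:C%C.
Proof.
case: e => x y; rewrite ltcE /= => /andP[/eqP -> x0]; exists x => //.
Qed.

Lemma near_C2P (a : C2) (P : set C2) :
  (\forall z \near a, P z) <->
  exists2 d : R, 0 < d & forall z : C2, dist2 z a < d -> P z.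
Proof.
split.
  move=> /nbhs_ballP[e /= e0 h]; have [d d0 de] := posC_real e0.
  exists d => // z hz; apply: h; rewrite de.
  have := cmod_ge0 (z.1 - a.1); have := cmod_ge0 (z.2 - a.2).
  move: hz; rewrite /dist2 => hz h2 h1.
  split; rewrite /ball /= -[_ < _]/(`|_ - _ : C| < _) normCE ltcR cmodB; lra.
move=> [d d0 h]; apply/nbhs_ballP; exists (d / 2)%:C%C => /=.
  by rewrite ltcR divr_gt0.
move=> z [h1 h2]; apply: h; rewrite /dist2.
move: h1 h2; rewrite /ball /= -[_ < _]/(`|_ - _ : C| < _) -[X in _ -> X -> _]/(is_true (`|_ - _ : C| < _)).
rewrite !normCE !ltcR ![cmod (a.1 - _)]cmodB ![cmod (a.2 - _)]cmodB; lra.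
Qed.

(** Complex Frechet differentiability restated by real inequalities, with the two partial
    derivatives named; [differentiable_fdiff] and [fdiff_differentiable] translate both ways. *)
Definition fdiff (h : C2 -> C) (a : C2) (L1 L2 : C) :=
  forall e : R, 0 < e -> exists2 d : R, 0 < d & forall z : C2, dist2 z a < d ->
    cmod (h z - h a - (L1 * ((z.1 : C) - (a.1 : C)) + L2 * ((z.2 : C) - (a.2 : C)))) <= e * dist2 z a.

Lemma norm_C2_le (z : C2) : `|z| <= (cmod z.1 + cmod z.2)%:C%C.
Proof.
rewrite prod_normE.
have h1 : `|z.1| <= (cmod z.1 + cmod z.2)%:C%C.
  by rewrite -[_ <= _]/(`|z.1 : C| <= _) normCE lecR lerDl cmod_ge0.
have h2 : `|z.2| <= (cmod z.1 + cmod z.2)%:C%C.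
  by rewrite -[_ <= _]/(`|z.2 : C| <= _) normCE lecR lerDr cmod_ge0.
by rewrite /Num.max; case: ifP.
Qed.

Lemma norm_C2_ge (z : C2) : (cmod z.1 + cmod z.2)%:C%C <= 2 * `|z|.
Proof.
rewrite prod_normE !normCE.
have -> : Num.max (cmod z.1)%:C%C (cmod z.2)%:C%C
          = (Num.max (cmod z.1) (cmod z.2))%:C%C.
  by case: (leP (cmod z.1) (cmod z.2)) => h; [rewrite max_r|rewrite max_l];
     rewrite // lecR // ltW.
have -> : (2 : C) = 2%:R%:C%C by rewrite rmorph_nat.
by rewrite -rmorphM lecR mulr_natl mulr2n lerD // le_max lexx ?orbT.
Qed.

Lemma differentiable_fdiff (h : C2 -> CC) (a : C2) : differentiable h a ->
  fdiff h a (pdx h a) (pdy h a).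
Proof.
move=> dh e e0.
have := diff_locally dh => /eqaddoP /(_ e%:C%C).
rewrite ltcR => /(_ e0) /near_C2P[d d0 hd]; exists d => // z hz.
have := hd (z - a); rewrite {1}/dist2 /= !subr0 => /(_ hz).
rewrite /pdx /pdy !deriveE // -![(_ - _ : _ -> _) _]/(_ - _).
rewrite -![(_ + _ : _ -> _) _]/(_ + _) /= subrK.
have -> : 'd h a (z - a) = 'd h a (ex1 R) * (z.1 - a.1) + 'd h a (ey1 R) * (z.2 - a.2).
  have {1}-> : z - a = (z.1 - a.1) *: ex1 R + (z.2 - a.2) *: ey1 R.
    apply/eqP; rewrite -pair_eqE; apply/andP; split; apply/eqP => /=.
      by rewrite /GRing.scale /= mulr1 mulr0 addr0.
    by rewrite /GRing.scale /= mulr1 mulr0 add0r.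
  by rewrite linearD !linearZ /GRing.scale /= mulrC [X in _ + X = _]mulrC.
rewrite opprD addrA /cst => H.
have {}H := le_trans H (ler_wpM2l _ (norm_C2_le (z - a))).
rewrite -lecR -normCE rmorphM; apply: H.
by rewrite lecR ltW.
Qed.

Lemma fdiff_differentiable (h : C2 -> CC) (a : C2) L1 L2 : fdiff h a L1 L2 ->
  [/\ differentiable h a, pdx h a = L1 & pdy h a = L2].
Proof.
move=> hL.
pose df0 : C2 -> CC := fun z => L1 * z.1 + L2 * z.2.
have lin : linear df0.
  by move=> k u v; rewrite /df0 /= /GRing.scale /=; ring.
pose df : {linear C2 -> CC} := HB.pack df0 (GRing.isLinear.Build _ _ _ _ df0 lin).
have cdf : continuous df.
  move=> x; rewrite /df /= /df0.
  apply: cvgD; (apply: cvgM; first exact: cvg_cst); [exact: cvg_fst|exact: cvg_snd].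
have [|dh D] := @diff_of_littleo _ C2 CC h df a cdf.
  move=> e /posC_real[d d0 ->].
  have d20 : 0 < d / 2 by rewrite divr_gt0.
  have [r r0 hr] := hL _ d20.
  apply/near_C2P; exists r => // z; rewrite /dist2 !subr0 => hz.
  have := hr (z + a); rewrite {1}/dist2 /= !addrK => /(_ hz).
  rewrite /dist2 /= !addrK => H.
  rewrite -[X in X <= _]/(`|(_ : C)|) normCE.
  apply: le_trans (_ : (d / 2 * (cmod z.1 + cmod z.2))%:C%C <= _).
    by rewrite lecR.
  rewrite rmorphM rmorphM fmorphV rmorph_nat -mulrA.
  apply: ler_wpM2l; first by rewrite lecR ltW.
  by rewrite ler_pdivrMl ?ltr0n // norm_C2_ge.
split=> //; rewrite /pdx /pdy deriveE // D /= /df0 /= ?mulr1 ?mulr0 ?addr0 ?add0r //.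
Qed.
End Interface.

(** * Cauchy formula and holomorphic functions of two variables *)

Section ComplexExponential.
Variable R : realType.
Local Notation C := (R[i]).

(** The exponential of [s + i t], used as log-polar coordinates: annuli become rectangles, to which
    [goursat_rect] applies. *)
Definition cexp (s t : R) : C := (expR s)%:C%C * (cos t +i* sin t)%C.

Lemma cexpD s t s' t' : cexp (s + s') (t + t') = cexp s t * cexp s' t'.
Proof.
rewrite /cexp expRD cosD sinD; apply/eqP; rewrite eq_complex /=.
by apply/andP; split; apply/eqP; ring.
Qed.

Lemma cmod_cexp s t : cmod (cexp s t) = expR s.
Proof.
rewrite cmodM cmod_real ger0_norm ?expR_ge0 // /cmod /= cos2Dsin2 sqrtr1.
by rewrite mulr1.
Qed.

Lemma cexp_neq0 s t : cexp s t != 0.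
Proof. by rewrite -cmod_gt0 cmod_cexp expR_gt0. Qed.

Lemma cexp_period s t : cexp s (t + pi *+ 2) = cexp s t.
Proof. by rewrite /cexp cosD2pi sinD2pi. Qed.

Lemma is_derive_approx (f : R -> R) (x l : R) : is_derive x 1 f l ->
  forall e, 0 < e -> exists2 d : R, 0 < d &
    forall h, `|h| < d -> `|f (x + h) - f x - h * l| <= e * `|h|.
Proof.
move=> [/derivable_nbhs df <-] e e0.
have /eqaddoP/(_ e e0)/nbhs_ballP[d /= d0 hd] := df.
exists d => // h hh; have := hd h; rewrite /ball /= sub0r normrN => /(_ hh).
rewrite -![(_ - _ : _ -> _) _]/(_ - _) -![(_ + _ : _ -> _) _]/(_ + _) /=.
by rewrite /GRing.scale /= mulr1 [h + x]addrC opprD addrA.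
Qed.

Lemma cexp_approx e : 0 < e -> exists2 d : R, 0 < d & forall h k,
  `|h| < d -> `|k| < d ->
  cmod (cexp h k - 1 - (h%:C%C + 'i%C * k%:C%C)) <= e * (`|h| + `|k|).
Proof.
move=> e0; pose e1 := Num.min 1 (e / 8).
have e10 : 0 < e1 by rewrite lt_min ltr01 divr_gt0.
have e11 : e1 <= 1 by rewrite ge_min lexx.
have e18 : e1 <= e / 8 by rewrite ge_min lexx orbT.
have [d1 d10 h1] := is_derive_approx (is_derive_expR 0) e10.
have [d2 d20 h2] := is_derive_approx (is_derive_cos 0) e10.
have [d3 d30 h3] := is_derive_approx (is_derive_sin 0) e10.
pose d := Num.min (Num.min d1 (e1 / 4)) (Num.min d2 d3).
exists d; first by rewrite !lt_min d10 d20 d30 divr_gt0.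
move=> h k; rewrite !lt_min => /andP[/andP[hh1 hh2] _] /andP[/andP[_ _] /andP[kk2 kk3]].
have := h1 _ hh1; have := h2 _ kk2; have := h3 _ kk3.
rewrite !add0r expR0 cos0 sin0 oppr0 mulr0 !mulr1 !subr0 addr0 => H3 H2 H1.
have EP := expR_gt0 h.
have -> : cexp h k - 1 - (h%:C%C + 'i%C * k%:C%C) =
   (((expR h - 1 - h) + expR h * (cos k - 1)) +i*
    (expR h * (sin k - k) + (expR h - 1) * k))%C.
  apply/eqP; rewrite eq_complex /=.
  by apply/andP; split; apply/eqP; ring.
apply: le_trans (cmod_le_parts _ _) _.
have k1 := ler_normD (expR h - 1 - h) (expR h * (cos k - 1)).
have k2 := ler_normD (expR h * (sin k - k)) ((expR h - 1) * k).
rewrite !normrM (gtr0_norm EP) in k1 k2.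
have hk := normr_ge0 k; have hn := normr_ge0 h.
have e1h : e1 * `|h| <= `|h| by rewrite ler_piMl.
have e1k : 0 <= e1 * `|k| by rewrite mulr_ge0 // ltW.
have eh0 : 0 <= e * `|h| by rewrite mulr_ge0 // ltW.
have ek0 : 0 <= e * `|k| by rewrite mulr_ge0 // ltW.
have eh : e1 * `|h| <= e / 8 * `|h| by rewrite ler_wpM2r.
have ek : e1 * `|k| <= e / 8 * `|k| by rewrite ler_wpM2r.
have k3 : `|expR h - 1| <= 2 * `|h|.
  have := ler_normD (expR h - 1 - h) h; rewrite subrK; lra.
have k4 : expR h <= 2.
  have := ler_norm (expR h - 1); lra.
have k5 : expR h * `|cos k - 1| <= 2 * (e1 * `|k|) by apply: ler_pM => //; exact: ltW.
have k6 : expR h * `|sin k - k| <= 2 * (e1 * `|k|) by apply: ler_pM => //; exact: ltW.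
have k7 : `|expR h - 1| * `|k| <= e1 * `|k| by apply: ler_wpM2r => //; lra.
lra.
Qed.

Definition cdiff (f : C -> C) (z L : C) :=
  forall e : R, 0 < e -> exists2 d : R, 0 < d & forall w, cmod (w - z) < d ->
    cmod (f w - f z - L * (w - z)) <= e * cmod (w - z).

(** Supplies the hypothesis of [goursat_rect] for a function read in log-polar coordinates; by the
    chain rule its derivative is [L * cexp x y]. *)
Lemma cdiff_cexp f x y L : cdiff f (cexp x y) L ->
  forall e, 0 < e -> exists2 d : R, 0 < d & forall s t,
    `|s - x| < d -> `|t - y| < d ->
    cmod (f (cexp s t) - f (cexp x y)
          - (L * cexp x y) * ((s - x)%:C%C + 'i%C * (t - y)%:C%C))
      <= e * (`|s - x| + `|t - y|).
Proof.
set z := cexp x y => hf e e0.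
have z0 : 0 < cmod z by rewrite cmod_gt0 cexp_neq0.
pose e1 := e / (4 * cmod z); have e10 : 0 < e1 by rewrite divr_gt0 ?mulr_gt0.
have L0 := cmod_ge0 L.
pose M := cmod L + 1; have M0 : 0 < M by rewrite /M; lra.
pose e2 := Num.min 1 (e / (2 * cmod z * M)).
have e20 : 0 < e2 by rewrite lt_min ltr01 divr_gt0 // ?mulr_gt0.
have e21 : e2 <= 1 by rewrite ge_min lexx.
have e22 : e2 * (cmod z * M) <= e / 2.
  have h : e2 <= e / (2 * cmod z * M) by rewrite ge_min lexx orbT.
  apply: le_trans (ler_wpM2r _ h) _; first by rewrite mulr_ge0 // ltW.
  by rewrite le_eqVlt; apply/orP; left; apply/eqP; field; rewrite !gt_eqF.
have [d1 d10 h1] := hf _ e10.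
have [d2 d20 h2] := cexp_approx e20.
pose d := Num.min d2 (d1 / (4 * cmod z)).
exists d; first by rewrite lt_min d20 divr_gt0 // ?mulr_gt0.
move=> s t; rewrite !lt_min => /andP[s1 s2] /andP[t1 t2].
set h := s - x in s1 s2 *; set k := t - y in t1 t2 *.
have -> : cexp s t = z * cexp h k.
  by rewrite -cexpD /h /k ![_ + (_ - _)]addrC !subrK.
have H2 := h2 _ _ s1 t1.
set u := h%:C%C + 'i%C * k%:C%C in H2 *.
have hk : cmod u <= `|h| + `|k|.
  by apply: le_trans (cmodD _ _) _; rewrite cmodM cmod_i mul1r !cmod_real.
have nn : 0 <= `|h| + `|k| by rewrite addr_ge0.
have H3 : cmod (cexp h k - 1) <= 2 * (`|h| + `|k|).
  have := cmodD (cexp h k - 1 - u) u; rewrite subrK; nra.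
have wz : z * cexp h k - z = z * (cexp h k - 1) by ring.
have H4 : cmod (z * cexp h k - z) <= cmod z * (2 * (`|h| + `|k|)).
  by rewrite wz cmodM ler_pM2l.
have d1h : (`|h| + `|k|) * (2 * cmod z) < d1.
  have : `|h| * (4 * cmod z) < d1 by rewrite -ltr_pdivlMr // mulr_gt0.
  have : `|k| * (4 * cmod z) < d1 by rewrite -ltr_pdivlMr // mulr_gt0.
  lra.
have H1 := h1 (z * cexp h k).
have {}H1 : cmod (f (z * cexp h k) - f z - L * (z * cexp h k - z)) <=
   e1 * (cmod z * (2 * (`|h| + `|k|))).
  apply: le_trans (H1 _) _; first by apply: le_lt_trans H4 _; lra.
  by rewrite ler_pM2l.
have -> : f (z * cexp h k) - f z - L * z * u =
   (f (z * cexp h k) - f z - L * (z * cexp h k - z)) + L * z * (cexp h k - 1 - u).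
  by ring.
apply: le_trans (cmodD _ _) _.
have -> : e * (`|h| + `|k|) = e1 * (cmod z * (2 * (`|h| + `|k|))) + (e / 2) * (`|h| + `|k|).
  by rewrite /e1; field; rewrite gt_eqF.
apply: lerD => //; rewrite (cmodM (L * z)) (cmodM L).
apply: (@le_trans _ _ (cmod L * cmod z * (e2 * (`|h| + `|k|)))).
  by apply: ler_wpM2l => //; rewrite mulr_ge0 // ltW.
rewrite mulrA; apply: ler_wpM2r => //; apply: le_trans e22.
have -> : cmod L * cmod z * e2 = e2 * (cmod z * cmod L) by ring.
rewrite ler_pM2l // ler_pM2l // /M; lra.
Qed.

End ComplexExponential.

(** * Calculus of complex derivatives in one variable *)

Section ComplexDerivative.
Variable R : realType.
Local Notation C := (R[i]).
Implicit Types (f g : C -> C) (z w : C).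

Definition ccont f z := forall e : R, 0 < e -> exists2 d : R, 0 < d &
  forall w, cmod (w - z) < d -> cmod (f w - f z) <= e.

Lemma cdiff_lipschitz f z L : cdiff f z L -> exists2 d : R, 0 < d &
  forall w, cmod (w - z) < d -> cmod (f w - f z) <= (cmod L + 1) * cmod (w - z).
Proof.
move=> hf; have [d d0 hd] := hf 1 ltr01; exists d => // w hw.
have := cmodD (f w - f z - L * (w - z)) (L * (w - z)); rewrite subrK cmodM.
by have := hd w hw; rewrite mul1r mulrDl mul1r; lra.
Qed.

Lemma lipschitz_ccont f z (d M : R) : 0 < d -> 0 < M ->
  (forall w, cmod (w - z) < d -> cmod (f w - f z) <= M * cmod (w - z)) -> ccont f z.
Proof.
move=> d0 M0 h e e0; exists (Num.min d (e / M)); first by rewrite lt_min d0 divr_gt0.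
move=> w; rewrite lt_min => /andP[h1 h2]; apply: le_trans (h _ h1) _.
by rewrite mulrC -ler_pdivlMr // ltW.
Qed.

Lemma cdiff_ccont f z L : cdiff f z L -> ccont f z.
Proof.
case/cdiff_lipschitz => d d0 h; apply: (@lipschitz_ccont f z d (cmod L + 1)) => //.
by have := cmod_ge0 L; lra.
Qed.

Lemma cdiff_local f g z L (r : R) : 0 < r ->
  (forall w, cmod (w - z) < r -> f w = g w) -> cdiff f z L -> cdiff g z L.
Proof.
move=> r0 fg hf e e0; have [d d0 hd] := hf e e0.
exists (Num.min r d); first by rewrite lt_min r0.
move=> w; rewrite lt_min => /andP[h1 h2].
by rewrite -!fg // ?subrr ?cmod0 //; exact: hd.
Qed.

Lemma cdiff_id z : cdiff id z 1.
Proof.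
by move=> e e0; exists 1 => // w _; rewrite mul1r subrr cmod0 mulr_ge0 ?cmod_ge0 ?ltW.
Qed.

Lemma cdiff_subC f z L c : cdiff f z L -> cdiff (fun w => f w - c) z L.
Proof.
move=> hf e e0; have [d d0 hd] := hf e e0; exists d => // w /hd.
by have -> : f w - c - (f z - c) = f w - f z by ring.
Qed.

Lemma cdiffM f g z Lf Lg : cdiff f z Lf -> cdiff g z Lg ->
  cdiff (fun w => f w * g w) z (Lf * g z + f z * Lg).
Proof.
move=> hf hg e e0.
have [d1 d10 lg] := cdiff_lipschitz hg.
have M0 := cmod_ge0 Lg; have K0 := cmod_ge0 Lf; have F0 := cmod_ge0 (f z).
have G0 := cmod_ge0 (g z).
pose M := cmod Lg + 1; pose B := cmod (g z) + M; pose K := cmod Lf * M + 1.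
pose F := cmod (f z) + 1.
have Mp : 0 < M by rewrite /M; lra.
have Bp : 0 < B by rewrite /B; lra.
have Kp : 0 < K by rewrite /K ltr_wpDl // mulr_ge0 // ltW.
have Fp : 0 < F by rewrite /F; lra.
have e1 : 0 < e / 3 / B by rewrite !divr_gt0.
have e2 : 0 < e / 3 / F by rewrite !divr_gt0.
have [d2 d20 h2] := hf _ e1; have [d3 d30 h3] := hg _ e2.
exists (Num.min (Num.min 1 d1) (Num.min (Num.min d2 d3) (e / 3 / K))).
  by rewrite !lt_min ltr01 d10 d20 d30 !divr_gt0.
move=> w; rewrite !lt_min => /andP[/andP[w1 wd1] /andP[/andP[wd2 wd3] wk]].
have D0 := cmod_ge0 (w - z).
have L1 := lg _ wd1; have L2 := h2 _ wd2; have L3 := h3 _ wd3.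
set D := cmod (w - z) in w1 wd1 wd2 wd3 wk D0 L1 L2 L3 *.
have gB : cmod (g w) <= B.
  have := cmod_sub_le (g w) (g z); rewrite -/M in L1; rewrite /B; nra.
have -> : f w * g w - f z * g z - (Lf * g z + f z * Lg) * (w - z) =
   (f w - f z - Lf * (w - z)) * g w + f z * (g w - g z - Lg * (w - z))
   + Lf * (w - z) * (g w - g z) by ring.
have k1 := cmodD ((f w - f z - Lf * (w - z)) * g w + f z * (g w - g z - Lg * (w - z))) (Lf * (w - z) * (g w - g z)).
have k2 := cmodD ((f w - f z - Lf * (w - z)) * g w) (f z * (g w - g z - Lg * (w - z))).
apply: le_trans k1 _.
rewrite !cmodM -/D in k2 *.
have t1 : cmod (f w - f z - Lf * (w - z)) * cmod (g w) <= e / 3 * D.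
  apply: (@le_trans _ _ (e / 3 / B * D * B)); last by rewrite mulrAC divfK ?gt_eqF.
  by apply: ler_pM => //; exact: cmod_ge0.
have t2 : cmod (f z) * cmod (g w - g z - Lg * (w - z)) <= e / 3 * D.
  apply: (@le_trans _ _ (F * (e / 3 / F * D))).
    by apply: ler_pM => //; rewrite ?cmod_ge0 // /F; lra.
  by rewrite mulrA [F * _]mulrC divfK ?gt_eqF.
have t3 : cmod Lf * D * cmod (g w - g z) <= e / 3 * D.
  apply: (@le_trans _ _ (cmod Lf * D * (M * D))).
    by apply: ler_wpM2l => //; rewrite mulr_ge0.
  have -> : cmod Lf * D * (M * D) = (D * (cmod Lf * M)) * D by ring.
  apply: ler_wpM2r => //.
  apply: (@le_trans _ _ (D * K)); last by rewrite -ler_pdivlMr // ltW.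
  by apply: ler_wpM2l => //; rewrite /K; lra.
have -> : e * D = e / 3 * D + e / 3 * D + e / 3 * D by field.
lra.
Qed.

Lemma cdiff_invB w z : z != w -> cdiff (fun u => (u - w)^-1) z (- (z - w) ^- 2).
Proof.
move=> zw e e0; set c := z - w.
have c0 : c != 0 by rewrite subr_eq0.
have cp : 0 < cmod c by rewrite cmod_gt0.
exists (Num.min (cmod c / 2) (e * cmod c ^+ 3 / 2)).
  by rewrite lt_min !divr_gt0 // mulr_gt0 // exprn_gt0.
move=> u; rewrite lt_min => /andP[u1 u2].
have hc : cmod c / 2 < cmod (u - w).
  have := cmod_sub_le c (u - w); have -> : c - (u - w) = z - u by rewrite /c; ring.
  by rewrite (cmodB z u); lra.
have hu : 0 < cmod (u - w) by apply: lt_trans hc; rewrite divr_gt0.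
have uw : u - w != 0 by rewrite -cmod_gt0.
have -> : (u - w)^-1 - c^-1 - - c ^- 2 * (u - z) =
   (u - z) * ((u - z) * (c ^+ 2 * (u - w))^-1).
  have -> : u - z = (u - w) - c by rewrite /c; ring.
  by field; rewrite uw c0.
rewrite (cmodM (u - z)) (cmodM (u - z)) cmodV (cmodM (c ^+ 2)) cmodX.
rewrite mulrC; apply: ler_wpM2r; first exact: cmod_ge0.
have p0 : 0 < cmod c ^+ 2 by rewrite exprn_gt0.
rewrite ler_pdivrMr ?mulr_gt0 //; apply: le_trans (ltW u2) _.
rewrite (exprS _ 2) -mulrA ler_pM2l // mulrC mulrA mulrC ler_pM2l //.
lra.
Qed.

End ComplexDerivative.

(** * Means over circles and Cauchy's formula *)

Section CircleMeans.
Variable R : realType.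
Local Notation C := (R[i]).
Local Notation tau := (pi *+ 2 : R).
Implicit Types (f g q : C -> C) (z w : C).

Definition ctends (u : nat -> C) (l : C) := forall e : R, 0 < e ->
  exists N, forall m, (N <= m)%N -> cmod (u m - l) <= e.

Lemma ctendsD u v l k : ctends u l -> ctends v k -> ctends (fun m => u m + v m) (l + k).
Proof.
move=> hu hv e e0; have e2 : 0 < e / 2 by rewrite divr_gt0.
have [N1 h1] := hu _ e2; have [N2 h2] := hv _ e2.
exists (maxn N1 N2) => m; rewrite geq_max => /andP[/h1 k1 /h2 k2].
have -> : u m + v m - (l + k) = (u m - l) + (v m - k) by ring.
by apply: le_trans (cmodD _ _) _; lra.
Qed.

Lemma ctendsZ c u l : ctends u l -> ctends (fun m => c * u m) (c * l).
Proof.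
move=> hu e e0; have M0 : 0 < cmod c + 1 by have := cmod_ge0 c; lra.
have [|N h] := hu (e / (cmod c + 1)); first by rewrite divr_gt0.
exists N => m /h hm; rewrite -mulrBr cmodM.
apply: (@le_trans _ _ ((cmod c + 1) * cmod (u m - l))).
  by apply: ler_wpM2r; rewrite ?cmod_ge0 //; lra.
by rewrite mulrC -ler_pdivlMr.
Qed.

Lemma tau_gt0 : 0 < tau.
Proof. by rewrite mulrn_wgt0 ?pi_gt0. Qed.

Lemma tau_ge0 : 0 <= tau.
Proof. exact: ltW tau_gt0. Qed.

(** Mean over the circle of radius [expR s]. As [dt = dz / (i z)], it stands for the Cauchy integral
    of [f z / z], which is why the kernel below is [z / (z - w)]. *)
Definition cmean m f (s : R) : C :=
  (tau^-1)%:C%C * trap m (fun t => f (cexp s t)) 0 tau.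

Lemma cmeanD m f g s : cmean m (fun z => f z + g z) s = cmean m f s + cmean m g s.
Proof. by rewrite /cmean trapD mulrDr. Qed.

Lemma cmeanZ m c f s : cmean m (fun z => c * f z) s = c * cmean m f s.
Proof. by rewrite /cmean trapZ; ring. Qed.

Lemma cmean_cst m c s : cmean m (fun=> c) s = c.
Proof.
rewrite /cmean (@eq_trap _ _ _ (fun t => c + 0 * t%:C%C)); last first.
  by move=> t; rewrite mul0r addr0.
rewrite trap_affine mul0r addr0 mulrA -rmorphM mulVf ?rmorph1 ?mul1r //.
by rewrite gt_eqF // tau_gt0.
Qed.

Lemma cmean_bound m f s B :
  (forall t, 0 <= t <= tau -> cmod (f (cexp s t)) <= B) -> cmod (cmean m f s) <= B.
Proof.
move=> h; rewrite /cmean cmodM cmod_real ger0_norm ?invr_ge0 ?tau_ge0 //.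
rewrite ler_pdivrMl ?tau_gt0 //; apply: trap_bound; rewrite ?tau_ge0 //.
by move=> t; rewrite add0r; exact: h.
Qed.

Lemma eq_cmean m f g s : (forall z, cmod z = expR s -> f z = g z) ->
  cmean m f s = cmean m g s.
Proof.
by move=> fg; congr (_ * _); apply: eq_trap => t; apply: fg; rewrite cmod_cexp.
Qed.

(** In log-polar coordinates the annulus is a rectangle; its two radial edges cancel by periodicity,
    so Goursat's theorem compares the two circles. *)
Lemma cmean_annulus f (s1 s2 : R) : s1 < s2 ->
  (forall z, expR s1 <= cmod z <= expR s2 -> exists L, cdiff f z L) ->
  ctends (fun m => cmean m f s2 - cmean m f s1) 0.
Proof.
move=> s12 hf.
pose g s t := f (cexp s t).
have a0 : 0 < s2 - s1 by rewrite subr_gt0.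
have H := @goursat_rect R g s1 0 (s2 - s1) tau a0 tau_gt0.
have {}H e : 0 < e -> exists N, forall m, (N <= m)%N ->
    cmod (rect_sum m g s1 0 (s2 - s1) tau) <= e.
  apply: H => x y /andP[x1 x2] _.
  have [|L hL] := hf (cexp x y).
    by rewrite cmod_cexp !ler_expR x1; move: x2; rewrite addrC subrK.
  by exists (L * cexp x y); exact: cdiff_cexp.
move=> e e0; have [|N hN] := H (e * tau); first by rewrite mulr_gt0 ?tau_gt0.
exists N => m /hN; rewrite subr0 /cmean -mulrBr cmodM cmod_real.
rewrite ger0_norm ?invr_ge0 ?tau_ge0 // ler_pdivrMl ?tau_gt0 // [tau * e]mulrC.
rewrite /rect_sum add0r [s1 + _]addrC subrK.
have -> : trap m (g^~ tau) s1 (s2 - s1) = trap m (g^~ 0) s1 (s2 - s1).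
  by apply: eq_trap => t; rewrite /g -[tau]add0r cexp_period.
have -> : forall a b c : C, a + 'i%C * b - a - 'i%C * c = 'i%C * (b - c).
  by move=> a b c; ring.
by rewrite cmodM cmod_i mul1r.
Qed.

(** Compactness of the circle makes the radial continuity uniform in the angle. It is obtained from
    [cousin_rect] on a rectangle of width zero. *)
Lemma ccont_circle q (s : R) : (forall z, cmod z = expR s -> ccont q z) ->
  forall e, 0 < e -> exists2 d : R, 0 < d & forall s' t, 0 <= t <= tau ->
    `|s' - s| < d -> cmod (q (cexp s' t) - q (cexp s t)) <= e.
Proof.
move=> hq e e0.
pose P (s1 t a b : R) := exists2 d : R, 0 < d & forall s' t', t <= t' <= t + b ->
  `|s' - s| < d -> cmod (q (cexp s' t') - q (cexp s t')) <= e.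
have : P s 0 0 tau.
  apply: (@cousin_rect R P); rewrite ?tau_ge0 //.
    move=> s1 t a b [d1 d10 h1] _ [d2 d20 h2] _.
    exists (Num.min d1 d2); first by rewrite lt_min d10.
    move=> s' t' /andP[t1 t2]; rewrite lt_min => /andP[k1 k2].
    have [tb|tb] := leP t' (t + b / 2).
      by apply: h1; rewrite // t1.
    by apply: h2; rewrite // ltW //=; lra.
  move=> x y; rewrite addr0 => hx _.
  have {hx} -> : x = s by apply/eqP; rewrite eq_le andbC.
  have e2 : 0 < e / 2 by rewrite divr_gt0.
  have [|d1 d10 h1] := hq (cexp s y) _ _ e2; first by rewrite cmod_cexp.
  have [d2 d20 h2] := cdiff_cexp (@cdiff_id _ (cexp s y)) ltr01.
  pose M := expR s + 1; have M0 : 0 < M by rewrite /M; have := expR_gt0 s; lra.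
  pose d := Num.min d2 (d1 / (4 * M)).
  have d0 : 0 < d by rewrite lt_min d20 divr_gt0 // mulr_gt0.
  have near s' t' : `|s' - s| < d -> `|t' - y| < d -> cmod (cexp s' t' - cexp s y) < d1.
    rewrite !lt_min => /andP[k1 k2] /andP[k3 k4].
    have := h2 _ _ k1 k3; rewrite mul1r; set u := (_ + _ * _ : C).
    have hu : cmod u <= `|s' - s| + `|t' - y|.
      by apply: le_trans (cmodD _ _) _; rewrite cmodM cmod_i mul1r !cmod_real.
    have := cmodD (cexp s' t' - cexp s y - cexp s y * u) (cexp s y * u).
    rewrite subrK mul1r (cmodM (cexp s y)) cmod_cexp.
    move: k2 k4; rewrite !ltr_pdivlMr ?mulr_gt0 // /M.
    have E := expR_gt0 s.
    have : expR s * cmod u <= expR s * (`|s' - s| + `|t' - y|) by rewrite ler_pM2l.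
    set A := `|s' - s|; set B := `|t' - y|.
    have A0 : 0 <= A by exact: normr_ge0.
    have B0 : 0 <= B by exact: normr_ge0.
    by rewrite !mulrDr !mulr1; nra.
  exists (d / tau); first by rewrite divr_gt0 ?tau_gt0.
  move=> s1 t k /andP[k0 kd] _ /andP[t1 t2].
  have kd' : tau * k < d by rewrite mulrC -ltr_pdivlMr ?tau_gt0.
  exists d => // s' t' /andP[t1' t2'] hs'.
  have ht : `|t' - y| < d by rewrite ltr_norml; apply/andP; split; lra.
  have := cmod_triangle (q (cexp s' t')) (q (cexp s y)) (q (cexp s t')).
  rewrite (cmodB (q (cexp s y))).
  have := h1 _ (near _ _ hs' ht).
  have := h1 (cexp s t'); rewrite near ?subrr ?normr0 // => /(_ isT).
  lra.
case=> d d0 h; exists d => // s' t ht; apply: h; by rewrite add0r.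
Qed.

(* The exceptional point [w] is crossed by continuity of the circle means. *)
Lemma cmean_center q (S : R) w : w != 0 -> cmod w < expR S ->
  (forall z, cmod z <= expR S -> ccont q z) ->
  (forall z, cmod z <= expR S -> z != 0 -> z != w -> exists L, cdiff q z L) ->
  ctends (fun m => cmean m q S) (q 0).
Proof.
move=> w0 wS hc hd e e0.
have wp : 0 < cmod w by rewrite cmod_gt0.
pose s := ln (cmod w).
have sE : expR s = cmod w by rewrite lnK.
have sS : s < S by rewrite -ltr_expR sE.
(* Five comparisons share [e]: from [S] to [s + dd], to [s], to [s - dd], to [s3], and from the
   circle [s3] to the value at 0. The second and third cross the circle through [w]. *)
pose e5 := e / 5; have e50 : 0 < e5 by rewrite divr_gt0.
have [|d d0 hds] := @ccont_circle q s _ e5 e50.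
  by move=> z hz; apply: hc; rewrite hz ler_expR ltW.
pose dd := Num.min (d / 2) ((S - s) / 2).
have dd0 : 0 < dd by rewrite lt_min !divr_gt0 ?subr_gt0.
have ddd : dd < d by apply: (@le_lt_trans _ _ (d / 2)); [rewrite ge_min lexx|lra].
have ddS : dd <= (S - s) / 2 by rewrite ge_min lexx orbT.
have [|r r0 hr] := hc 0 _ _ e50; first by rewrite cmod0 expR_ge0.
pose s3 := Num.min (s - dd - 1) (ln (r / 2)).
have s3a : s3 <= s - dd - 1 by rewrite ge_min lexx.
have s3r : expR s3 <= r / 2.
  have h : s3 <= ln (r / 2) by rewrite ge_min lexx orbT.
  by rewrite -ler_expR lnK ?posrE ?divr_gt0 // in h.
have [||N1 h1] := @cmean_annulus q (s + dd) S _ _ e5 e50; first by lra.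
  move=> z /andP[z1 z2]; have zw : cmod w < cmod z.
    by apply: lt_le_trans z1; rewrite -sE ltr_expR; lra.
  apply: hd => //; first by rewrite -cmod_gt0; apply: le_lt_trans zw; exact: cmod_ge0.
  by apply/eqP => zE; rewrite zE ltxx in zw.
have [||N2 h2] := @cmean_annulus q s3 (s - dd) _ _ e5 e50; first by lra.
  move=> z /andP[z1 z2]; have zw : cmod z < cmod w.
    by apply: le_lt_trans z2 _; rewrite -sE ltr_expR; lra.
  apply: hd; first by apply: ltW; apply: lt_trans wS.
    by rewrite -cmod_gt0; apply: lt_le_trans z1; exact: expR_gt0.
  by apply/eqP => zE; rewrite zE ltxx in zw.
exists (maxn N1 N2) => m; rewrite geq_max => /andP[/h1 + /h2].
rewrite !subr0 => k1 k2.
have mB f g s1 s2 : cmean m f s1 - cmean m g s2 =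
    (tau^-1)%:C%C * trap m (fun t => f (cexp s1 t) - g (cexp s2 t)) 0 tau.
  rewrite /cmean -mulrBr; congr (_ * _).
  rewrite -[- trap _ _ _ _]mulN1r -trapZ -trapD.
  by apply: eq_trap => t; rewrite mulN1r.
have k3 s' : `|s' - s| < d -> cmod (cmean m q s' - cmean m q s) <= e5.
  move=> hs'; rewrite mB cmodM cmod_real ger0_norm ?invr_ge0 ?tau_ge0 //.
  rewrite ler_pdivrMl ?tau_gt0 //; apply: trap_bound; rewrite ?tau_ge0 //.
  by move=> t; rewrite add0r => ht; exact: hds.
have k4 : cmod (cmean m q s3 - q 0) <= e5.
  have -> : cmean m q s3 - q 0 = cmean m (fun z => q z + - q 0) s3.
    by rewrite cmeanD cmean_cst.
  apply: cmean_bound => t _; apply: hr; rewrite subr0 cmod_cexp; lra.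
have k5 := k3 (s + dd); have k6 := k3 (s - dd).
have e1 : s + dd - s = dd by ring.
have e2 : s - dd - s = - dd by ring.
rewrite e1 (gtr0_norm dd0) in k5; rewrite e2 normrN (gtr0_norm dd0) in k6.
have {}k5 := k5 ddd; have {}k6 := k6 ddd.
rewrite cmodB in k6.
have t1 := cmod_triangle (cmean m q S) (cmean m q (s + dd)) (q 0).
have t2 := cmod_triangle (cmean m q (s + dd)) (cmean m q s) (q 0).
have t3 := cmod_triangle (cmean m q s) (cmean m q (s - dd)) (q 0).
have t4 := cmod_triangle (cmean m q (s - dd)) (cmean m q s3) (q 0).
rewrite /e5 in k1 k2 k4 k5 k6; lra.
Qed.

(** The circle is pushed out to a radius [expR T] so large that [z / (z - w) - 1 = w / (z - w)] is
    at most [e / 2]. *)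
Lemma cmean_kernel (S : R) w : cmod w < expR S ->
  ctends (fun m => cmean m (fun z => z / (z - w)) S) 1.
Proof.
move=> wS e e0.
have w0 := cmod_ge0 w.
have e2 : 0 < e / 2 by rewrite divr_gt0.
pose T := ln (cmod w * (1 + (e / 2)^-1) + expR S + 1).
have Tp : 0 < cmod w * (1 + (e / 2)^-1) + expR S + 1.
  have := expR_gt0 S; have : 0 <= cmod w * (1 + (e / 2)^-1).
    by rewrite mulr_ge0 // addr_ge0 // invr_ge0 ltW.
  lra.
have TE : expR T = cmod w * (1 + (e / 2)^-1) + expR S + 1 by rewrite lnK.
have wi : 0 <= cmod w * (e / 2)^-1 by rewrite mulr_ge0 // invr_ge0 ltW.
have ST : S < T by rewrite -ltr_expR TE mulrDr mulr1; lra.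
have [||N hN] := @cmean_annulus (fun z => z / (z - w)) S T _ _ (e / 2) e2 => //.
  move=> z /andP[z1 _]; have zw : z != w.
    by apply/eqP => zE; rewrite zE leNgt wS in z1.
  by eexists; apply: cdiffM; [exact: cdiff_id|exact: cdiff_invB].
exists N => m /hN; rewrite subr0.
have k : cmod (cmean m (fun z => z / (z - w)) T - 1) <= e / 2.
  have -> : cmean m (fun z => z / (z - w)) T - 1 =
            cmean m (fun z => z / (z - w) + -1) T by rewrite cmeanD cmean_cst.
  apply: cmean_bound => t _; set z := cexp T t.
  have zE : cmod z = expR T by rewrite cmod_cexp.
  have zw : cmod w / (e / 2) + expR S + 1 <= cmod (z - w).
    by have := cmod_sub_le z w; rewrite zE TE mulrDr mulr1; lra.
  have zwp : 0 < cmod (z - w).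
    by apply: lt_le_trans zw; have := expR_gt0 S; lra.
  have zw0 : z - w != 0 by rewrite -cmod_gt0.
  have -> : z / (z - w) + -1 = w / (z - w) by field.
  rewrite cmodM cmodV ler_pdivrMr // mulrC -ler_pdivrMr //.
  by apply: le_trans zw; have := expR_gt0 S; lra.
have := cmod_triangle (cmean m (fun z => z / (z - w)) S) (cmean m (fun z => z / (z - w)) T) 1.
by rewrite [X in _ <= X + _]cmodB; lra.
Qed.

(** The difference quotient [q], extended continuously at [w], carries a factor [z] and so vanishes
    at 0; its means tend to 0 by [cmean_center]. Adding [f w] times the kernel gives the formula. *)
Theorem cauchy_formula f (S : R) w : cmod w < expR S ->
  (forall z, cmod z <= expR S -> exists L, cdiff f z L) ->
  ctends (fun m => cmean m (fun z => f z * (z / (z - w))) S) (f w).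
Proof.
move=> wS hf.
have [L hL] := hf w (ltW wS).
pose q z := if z == w then w * L else z * (f z - f w) / (z - w).
have q0 : q 0 = 0.
  by rewrite /q; case: eqP => [<-|_]; rewrite !mul0r.
have qd z : cmod z <= expR S -> z != w -> exists L', cdiff q z L'.
  move=> zS zw; have [Lz hz] := hf z zS.
  eexists; apply: (@cdiff_local _ (fun z => z * (f z - f w) * (z - w)^-1) _ _ _ (cmod (z - w))).
  - by rewrite cmod_gt0 subr_eq0.
  - move=> u hu; rewrite /q; case: eqP => // uw; move: hu.
    by rewrite uw cmodB ltxx.
  - apply: cdiffM; last exact: cdiff_invB.
    by apply: cdiffM; [exact: cdiff_id|apply: cdiff_subC; exact: hz].
have qw : ccont q w.
  pose q1 u := if u == w then L else (f u - f w) / (u - w).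
  have q1c : ccont q1 w.
    move=> e e0; have [d d0 hd] := hL e e0; exists d => // u hu.
    rewrite /q1 eqxx; case: eqP => [_|/eqP uw]; first by rewrite subrr cmod0 ltW.
    have uw0 : u - w != 0 by rewrite subr_eq0.
    have -> : (f u - f w) / (u - w) - L = (f u - f w - L * (u - w)) / (u - w) by field.
    by rewrite cmodM cmodV ler_pdivrMr ?cmod_gt0 //; exact: hd.
  move=> e e0.
  pose M := cmod w + 1; have M0 : 0 < M by rewrite /M; have := cmod_ge0 w; lra.
  pose K := cmod L + 1; have K0 : 0 < K by rewrite /K; have := cmod_ge0 L; lra.
  have e2 : 0 < e / 2 / M by rewrite !divr_gt0.
  have [d d0 hd] := q1c _ e2.
  exists (Num.min (Num.min 1 d) (e / 2 / K)); first by rewrite !lt_min ltr01 d0 !divr_gt0.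
  move=> u; rewrite !lt_min => /andP[/andP[u1 ud] uK].
  have qE v : q v = v * q1 v.
    by rewrite /q /q1; case: eqP => [->|_] //; rewrite mulrA.
  rewrite !qE; have -> : u * q1 u - w * q1 w = u * (q1 u - q1 w) + (u - w) * q1 w by ring.
  have q1w : q1 w = L by rewrite /q1 eqxx.
  apply: le_trans (cmodD _ _) _; rewrite !cmodM q1w.
  have uM : cmod u <= M by have := cmod_sub_le u w; rewrite /M; lra.
  have k1 : cmod u * cmod (q1 u - L) <= M * (e / 2 / M).
    by apply: ler_pM; rewrite ?cmod_ge0 // -q1w; exact: hd.
  have k2 : cmod (u - w) * cmod L <= (e / 2 / K) * K.
    by apply: ler_pM; rewrite ?cmod_ge0 ?(ltW uK) // /K; lra.
  have E1 : M * (e / 2 / M) = e / 2 by field; rewrite gt_eqF.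
  have E2 : e / 2 / K * K = e / 2 by field; rewrite gt_eqF.
  rewrite E1 in k1; rewrite E2 in k2; lra.
have qc z : cmod z <= expR S -> ccont q z.
  move=> zS; have [->//|zw] := eqVneq z w.
  by have [L' h'] := qd z zS zw; exact: cdiff_ccont h'.
have Hq : ctends (fun m => cmean m q S) 0.
  rewrite -q0; have [w0|w0] := eqVneq w 0.
    (* For [w = 0] the exceptional point is the centre, which [cmean_center] already exempts; an
       arbitrary nonzero point fills the other slot. *)
    have h2 : (expR S / 2)%:C%C != 0 :> C.
      by rewrite -cmod_gt0 cmod_real normr_gt0 gt_eqF // divr_gt0 ?expR_gt0.
    apply: (@cmean_center _ _ (expR S / 2)%:C%C) => //.
      by rewrite cmod_real ger0_norm; have := expR_gt0 S; lra.
    by move=> z zS z0 _; apply: qd => //; rewrite w0.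
  by apply: (@cmean_center _ _ w) => // z zS _ zw; exact: qd.
have := ctendsD Hq (ctendsZ (f w) (cmean_kernel wS)).
rewrite add0r mulr1; congr ctends; apply/funext => m.
rewrite -cmeanZ -cmeanD; apply: eq_cmean => z zE.
have zw : z != w by apply/eqP => h; move: wS; rewrite -h zE ltxx.
rewrite /q (negbTE zw); have zw0 : z - w != 0 by rewrite subr_eq0.
by field.
Qed.

End CircleMeans.

(** * A linear limit for all bounded sequences *)

Section GeneralizedLimit.
Variable R : realType.
Local Notation C := (R[i]).

Definition cbounded (u : nat -> C) := exists B : R, forall n, cmod (u n) <= B.

(** Limits along an ultrafilter finer than [eventually]. With such a functional as integral, the
    circle means of a general bounded function need not be shown to converge. *)
Lemma generalized_limit : exists M : (nat -> C) -> C,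
  [/\ forall u v, cbounded u -> cbounded v -> M (fun n => u n + v n) = M u + M v,
      forall c u, cbounded u -> M (fun n => c * u n) = c * M u,
      forall u B, (forall n, cmod (u n) <= B) -> cmod (M u) <= B &
      forall u l, cbounded u -> ctends u l -> M u = l].
Proof.
have [U [UU hU]] := ultraFilterLemma (eventually_filter).
have PU : ProperFilter U by exact: ultra_proper.
have FU : Filter U by exact: filter_filter.
pose ucvg (u : nat -> C) l := forall e : R, 0 < e -> U [set n | cmod (u n - l) < e].
have Ur (c : nat -> R) B : (forall n, `|c n| <= B) ->
    exists l, forall e : R, 0 < e -> U [set n | `|c n - l| < e].
  (* The limit along [U] is the supremum of the levels that lie below [c n] for [U]-almost all
     [n]. *)
  move=> hB; pose S := [set x | U [set n | x <= c n]].
  have Slo : S (- B).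
    apply: (filterS _ (@filterT _ U FU)) => n _ /=.
    by have := hB n; rewrite ler_norml => /andP[].
  have Sub x : S x -> x <= B.
    move=> Sx; rewrite leNgt; apply/negP => Bx.
    apply: (@filter_not_empty _ U PU); apply: filterS Sx => n /= xn.
    by have := hB n; rewrite ler_norml => /andP[_ cB]; move: (lt_le_trans Bx xn); rewrite ltNge cB.
  have hs : has_sup S by split; [exists (- B)|exists B].
  exists (sup S) => e e0.
  have [x Sx xe] := sup_adherent e0 hs.
  have nS : ~ S (sup S + e / 2).
    move=> /(ub_le_sup (proj2 hs)); lra.
  have [//|h2] := in_ultra_setVsetC [set n | sup S + e / 2 <= c n] UU.
  apply: filterS (filterI Sx h2) => n /= [k1 /negP]; rewrite -ltNge => k2.
  by rewrite ltr_norml; apply/andP; split; lra.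
have Uc u : cbounded u -> exists l, ucvg u l.
  move=> [B hB].
  have [n|a ha] := Ur (fun n => complex.Re (u n)) B.
    by apply: le_trans (hB n); case: (u n) => x y; exact: Re_le_cmod.
  have [n|b hb] := Ur (fun n => complex.Im (u n)) B.
    by apply: le_trans (hB n); case: (u n) => x y; exact: Im_le_cmod.
  exists (a +i* b)%C => e e0; have e2 : 0 < e / 2 by rewrite divr_gt0.
  apply: filterS (filterI (ha _ e2) (hb _ e2)) => n /= [k1 k2].
  move: k1 k2; case: (u n) => x y /= k1 k2.
  by apply: le_lt_trans (cmod_le_parts _ _) _; lra.
have Uu u l l' : ucvg u l -> ucvg u l' -> l = l'.
  move=> h h'; apply/eqP; rewrite -subr_eq0 -cmod_eq0; apply/eqP/le_anti.
  rewrite cmod_ge0 andbT leNgt; apply/negP => d0.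
  have d2 : 0 < cmod (l - l') / 2 by rewrite divr_gt0.
  have [n /= [k1 k2]] := @filter_ex _ U PU _ (filterI (h _ d2) (h' _ d2)).
  have := cmod_triangle l (u n) l'; rewrite (cmodB l (u n)); lra.
pose M u := xget 0 [set l | ucvg u l].
have MP u : cbounded u -> ucvg u (M u).
  by move=> /Uc[l hl]; rewrite /M; case: xgetP => [y _ //|/(_ l)].
have ME u l : ucvg u l -> M u = l.
  by move=> h; rewrite /M; case: xgetP => [y _ hy|/(_ l) //]; exact: Uu hy h.
exists M; split.
- move=> u v bu bv; apply: ME => e e0; have e2 : 0 < e / 2 by rewrite divr_gt0.
  apply: filterS (filterI (MP _ bu _ e2) (MP _ bv _ e2)) => n /= [k1 k2].
  have -> : u n + v n - (M u + M v) = (u n - M u) + (v n - M v) by ring.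
  by apply: le_lt_trans (cmodD _ _) _; lra.
- move=> c u bu; apply: ME => e e0.
  have M0 : 0 < cmod c + 1 by have := cmod_ge0 c; lra.
  have e2 : 0 < e / (cmod c + 1) by rewrite divr_gt0.
  apply: filterS (MP _ bu _ e2) => n /=; rewrite ltr_pdivlMr // => k.
  rewrite -mulrBr cmodM; apply: le_lt_trans k.
  by rewrite mulrC ler_wpM2l ?cmod_ge0 //; lra.
- move=> u B hB; rewrite leNgt; apply/negP => h.
  have d0 : 0 < cmod (M u) - B by rewrite subr_gt0.
  have bu : cbounded u by exists B.
  have [n /= k] := @filter_ex _ U PU _ (MP _ bu _ d0).
  have := cmod_sub_le (M u) (u n); rewrite cmodB; have := hB n; lra.
- move=> u l bu h; apply: ME => e e0; apply: hU.
  have e2 : 0 < e / 2 by rewrite divr_gt0.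
  have [N hN] := h _ e2; exists N => // n /= /hN; lra.
Qed.

End GeneralizedLimit.

(** * Means over a torus *)

Section TorusMean.
Variable R : realType.
Local Notation C := (R[i]).
Implicit Types (phi psi h : C -> C -> C).

Definition tbounded (r : R) phi (B : R) :=
  forall z1 z2, cmod z1 = r -> cmod z2 = r -> cmod (phi z1 z2) <= B.

(** The one-variable functional iterated in a fixed order, so that no exchange of limits arises. The
    five clauses are the whole interface through which integration enters later. *)
Lemma torus_mean (r : R) : 0 < r -> exists E : (C -> C -> C) -> C,
  [/\ forall phi psi B B', tbounded r phi B -> tbounded r psi B' ->
        E (fun z1 z2 => phi z1 z2 + psi z1 z2) = E phi + E psi,
      forall c phi B, tbounded r phi B ->
        E (fun z1 z2 => c * phi z1 z2) = c * E phi,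
      forall phi B, tbounded r phi B -> cmod (E phi) <= B,
      forall phi psi, (forall z1 z2, cmod z1 = r -> cmod z2 = r ->
        phi z1 z2 = psi z1 z2) -> E phi = E psi &
      forall h B w1 w2,
        (forall z1 z2, cmod z1 <= r -> cmod z2 <= r -> cmod (h z1 z2) <= B) ->
        cmod w1 < r -> cmod w2 < r ->
        (forall z1 z2, cmod z1 <= r -> cmod z2 <= r ->
           (exists L, cdiff (h^~ z2) z1 L) /\ (exists L, cdiff (h z1) z2 L)) ->
        E (fun z1 z2 => h z1 z2 * (z1 / (z1 - w1)) * (z2 / (z2 - w2))) = h w1 w2].
Proof.
move=> r0; have [M [MD MZ MB ML]] := generalized_limit R.
pose S := ln r; have SE : expR S = r by rewrite lnK.
pose M1 (f : C -> C) := M (fun m => cmean m f S).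
have mb f B m : (forall z, cmod z = r -> cmod (f z) <= B) -> cmod (cmean m f S) <= B.
  by move=> h; apply: cmean_bound => t _; apply: h; rewrite cmod_cexp.
have cb f B : (forall z, cmod z = r -> cmod (f z) <= B) ->
    cbounded (fun m => cmean m f S).
  by move=> h; exists B => m; exact: mb.
have M1D f g B B' : (forall z, cmod z = r -> cmod (f z) <= B) ->
    (forall z, cmod z = r -> cmod (g z) <= B') -> M1 (fun z => f z + g z) = M1 f + M1 g.
  move=> hf hg; rewrite /M1 -MD; [|exact: cb hf|exact: cb hg].
  by congr M; apply/funext => m; rewrite cmeanD.
have M1Z c f B : (forall z, cmod z = r -> cmod (f z) <= B) ->
    M1 (fun z => c * f z) = c * M1 f.
  move=> hf; rewrite /M1 -MZ; last exact: cb hf.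
  by congr M; apply/funext => m; rewrite cmeanZ.
have M1B f B : (forall z, cmod z = r -> cmod (f z) <= B) -> cmod (M1 f) <= B.
  by move=> hf; apply: MB => m; exact: mb.
have M1e f g : (forall z, cmod z = r -> f z = g z) -> M1 f = M1 g.
  move=> fg; rewrite /M1; congr M; apply/funext => m; apply: eq_cmean => z.
  by rewrite SE; exact: fg.
have M1C f B w : (forall z, cmod z = r -> cmod (f z) <= B) -> cmod w < r ->
    (forall z, cmod z <= r -> exists L, cdiff f z L) ->
    M1 (fun z => f z * (z / (z - w))) = f w.
  move=> fB wr hf; apply: ML; last by apply: cauchy_formula; rewrite SE.
  apply: (@cb _ (B * (r / (r - cmod w)))) => z zr.
  have d0 : 0 < r - cmod w by rewrite subr_gt0.
  rewrite !cmodM cmodV; apply: ler_pM; rewrite ?cmod_ge0 ?fB //.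
    by rewrite mulr_ge0 ?invr_ge0 ?cmod_ge0.
  rewrite zr; apply: ler_wpM2l; first exact: ltW.
  have := cmod_sub_le z w; rewrite zr => h.
  by rewrite lef_pV2 ?posrE; lra.
exists (fun phi => M1 (fun z1 => M1 (phi z1))); split.
- move=> phi psi B B' h h'.
  rewrite -(@M1D _ _ B B').
  + apply: (M1e) => z1 k1; apply: (@M1D _ _ B B') => z2 k2; [exact: h|exact: h'].
  + by move=> z1 k1; apply: (M1B) => z2 k2; exact: h.
  + by move=> z1 k1; apply: (M1B) => z2 k2; exact: h'.
- move=> c phi B h; rewrite -(@M1Z _ _ B).
  + by apply: (M1e) => z1 k1; apply: (@M1Z _ _ B) => z2 k2; exact: h.
  + by move=> z1 k1; apply: (M1B) => z2 k2; exact: h.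
- by move=> phi B h; apply: (M1B) => z1 k1; apply: (M1B) => z2 k2; exact: h.
- by move=> phi psi h; apply: (M1e) => z1 k1; apply: (M1e) => z2 k2; exact: h.
- move=> h B w1 w2 hB w1r w2r hd.
  rewrite -(@M1C (h^~ w2) B w1) //.
  + apply: (M1e) => z1 k1.
    have kz : cmod z1 <= r by rewrite k1.
    rewrite -(@M1C (h z1) B w2) //.
    * rewrite [RHS]mulrC -(@M1Z _ _ (B * (r / (r - cmod w2)))).
        by apply: (M1e) => z2 k2; ring.
      move=> z zr; have d0 : 0 < r - cmod w2 by rewrite subr_gt0.
      have hz : cmod (h z1 z) <= B by apply: hB; rewrite ?k1 ?zr.
      rewrite !cmodM cmodV; apply: ler_pM; rewrite ?cmod_ge0 ?hz //.
        by rewrite mulr_ge0 ?invr_ge0 ?cmod_ge0.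
      rewrite zr; apply: ler_wpM2l; first exact: ltW.
      have := cmod_sub_le z w2; rewrite zr => hh.
      by rewrite lef_pV2 ?posrE; lra.
    * by move=> z2 k2; apply: hB; rewrite ?k1 ?k2.
    * by move=> z2 k2; have [] := hd z1 z2 kz k2.
  + by move=> z1 k1; apply: hB; rewrite ?k1 // ltW.
  + by move=> z1 k1; have [] := hd z1 w2 k1 (ltW w2r).
Qed.

End TorusMean.

(** * Cauchy kernels in two variables *)

Section CauchyKernel.
Variable R : realType.
Local Notation C := (R[i]).
Variables (r : R) (E : (C -> C -> C) -> C).
Hypothesis r0 : 0 < r.
Hypothesis ED : forall phi psi B B', tbounded r phi B -> tbounded r psi B' ->
  E (fun z1 z2 => phi z1 z2 + psi z1 z2) = E phi + E psi.
Hypothesis EZ : forall c phi B, tbounded r phi B ->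
  E (fun z1 z2 => c * phi z1 z2) = c * E phi.
Hypothesis EB : forall phi B, tbounded r phi B -> cmod (E phi) <= B.
Hypothesis Ee : forall phi psi, (forall z1 z2, cmod z1 = r -> cmod z2 = r ->
  phi z1 z2 = psi z1 z2) -> E phi = E psi.

(** For [c z1 z2 = h z1 z2 * (z1 * z2)] the exponents [1 1] reproduce [h], and [2 1], [1 2] give its
    partial derivatives. *)
Definition ckernel (c : C -> C -> C) i j (x y : C) : C :=
  E (fun z1 z2 => c z1 z2 * ((z1 - x) ^- i * (z2 - y) ^- j)).

(** Bounds [1 / (z - x)] for [z] on the circle of radius [r] and [x] within half that radius. *)
Let k := 2 / r.

Let k0 : 0 < k.
Proof. by rewrite divr_gt0. Qed.

Let inv_bound z x : cmod z = r -> cmod x < r / 2 ->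
  z - x != 0 /\ cmod (z - x)^-1 <= k.
Proof.
move=> zr xr; have h : r / 2 <= cmod (z - x).
  by have := cmod_sub_le z x; rewrite zr; lra.
have r2 : 0 < r / 2 by rewrite divr_gt0.
have p : 0 < cmod (z - x) by apply: lt_le_trans h.
split; first by rewrite -cmod_gt0.
by rewrite cmodV /k -[2 / r]invf_div lef_pV2 ?posrE.
Qed.

Let tb c B i j x y : tbounded r c B -> cmod x < r / 2 -> cmod y < r / 2 ->
  tbounded r (fun z1 z2 => c z1 z2 * ((z1 - x) ^- i * (z2 - y) ^- j)) (B * (k ^+ i * k ^+ j)).
Proof.
move=> hc hx hy z1 z2 h1 h2.
have [_ i1] := inv_bound h1 hx; have [_ i2] := inv_bound h2 hy.
rewrite cmodM (cmodM (_ ^- i)) -!exprVn !cmodX.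
apply: ler_pM; rewrite ?mulr_ge0 ?cmod_ge0 ?exprn_ge0 ?cmod_ge0 //; first exact: hc.
by apply: ler_pM; rewrite ?exprn_ge0 ?cmod_ge0 // lerXn2r ?nnegrE ?cmod_ge0 ?(ltW k0).
Qed.

(** The resolvent identities [e1] and [e2], used twice, expand the kernel to second order with exact
    remainder [rho], which is quadratic in [(dx, dy)]. *)
Lemma ckernel_diff c B x y x' y' : tbounded r c B ->
  cmod x < r / 2 -> cmod y < r / 2 -> cmod x' < r / 2 -> cmod y' < r / 2 ->
  cmod (ckernel c 1 1 x' y' - ckernel c 1 1 x y
        - (ckernel c 2 1 x y * (x' - x) + ckernel c 1 2 x y * (y' - y)))
  <= B * k ^+ 4 * (cmod (x' - x) + cmod (y' - y)) ^+ 2.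
Proof.
move=> hc hx hy hx' hy'.
set dx := x' - x; set dy := y' - y.
pose rho (z1 z2 : C) := c z1 z2 *
  (dx * (z1 - x)^-1 * (dx * ((z1 - x)^-1 * (z1 - x')^-1 * (z2 - y')^-1)
                       + dy * ((z1 - x)^-1 * (z2 - y)^-1 * (z2 - y')^-1))
   + dy * dy * ((z1 - x)^-1 * (z2 - y)^-1 * ((z2 - y)^-1 * (z2 - y')^-1))).
have D0 := cmod_ge0 dx; have D1 := cmod_ge0 dy.
have hrho : tbounded r rho (B * k ^+ 4 * (cmod dx + cmod dy) ^+ 2).
  move=> z1 z2 h1 h2.
  have [_ i1] := inv_bound h1 hx; have [_ i2] := inv_bound h2 hy.
  have [_ i3] := inv_bound h1 hx'; have [_ i4] := inv_bound h2 hy'.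
  have n1 := cmod_ge0 (z1 - x)^-1; have n2 := cmod_ge0 (z2 - y)^-1.
  have n3 := cmod_ge0 (z1 - x')^-1; have n4 := cmod_ge0 (z2 - y')^-1.
  rewrite /rho cmodM -[B * _ * _]mulrA.
  apply: ler_pM; rewrite ?cmod_ge0 //; first exact: hc.
  apply: le_trans (cmodD _ _) _; rewrite !cmodM.
  apply: (@le_trans _ _ (cmod dx * k * (cmod dx * (k * k * k) + cmod dy * (k * k * k))
      + cmod dy * cmod dy * (k * k * (k * k)))).
    apply: lerD.
      apply: ler_pM; rewrite ?mulr_ge0 ?cmod_ge0 //; first exact: ler_wpM2l.
      apply: le_trans (cmodD _ _) _; rewrite !cmodM.
      by apply: lerD; apply: ler_wpM2l => //; do ?apply: ler_pM; rewrite ?mulr_ge0.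
    by apply: ler_wpM2l; rewrite ?mulr_ge0 //; do ?apply: ler_pM; rewrite ?mulr_ge0.
  have -> : cmod dx * k * (cmod dx * (k * k * k) + cmod dy * (k * k * k))
      + cmod dy * cmod dy * (k * k * (k * k)) =
     k ^+ 4 * (cmod dx ^+ 2 + cmod dx * cmod dy + cmod dy ^+ 2) by ring.
  apply: ler_wpM2l; first by rewrite exprn_ge0 // ltW.
  by have := mulr_ge0 D0 D1; rewrite sqrrD mulr2n; lra.
have -> : ckernel c 1 1 x' y' - ckernel c 1 1 x y
        - (ckernel c 2 1 x y * dx + ckernel c 1 2 x y * dy) = E rho; last exact: EB.
have t1 := tb 1 1 hc hx hy; have t2 := tb 2 1 hc hx hy; have t3 := tb 1 2 hc hx hy.
have tz d phi B' : tbounded r phi B' ->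
    tbounded r (fun z1 z2 => d * phi z1 z2) (cmod d * B').
  by move=> h z1 z2 h1 h2; rewrite cmodM ler_wpM2l ?cmod_ge0 //; exact: h.
have td phi psi B1 B2 : tbounded r phi B1 -> tbounded r psi B2 ->
    tbounded r (fun z1 z2 => phi z1 z2 + psi z1 z2) (B1 + B2).
  move=> h h' z1 z2 h1 h2; apply: le_trans (cmodD _ _) _.
  by apply: lerD; [exact: h|exact: h'].
have s2 := tz dx _ _ t2; have s3 := tz dy _ _ t3.
have u3 := td _ _ _ _ s3 hrho; have u2 := td _ _ _ _ s2 u3.
have -> : ckernel c 1 1 x' y' = ckernel c 1 1 x y +
   (dx * ckernel c 2 1 x y + (dy * ckernel c 1 2 x y + E rho)).
  rewrite /ckernel -(EZ dx t2) -(EZ dy t3) -(ED s3 hrho) -(ED s2 u3) -(ED t1 u2).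
  apply: Ee => z1 z2 h1 h2; rewrite /rho.
  have [i1 _] := inv_bound h1 hx; have [i2 _] := inv_bound h2 hy.
  have [i3 _] := inv_bound h1 hx'; have [i4 _] := inv_bound h2 hy'.
  have e1 : (z1 - x')^-1 = (z1 - x)^-1 + dx * ((z1 - x)^-1 * (z1 - x')^-1).
    by rewrite /dx; field; rewrite i1 i3.
  have e2 : (z2 - y')^-1 = (z2 - y)^-1 + dy * ((z2 - y)^-1 * (z2 - y')^-1).
    by rewrite /dy; field; rewrite i2 i4.
  rewrite !expr1 -!exprVn.
  set A := (z1 - x)^-1 in e1 *; set A' := (z1 - x')^-1 in e1 *.
  set Bb := (z2 - y)^-1 in e2 *; set B' := (z2 - y')^-1 in e2 *.
  suff : A' * B' = A * Bb + (dx * (A ^+ 2 * Bb) + (dy * (A * Bb ^+ 2) +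
     (dx * A * (dx * (A * A' * B') + dy * (A * Bb * B')) + dy * dy * (A * Bb * (Bb * B'))))).
    by move=> ->; ring.
  have q1 : A' * B' = A * Bb + (dx * (A * A' * B') + dy * (A * Bb * B')).
    have -> : A' * B' = A * Bb + ((A' - A) * B' + A * (B' - Bb)) by ring.
    have -> : A' - A = dx * (A * A') by rewrite {1}e1; ring.
    have -> : B' - Bb = dy * (Bb * B') by rewrite {1}e2; ring.
    by ring.
  have -> : A * Bb + (dx * (A ^+ 2 * Bb) + (dy * (A * Bb ^+ 2) +
     (dx * A * (dx * (A * A' * B') + dy * (A * Bb * B')) + dy * dy * (A * Bb * (Bb * B'))))) =
     A * Bb + (dx * A * (A * Bb + (dx * (A * A' * B') + dy * (A * Bb * B')))
               + dy * (A * Bb) * (Bb + dy * (Bb * B'))) by ring.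
  by rewrite -q1 -e2 {1}q1; ring.
by ring.
Qed.

(** Yields the continuity of the partial derivatives. The increments factor through
    [A' - A = dx A A'] and its analogue in the second variable. *)
Lemma ckernel_lip c B x y x' y' : tbounded r c B ->
  cmod x < r / 2 -> cmod y < r / 2 -> cmod x' < r / 2 -> cmod y' < r / 2 ->
  cmod (ckernel c 2 1 x' y' - ckernel c 2 1 x y)
    <= B * (2 * k ^+ 4) * (cmod (x' - x) + cmod (y' - y)) /\
  cmod (ckernel c 1 2 x' y' - ckernel c 1 2 x y)
    <= B * (2 * k ^+ 4) * (cmod (x' - x) + cmod (y' - y)).
Proof.
move=> hc hx hy hx' hy'.
set dx := x' - x; set dy := y' - y.
have D0 := cmod_ge0 dx; have D1 := cmod_ge0 dy.
have N1 phi psi B1 B2 : tbounded r phi B1 -> tbounded r psi B2 ->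
    E phi - E psi = E (fun z1 z2 => phi z1 z2 - psi z1 z2).
  move=> h1 h2.
  rewrite -mulN1r -(EZ _ h2) -(@ED _ _ B1 B2) //.
    by apply: Ee => z1 z2 _ _; rewrite mulN1r.
  by move=> z1 z2 k1 k2; rewrite mulN1r cmodN; exact: h2.
have key z1 z2 : cmod z1 = r -> cmod z2 = r ->
  let A := (z1 - x)^-1 in let A' := (z1 - x')^-1 in
  let Bb := (z2 - y)^-1 in let B' := (z2 - y')^-1 in
  cmod (A' ^+ 2 * B' - A ^+ 2 * Bb) <= 2 * k ^+ 4 * (cmod dx + cmod dy) /\
  cmod (A' * B' ^+ 2 - A * Bb ^+ 2) <= 2 * k ^+ 4 * (cmod dx + cmod dy).
  move=> h1 h2 A A' Bb B'.
  have [i1 j1] := inv_bound h1 hx; have [i2 j2] := inv_bound h2 hy.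
  have [i3 j3] := inv_bound h1 hx'; have [i4 j4] := inv_bound h2 hy'.
  rewrite -/A -/A' -/Bb -/B' in j1 j2 j3 j4.
  have n1 := cmod_ge0 A; have n2 := cmod_ge0 Bb.
  have n3 := cmod_ge0 A'; have n4 := cmod_ge0 B'.
  have e1 : A' - A = dx * (A * A') by rewrite /A /A' /dx; field; rewrite i1 i3.
  have e2 : B' - Bb = dy * (Bb * B') by rewrite /Bb /B' /dy; field; rewrite i2 i4.
  have kk : 0 <= k by exact: ltW.
  have k4 : 0 <= k ^+ 4 by rewrite exprn_ge0.
  split.
    have -> : A' ^+ 2 * B' - A ^+ 2 * Bb =
       (A' - A) * ((A' + A) * B') + A * A * (B' - Bb) by ring.
    rewrite e1 e2; apply: le_trans (cmodD _ _) _; rewrite !cmodM.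
    apply: (@le_trans _ _ (cmod dx * (k * k) * ((k + k) * k) + k * k * (cmod dy * (k * k)))).
      apply: lerD; do ?apply: ler_pM; rewrite ?mulr_ge0 ?addr_ge0 ?cmod_ge0 //.
      by apply: le_trans (cmodD _ _) _; apply: lerD.
    have -> : cmod dx * (k * k) * ((k + k) * k) + k * k * (cmod dy * (k * k)) =
       k ^+ 4 * (2 * cmod dx + cmod dy) by ring.
    rewrite -mulrA mulrCA ler_wpM2l //; lra.
  have -> : A' * B' ^+ 2 - A * Bb ^+ 2 =
     (B' - Bb) * ((B' + Bb) * A') + Bb * Bb * (A' - A) by ring.
  rewrite e1 e2; apply: le_trans (cmodD _ _) _; rewrite !cmodM.
  apply: (@le_trans _ _ (cmod dy * (k * k) * ((k + k) * k) + k * k * (cmod dx * (k * k)))).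
    apply: lerD; do ?apply: ler_pM; rewrite ?mulr_ge0 ?addr_ge0 ?cmod_ge0 //.
    by apply: le_trans (cmodD _ _) _; apply: lerD.
  have -> : cmod dy * (k * k) * ((k + k) * k) + k * k * (cmod dx * (k * k)) =
     k ^+ 4 * (2 * cmod dy + cmod dx) by ring.
  rewrite -mulrA mulrCA ler_wpM2l //; lra.
rewrite /ckernel !(N1 _ _ _ _ (tb _ _ hc _ _) (tb _ _ hc _ _)) //.
split; apply: EB => z1 z2 h1 h2; rewrite -mulrBr cmodM -mulrA -!exprVn !expr1.
  by apply: ler_pM; rewrite ?cmod_ge0 ?hc //; have [] := key _ _ h1 h2.
by apply: ler_pM; rewrite ?cmod_ge0 ?hc //; have [] := key _ _ h1 h2.
Qed.

(** Integrates the identity [z1 z2 / ((z1 - x) (z2 - y)) = 1 + x z2 / ((z1 - x) (z2 - y)) + y / (z2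
    - y)]. The cofactor of [y] depends on [y] alone. *)
Lemma ckernel_hadamard c B x y : tbounded r c B ->
  cmod x < r / 2 -> cmod y < r / 2 ->
  ckernel (fun z1 z2 => c z1 z2 * (z1 * z2)) 1 1 x y =
  ckernel (fun z1 z2 => c z1 z2 * (z1 * z2)) 1 1 0 0
  + ckernel (fun z1 z2 => c z1 z2 * z2) 1 1 x y * x
  + ckernel (fun z1 z2 => c z1 z2 * z1) 1 1 0 y * y.
Proof.
move=> hc hx hy; have h0 : cmod (0 : C) < r / 2 by rewrite cmod0 divr_gt0.
have b0 : tbounded r (fun z1 z2 => c z1 z2 * (z1 * z2)) (B * (r * r)).
  move=> z1 z2 j1 j2; rewrite !cmodM j1 j2 ler_wpM2r ?mulr_ge0 ?(ltW r0) //.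
  exact: hc.
have b1 : tbounded r (fun z1 z2 => c z1 z2 * z2) (B * r).
  by move=> z1 z2 j1 j2; rewrite cmodM j2 ler_wpM2r ?(ltW r0) //; exact: hc.
have b2 : tbounded r (fun z1 z2 => c z1 z2 * z1) (B * r).
  by move=> z1 z2 j1 j2; rewrite cmodM j1 ler_wpM2r ?(ltW r0) //; exact: hc.
have t0 := tb 1 1 b0 h0 h0; have t1 := tb 1 1 b1 hx hy; have t2 := tb 1 1 b2 h0 hy.
have tz d phi B' : tbounded r phi B' ->
    tbounded r (fun z1 z2 => d * phi z1 z2) (cmod d * B').
  by move=> h z1 z2 h1 h2; rewrite cmodM ler_wpM2l ?cmod_ge0 //; exact: h.
have td phi psi B1 B2 : tbounded r phi B1 -> tbounded r psi B2 ->
    tbounded r (fun z1 z2 => phi z1 z2 + psi z1 z2) (B1 + B2).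
  move=> h h' z1 z2 h1 h2; apply: le_trans (cmodD _ _) _.
  by apply: lerD; [exact: h|exact: h'].
rewrite [X in _ = _ + X + _]mulrC [X in _ = _ + X]mulrC /ckernel.
rewrite -(EZ x t1) -(EZ y t2) -(ED t0 (tz _ _ _ t1)).
rewrite -(ED (td _ _ _ _ t0 (tz _ _ _ t1)) (tz _ _ _ t2)).
apply: Ee => z1 z2 h1 h2.
have [i1 _] := inv_bound h1 hx; have [i2 _] := inv_bound h2 hy.
have [i3 _] := inv_bound h1 h0; have [i4 _] := inv_bound h2 h0.
rewrite subr0 in i3; rewrite subr0 in i4.
by rewrite !subr0 !expr1; field; rewrite i1 i2 i3 i4.
Qed.

End CauchyKernel.

(** * Continuity of partial derivatives and Hadamard's lemma *)

Section HoloStructure.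
Variable R : realType.
Local Notation C := (R[i]).
Local Notation CC := (CC R).
Local Notation C2 := (C2 R).

Lemma dist2_ge0 (z a : C2) : 0 <= dist2 z a.
Proof. by rewrite addr_ge0 ?cmod_ge0. Qed.

Definition fcont (u : C2 -> C) (p : C2) := forall e : R, 0 < e ->
  exists2 d : R, 0 < d & forall z, dist2 z p < d -> cmod (u z - u p) <= e.

Lemma fdiff_lipschitz (h : C2 -> C) p L1 L2 : fdiff h p L1 L2 ->
  exists2 d : R, 0 < d & forall z, dist2 z p < d ->
    cmod (h z - h p) <= (cmod L1 + cmod L2 + 1) * dist2 z p.
Proof.
move=> hf; have [d d0 hd] := hf 1 ltr01; exists d => // z hz.
have := cmodD (h z - h p - (L1 * ((z.1 : C) - p.1) + L2 * ((z.2 : C) - p.2)))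
              (L1 * ((z.1 : C) - p.1) + L2 * ((z.2 : C) - p.2)); rewrite subrK.
have := cmodD (L1 * ((z.1 : C) - p.1)) (L2 * ((z.2 : C) - p.2)); rewrite !cmodM.
have := hd z hz; rewrite mul1r !mulrDl mul1r /dist2 !mulrDr.
have := mulr_ge0 (cmod_ge0 L1) (cmod_ge0 ((z.2 : C) - p.2)).
have := mulr_ge0 (cmod_ge0 L2) (cmod_ge0 ((z.1 : C) - p.1)).
lra.
Qed.

Lemma lipschitz_fcont (h : C2 -> C) p (d M : R) : 0 < d -> 0 < M ->
  (forall z, dist2 z p < d -> cmod (h z - h p) <= M * dist2 z p) -> fcont h p.
Proof.
move=> d0 M0 h0 e e0; exists (Num.min d (e / M)); first by rewrite lt_min d0 divr_gt0.
move=> w; rewrite lt_min => /andP[h1 h2]; apply: le_trans (h0 _ h1) _.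
by rewrite mulrC -ler_pdivlMr // ltW.
Qed.

Lemma fdiff_fcont (h : C2 -> C) p L1 L2 : fdiff h p L1 L2 -> fcont h p.
Proof.
case/fdiff_lipschitz => d d0 hd; apply: lipschitz_fcont d0 _ hd.
by have := cmod_ge0 L1; have := cmod_ge0 L2; lra.
Qed.

Lemma fdiff_of_square (h : C2 -> C) p L1 L2 (d M : R) : 0 < d -> 0 <= M ->
  (forall z, dist2 z p < d -> cmod (h z - h p - (L1 * ((z.1 : C) - p.1) + L2 * ((z.2 : C) - p.2)))
     <= M * dist2 z p ^+ 2) -> fdiff h p L1 L2.
Proof.
move=> d0 M0 h0 e e0; have M1 : 0 < M + 1 by lra.
exists (Num.min d (e / (M + 1))); first by rewrite lt_min d0 divr_gt0.
move=> z; rewrite lt_min => /andP[h1 h2]; apply: le_trans (h0 _ h1) _.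
rewrite expr2 mulrA; apply: ler_wpM2r; first exact: dist2_ge0.
have := dist2_ge0 z p; rewrite ltr_pdivlMr // in h2; lra.
Qed.

Lemma fdiff_cdiff (h : C2 -> C) (x y L1 L2 : C) : fdiff h (x, y) L1 L2 ->
  cdiff (fun x => h (x, y)) x L1 /\ cdiff (fun y => h (x, y)) y L2.
Proof.
move=> F; split=> e e0; have [d d0 Hd] := F e e0; exists d => // w hw.
  have := Hd (w, y); rewrite /dist2 /=.
  by rewrite (subrr (y : C)) (mulr0 L2) (addr0 (L1 * _)) cmod0 (addr0 (cmod _)); exact.
have := Hd (x, w); rewrite /dist2 /=.
by rewrite (subrr (x : C)) (mulr0 L1) (add0r (L2 * _)) cmod0 (add0r (cmod _)); exact.
Qed.

Lemma cdiff_shift (f : C -> C) (c z L : C) : cdiff f (c + z) L ->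
  cdiff (fun x => f (c + x)) z L.
Proof.
move=> F e e0; have [d d0 Hd] := F e e0; exists d => // w hw.
by have := Hd (c + w); rewrite opprD addrACA subrr add0r; exact.
Qed.

(** Near [a] the function is a Cauchy kernel over a small torus; the two parts are then
    [ckernel_lip] and [ckernel_hadamard]. *)
Lemma holo_structure (h : C2 -> CC) (a : C2) : holo_near h a ->
  (exists2 d : R, 0 < d & forall p, dist2 p a < d -> fcont (pdx h) p /\ fcont (pdy h) p) /\
  (exists u v : C2 -> CC, [/\ holo_near u a, holo_near v a &
     exists2 d : R, 0 < d & forall z, dist2 z a < d ->
       (h z : C) = (h a : C) + (u z : C) * ((z.1 : C) - a.1) + (v z : C) * ((z.2 : C) - a.2)]).
Proof.
move=> /near_C2P[d0 d00 hd].
have fd p : dist2 p a < d0 -> fdiff h p (pdx h p) (pdy h p).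
  by move=> /hd; exact: differentiable_fdiff.
have aa : dist2 a a = 0 by rewrite /dist2 !subrr cmod0 addr0.
have [|d1 d10 h1] := fdiff_fcont (fd a _) ltr01; first by rewrite aa.
(* In the distance [dist2] the closed polydisc of radius [r] lies within [2 r] of [a], hence inside
   the domain of differentiability [d0] and the ball [d1] on which [h] is bounded. *)
pose r := Num.min d0 d1 / 3.
have r0 : 0 < r by rewrite divr_gt0 // lt_min d00.
have rd0 : 3 * r <= d0 by rewrite /r mulrC divfK ?gt_eqF // ge_min lexx.
have rd1 : 3 * r <= d1 by rewrite /r mulrC divfK ?gt_eqF // ge_min lexx orbT.
pose hh (x y : C) : C := h ((a.1 : C) + x, (a.2 : C) + y).
pose B := cmod (h a) + 1.
have B0 : 0 <= B by rewrite addr_ge0 ?cmod_ge0.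
have hB z1 z2 : cmod z1 <= r -> cmod z2 <= r -> cmod (hh z1 z2) <= B.
  move=> k1 k2; have := cmod_sub_le (hh z1 z2) (h a); rewrite /B.
  have : cmod (hh z1 z2 - h a) <= 1.
    apply: h1; rewrite /dist2 /= !(addrC _ z1) !(addrC _ z2) !addrK; lra.
  lra.
have hD z1 z2 : cmod z1 <= r -> cmod z2 <= r ->
   (exists L, cdiff (hh^~ z2) z1 L) /\ (exists L, cdiff (hh z1) z2 L).
  move=> k1 k2; have /fd F : dist2 ((a.1 : C) + z1, (a.2 : C) + z2) a < d0.
    rewrite /dist2 /= !(addrC _ z1) !(addrC _ z2) !addrK; lra.
  have [F1 F2] := fdiff_cdiff F.
  split.
    by eexists; exact (cdiff_shift F1).
  by eexists; exact (cdiff_shift F2).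
have [E [ED EZ EB Ee EC]] := torus_mean r0.
have r2 : 0 < r / 2 by rewrite divr_gt0.
pose K c i j := @ckernel R E c i j.
pose k := 2 / r.
have k40 : 0 <= k ^+ 4 by rewrite exprn_ge0 // divr_ge0 // ltW.
have Kd c B' : tbounded r c B' -> forall p : C2, dist2 p a < r / 2 ->
   fdiff (fun z => K c 1%N 1%N ((z.1 : C) - a.1) ((z.2 : C) - a.2)) p
     (K c 2%N 1%N ((p.1 : C) - a.1) ((p.2 : C) - a.2)) (K c 1%N 2%N ((p.1 : C) - a.1) ((p.2 : C) - a.2)).
  move=> hc p hp.
  have B'0 : 0 <= B'.
    by apply: le_trans (hc r%:C%C r%:C%C _ _); rewrite ?cmod_ge0 // cmod_real ger0_norm // ltW.
  apply: (@fdiff_of_square _ _ _ _ (r / 2 - dist2 p a) (B' * k ^+ 4)); first by rewrite subr_gt0.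
    by rewrite mulr_ge0.
  move=> z hz; rewrite /dist2.
  have e1 : (z.1 : C) - p.1 = ((z.1 : C) - a.1) - ((p.1 : C) - a.1) by ring.
  have e2 : (z.2 : C) - p.2 = ((z.2 : C) - a.2) - ((p.2 : C) - a.2) by ring.
  have t1 := cmod_triangle z.1 p.1 a.1; have t2 := cmod_triangle z.2 p.2 a.2.
  have n1 := cmod_ge0 ((z.1 : C) - p.1); have n2 := cmod_ge0 ((z.2 : C) - p.2).
  have n3 := cmod_ge0 ((p.1 : C) - a.1); have n4 := cmod_ge0 ((p.2 : C) - a.2).
  rewrite /dist2 in hz hp.
  rewrite e1 e2; apply: ckernel_diff => //; lra.
have Kl c B' : tbounded r c B' -> forall p : C2, dist2 p a < r / 2 ->
   fcont (fun z => K c 2%N 1%N ((z.1 : C) - a.1) ((z.2 : C) - a.2)) p /\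
   fcont (fun z => K c 1%N 2%N ((z.1 : C) - a.1) ((z.2 : C) - a.2)) p.
  move=> hc p hp.
  have B'0 : 0 <= B'.
    by apply: le_trans (hc r%:C%C r%:C%C _ _); rewrite ?cmod_ge0 // cmod_real ger0_norm // ltW.
  have M0 : 0 < B' * (2 * k ^+ 4) + 1 by rewrite ltr_wpDl // mulr_ge0 // mulr_ge0.
  have dd : 0 < r / 2 - dist2 p a by rewrite subr_gt0.
  have key z : dist2 z p < r / 2 - dist2 p a ->
    cmod (K c 2%N 1%N ((z.1 : C) - a.1) ((z.2 : C) - a.2) - K c 2%N 1%N ((p.1 : C) - a.1) ((p.2 : C) - a.2))
     <= B' * (2 * k ^+ 4) * dist2 z p /\
    cmod (K c 1%N 2%N ((z.1 : C) - a.1) ((z.2 : C) - a.2) - K c 1%N 2%N ((p.1 : C) - a.1) ((p.2 : C) - a.2))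
     <= B' * (2 * k ^+ 4) * dist2 z p.
    move=> hz; rewrite /dist2.
    have e1 : (z.1 : C) - p.1 = ((z.1 : C) - a.1) - ((p.1 : C) - a.1) by ring.
    have e2 : (z.2 : C) - p.2 = ((z.2 : C) - a.2) - ((p.2 : C) - a.2) by ring.
    have t1 := cmod_triangle z.1 p.1 a.1; have t2 := cmod_triangle z.2 p.2 a.2.
    have n1 := cmod_ge0 ((z.1 : C) - p.1); have n2 := cmod_ge0 ((z.2 : C) - p.2).
    have n3 := cmod_ge0 ((p.1 : C) - a.1); have n4 := cmod_ge0 ((p.2 : C) - a.2).
    rewrite /dist2 in hz hp.
    rewrite e1 e2; apply: (ckernel_lip r0 ED EZ EB Ee hc); lra.
  split; apply: (lipschitz_fcont dd M0) => z hz; have [j1 j2] := key z hz;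
    rewrite mulrDl mul1r; have := dist2_ge0 z p; lra.
pose c0 (z1 z2 : C) : C := hh z1 z2 * (z1 * z2).
have tbh : tbounded r hh B.
  by move=> z1 z2 j1 j2; have := hB z1 z2; rewrite j1 j2 lexx; exact.
have tc0 : tbounded r c0 (B * (r * r)).
  move=> z1 z2 j1 j2; rewrite /c0 cmodM cmodM j1 j2.
  by apply: ler_wpM2r; [rewrite mulr_ge0 ?(ltW r0)|exact: tbh].
have hK z : dist2 z a < r / 2 -> h z = K c0 1%N 1%N ((z.1 : C) - a.1) ((z.2 : C) - a.2).
  move=> hz; have n1 := cmod_ge0 ((z.1 : C) - a.1); have n2 := cmod_ge0 ((z.2 : C) - a.2).
  rewrite /dist2 in hz.
  have ec (x y : C) : x + (y - x) = y by ring.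
  have hE : hh ((z.1 : C) - a.1) ((z.2 : C) - a.2) = h z.
    by rewrite /hh !ec -surjective_pairing.
  have m1 : cmod ((z.1 : C) - a.1) < r by lra.
  have m2 : cmod ((z.2 : C) - a.2) < r by lra.
  rewrite -hE -(EC hh B _ _ hB m1 m2 hD).
  by apply: Ee => z1 z2 _ _; rewrite /c0 !expr1; ring.
have hloc z : dist2 z a < r / 2 -> exists2 d, 0 < d & forall w, dist2 w z < d -> dist2 w a < r / 2.
  move=> hz; exists (r / 2 - dist2 z a); first by rewrite subr_gt0.
  move=> w hw; have t1 := cmod_triangle w.1 z.1 a.1; have t2 := cmod_triangle w.2 z.2 a.2.
  rewrite /dist2 in hz hw *; lra.
have hpd p : dist2 p a < r / 2 ->
    pdx h p = K c0 2%N 1%N ((p.1 : C) - a.1) ((p.2 : C) - a.2) /\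
    pdy h p = K c0 1%N 2%N ((p.1 : C) - a.1) ((p.2 : C) - a.2).
  move=> hp; have F : fdiff h p (K c0 2%N 1%N ((p.1 : C) - a.1) ((p.2 : C) - a.2)) (K c0 1%N 2%N ((p.1 : C) - a.1) ((p.2 : C) - a.2)).
    move=> e e0; have [d dd0 Hd] := Kd _ _ tc0 p hp e e0.
    have [d' d'0 Hd'] := hloc p hp.
    exists (Num.min d d'); first by rewrite lt_min dd0.
    by move=> z; rewrite lt_min => /andP[j1 j2]; rewrite !hK //; [exact: Hd|exact: Hd'].
  by have [] := fdiff_differentiable F.
split.
  exists (r / 2) => // p hp; have [c1 c2] := Kl _ _ tc0 p hp.
  have [d' d'0 Hd'] := hloc p hp; have [q1 q2] := hpd p hp.
  split=> e e0.
    have [d dd0 Hd] := c1 e e0; exists (Num.min d d'); first by rewrite lt_min dd0.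
    move=> z; rewrite lt_min => /andP[j1 /Hd'/hpd[-> _]]; rewrite q1; exact: Hd.
  have [d dd0 Hd] := c2 e e0; exists (Num.min d d'); first by rewrite lt_min dd0.
  move=> z; rewrite lt_min => /andP[j1 /Hd'/hpd[_ ->]]; rewrite q2; exact: Hd.
pose cu (z1 z2 : C) : C := hh z1 z2 * z2; pose cv (z1 z2 : C) : C := hh z1 z2 * z1.
have tcu : tbounded r cu (B * r).
  move=> z1 z2 j1 j2; rewrite /cu cmodM j2.
  by apply: ler_wpM2r; [exact: ltW|exact: tbh].
have tcv : tbounded r cv (B * r).
  move=> z1 z2 j1 j2; rewrite /cv cmodM j1.
  by apply: ler_wpM2r; [exact: ltW|exact: tbh].
pose u (z : C2) : C := K cu 1%N 1%N ((z.1 : C) - a.1) ((z.2 : C) - a.2).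
pose v (z : C2) : C := K cv 1%N 1%N 0 ((z.2 : C) - a.2).
(* [v] ignores the first coordinate, so its derivative at [p] is read off at [(a.1, p.2)]. *)
have vd p : dist2 p a < r / 2 -> exists L, fdiff v p 0 L.
  move=> hp.
  have hp' : dist2 (a.1, p.2) a < r / 2.
    by have := cmod_ge0 ((p.1 : C) - a.1); move: hp; rewrite /dist2 /= subrr cmod0; lra.
  exists (K cv 1%N 2%N 0 ((p.2 : C) - a.2)) => e e0.
  have [d dd0 Hd] := Kd _ _ tcv _ hp' e e0.
  exists d => // z hz; have := Hd (a.1, z.2); rewrite /dist2 /= !subrr cmod0 mulr0 !add0r mul0r add0r.
  rewrite /dist2 in hz.
  have n := cmod_ge0 ((z.1 : C) - p.1) => Hz.
  apply: le_trans (Hz _) _; first by lra.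
  by apply: ler_wpM2l; [exact: ltW|lra].
exists u, v; split.
- apply/near_C2P; exists (r / 2) => // p hp.
  by have [] := fdiff_differentiable (Kd _ _ tcu p hp).
- apply/near_C2P; exists (r / 2) => // p hp.
  by have [L hL] := vd p hp; have [] := fdiff_differentiable hL.
exists (r / 2) => // z hz.
have [n1 n2] : cmod ((z.1 : C) - a.1) < r / 2 /\ cmod ((z.2 : C) - a.2) < r / 2.
  have := cmod_ge0 ((z.1 : C) - a.1); have := cmod_ge0 ((z.2 : C) - a.2).
  by move: hz; rewrite /dist2; lra.
set x := (z.1 : C) - a.1 in n1 *; set y := (z.2 : C) - a.2 in n2 *.
have c00 : cmod (0 : C) < r / 2 by rewrite cmod0.
rewrite (hK z hz) (hK a); last by rewrite aa.
rewrite /K !subrr -/x -/y; exact: (ckernel_hadamard r0 ED EZ Ee tbh n1 n2).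
Qed.

End HoloStructure.

(** * Inverse function theorem *)

Section RowNorm.
Variable R : realType.
Local Notation C := (R[i]).

Definition vn n (v : 'rV[C]_n) : R := \sum_i cmod (v 0 i).

Lemma vn_ge0 n (v : 'rV[C]_n) : 0 <= vn v.
Proof. by apply: sumr_ge0 => i _; exact: cmod_ge0. Qed.

Lemma vn0 n : vn (0 : 'rV[C]_n) = 0.
Proof. by apply: big1 => i _; rewrite mxE cmod0. Qed.

Lemma vnD n (u v : 'rV[C]_n) : vn (u + v) <= vn u + vn v.
Proof. by rewrite -big_split; apply: ler_sum => i _; rewrite mxE cmodD. Qed.

Lemma vnN n (v : 'rV[C]_n) : vn (- v) = vn v.
Proof. by apply: eq_bigr => i _; rewrite mxE cmodN. Qed.

Lemma vnB n (u v : 'rV[C]_n) : vn (u - v) = vn (v - u).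
Proof. by rewrite -vnN opprB. Qed.

Lemma vn_triangle n (u v w : 'rV[C]_n) : vn (u - w) <= vn (u - v) + vn (v - w).
Proof. by have := vnD (u - v) (v - w); rewrite addrA subrK. Qed.

Lemma cmod_le_vn n (v : 'rV[C]_n) i : cmod (v 0 i) <= vn v.
Proof.
by rewrite /vn (bigD1 i) //= lerDl; apply: sumr_ge0 => j _; exact: cmod_ge0.
Qed.

Lemma vn_eq0 n (v : 'rV[C]_n) : vn v <= 0 -> v = 0.
Proof.
move=> h; apply/rowP => i; rewrite mxE; apply/eqP; rewrite -cmod_eq0.
by apply/eqP/le_anti; rewrite cmod_ge0 andbT (le_trans (cmod_le_vn v i)).
Qed.

Lemma vnZ n (c : C) (v : 'rV[C]_n) : vn (c *: v) = cmod c * vn v.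
Proof. by rewrite /vn mulr_sumr; apply: eq_bigr => i _; rewrite mxE cmodM. Qed.

Definition mxn m n (A : 'M[C]_(m, n)) : R := \sum_i \sum_j cmod (A i j).

Lemma mxn_ge0 m n (A : 'M[C]_(m, n)) : 0 <= mxn A.
Proof. by do 2![apply: sumr_ge0 => ? _]; exact: cmod_ge0. Qed.

Lemma vn_mulmx m n (v : 'rV[C]_m) (A : 'M[C]_(m, n)) : vn (v *m A) <= mxn A * vn v.
Proof.
apply: (@le_trans _ _ (\sum_j \sum_i cmod (v 0 i) * cmod (A i j))).
  apply: ler_sum => j _; rewrite mxE; apply: le_trans (cmod_le_sum _) _.
  by apply: ler_sum => i _; rewrite cmodM.
rewrite exchange_big /= /mxn mulr_suml; apply: ler_sum => i _.
rewrite mulr_suml; apply: ler_sum => j _; rewrite mulrC.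
by apply: ler_wpM2l; rewrite ?cmod_ge0 ?cmod_le_vn.
Qed.

(** The intervals of radius [2 c 2^-n] around [u n] are nested; their common point is the limit. *)
Lemma real_geometric_limit (u : nat -> R) (c : R) :
  (forall n, `|u n.+1 - u n| <= c * 2^-1 ^+ n) ->
  exists l, forall n, `|u n - l| <= 2 * c * 2^-1 ^+ n.
Proof.
move=> h; have kE n : (2^-1 : R) ^+ n.+1 = 2^-1 ^+ n / 2 by rewrite exprSr.
have [|||l hl] := @nested_intervals R (fun n => u n - 2 * c * 2^-1 ^+ n)
                               (fun n => u n + 2 * c * 2^-1 ^+ n).
- by move=> n; have := h n; rewrite ler_norml kE => /andP[]; lra.
- by move=> n; have := h n; rewrite ler_norml kE => /andP[]; lra.
- by move=> n; have := normr_ge0 (u n.+1 - u n); have := h n; lra.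
exists l => n; have := hl n; rewrite ler_norml => /andP[h1 h2].
by apply/andP; split; lra.
Qed.

Lemma row_geometric_limit n (u : nat -> 'rV[C]_n) (c : R) :
  (forall k, vn (u k.+1 - u k) <= c * 2^-1 ^+ k) ->
  exists (l : 'rV[C]_n) (K : R), forall k, vn (u k - l) <= K * 2^-1 ^+ k.
Proof.
move=> h.
have hc i k : cmod (u k.+1 0 i - u k 0 i) <= c * 2^-1 ^+ k.
  by apply: le_trans (h k); have := cmod_le_vn (u k.+1 - u k) i; rewrite !mxE.
have hi i : exists z : C, forall k, cmod (u k 0 i - z) <= 4 * c * 2^-1 ^+ k.
  have [k|a ha] := @real_geometric_limit (fun k => complex.Re (u k 0 i)) c.
    apply: le_trans (hc i k); case: (u k.+1 0 i) => x y; case: (u k 0 i) => x' y' /=.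
    exact: Re_le_cmod.
  have [k|b hb] := @real_geometric_limit (fun k => complex.Im (u k 0 i)) c.
    apply: le_trans (hc i k); case: (u k.+1 0 i) => x y; case: (u k 0 i) => x' y' /=.
    exact: Im_le_cmod.
  exists (a +i* b)%C => k; have := ha k; have := hb k.
  case: (u k 0 i) => x y /= h1 h2; apply: le_trans (cmod_le_parts _ _) _; lra.
have [z hz] := choice hi.
exists (\row_i z i), (4 * c *+ n) => k.
apply: (@le_trans _ _ (\sum_(i < n) 4 * c * 2^-1 ^+ k)).
  by apply: ler_sum => i _; rewrite !mxE hz.
by rewrite sumr_const card_ord -(mulrnAl (4 * c)) lexx.
Qed.

Lemma le0_of_geometric (x K : R) : (forall k, x <= K * 2^-1 ^+ k) -> x <= 0.
Proof.
move=> h; rewrite leNgt; apply/negP => x0.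
have K0 : 0 < K.
  by have := h 0%N; rewrite expr0 mulr1; exact: lt_le_trans.
have [k hk] := @exp2V_small R (x / K) (divr_gt0 x0 K0).
by have := h k; rewrite leNgt mulrC -ltr_pdivlMr ?hk.
Qed.

(** Banach's fixed point theorem with ratio one half. A first step of [rho / 4] keeps the orbit
    within [rho / 2], so the fixed point lies strictly inside the ball. *)
Lemma contraction_fixpoint n (N : 'rV[C]_n -> 'rV[C]_n) (z0 : 'rV[C]_n) (rho : R) :
  0 < rho ->
  (forall u v, vn (u - z0) <= rho -> vn (v - z0) <= rho ->
     vn (N u - N v) <= 2^-1 * vn (u - v)) ->
  vn (N z0 - z0) <= rho / 4 ->
  exists2 l, vn (l - z0) < rho & N l = l.
Proof.
move=> rho0 NL hN0.
have [u [u0 uS]] : exists u : nat -> 'rV[C]_n, u 0%N = z0 /\ forall k, u k.+1 = N (u k).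
  by exists (fun k => iter k N z0).
have kp k : 0 < (2^-1 : R) ^+ k by rewrite exprn_gt0 // invr_gt0.
have kE k : (2^-1 : R) ^+ k.+1 = 2^-1 ^+ k / 2 by rewrite exprSr.
have b k : rho / 2 * (1 - 2^-1 ^+ k) <= rho / 2.
  by rewrite ler_piMr ?divr_ge0 ?(ltW rho0) // lerBlDr lerDl ltW.
have b2 : rho / 2 <= rho by lra.
have hu k : vn (u k - z0) <= rho / 2 * (1 - 2^-1 ^+ k) /\
            vn (u k.+1 - u k) <= rho / 4 * 2^-1 ^+ k.
  elim: k => [|k [IH1 IH2]].
    by rewrite uS u0 subrr vn0 expr0 subrr mulr0 mulr1.
  have c1 : vn (u k.+1 - z0) <= rho / 2 * (1 - 2^-1 ^+ k.+1).
    apply: le_trans (vn_triangle _ (u k) _) _; apply: le_trans (lerD IH2 IH1) _.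
    by rewrite kE; move: (2^-1 ^+ k : R) => x; lra.
  split => //.
  have := NL (u k.+1) (u k) (le_trans (le_trans c1 (b _)) b2) (le_trans (le_trans IH1 (b _)) b2).
  rewrite -!uS => h; apply: le_trans h _; rewrite kE.
  by apply: le_trans (ler_wpM2l _ IH2) _; [lra|move: (2^-1 ^+ k : R) => x; lra].
have [l [M hl]] := @row_geometric_limit n u (rho / 4) (fun k => (hu k).2).
have lz : vn (l - z0) <= rho / 2.
  rewrite -subr_le0; apply: (@le0_of_geometric _ M) => k; rewrite lerBlDr.
  apply: le_trans (vn_triangle _ (u k) _) _; rewrite vnB; apply: lerD => //.
  by have [h _] := hu k; exact: le_trans h (b k).
have lz' : vn (l - z0) < rho by apply: le_lt_trans lz _; lra.
exists l => //; apply/eqP; rewrite -subr_eq0; apply/eqP/vn_eq0.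
apply: (@le0_of_geometric _ M) => k.
have c1 : vn (u k - z0) <= rho by have [h _] := hu k; exact: le_trans (le_trans h (b k)) b2.
apply: le_trans (vn_triangle _ (N (u k)) _) _.
have h1 := NL l (u k) (ltW lz') c1; rewrite vnB in h1.
have h2 := hl k; have h3 := hl k.+1; rewrite kE uS in h3; rewrite vnB.
apply: le_trans (lerD h1 h3) _; rewrite (vnB l).
by apply: le_trans (lerD (ler_wpM2l _ h2) (lexx _)) _; [lra|move: (2^-1 ^+ k : R) => x; lra].
Qed.

End RowNorm.

(** * Strict differentiability and the inverse function theorem *)

Section StrictDifferentiability.
Variable R : realType.
Local Notation C := (R[i]).

(** Both arguments move, as in the usual consequence of being continuously differentiable. This is
    exactly what makes Newton's map a contraction, and it is stable under composition. *)
Definition strict_diff m n (H : 'rV[C]_m -> 'rV[C]_n) (z : 'rV[C]_m) (A : 'M[C]_(m, n)) :=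
  forall e : R, 0 < e -> exists2 d : R, 0 < d & forall u v,
    vn (u - z) < d -> vn (v - z) < d ->
    vn (H u - H v - (u - v) *m A) <= e * vn (u - v).

Lemma strict_diff_lip m n (H : 'rV[C]_m -> 'rV[C]_n) z A : strict_diff H z A ->
  exists2 d : R, 0 < d & forall u v, vn (u - z) < d -> vn (v - z) < d ->
    vn (H u - H v) <= (mxn A + 1) * vn (u - v).
Proof.
move=> h; have [d d0 hd] := h 1 ltr01; exists d => // u v hu hv.
have := vnD (H u - H v - (u - v) *m A) ((u - v) *m A); rewrite subrK.
by have := hd u v hu hv; have := vn_mulmx (u - v) A; rewrite mulrDl !mul1r; lra.
Qed.

Lemma strict_diff_comp m n p (G : 'rV[C]_n -> 'rV[C]_p) (H : 'rV[C]_m -> 'rV[C]_n) z A B :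
  strict_diff H z A -> strict_diff G (H z) B -> strict_diff (G \o H) z (A *m B).
Proof.
move=> hH hG e e0.
have M0 := mxn_ge0 A; have N0 := mxn_ge0 B.
have [d1 d10 h1] := strict_diff_lip hH.
have e1 : 0 < e / 2 / (mxn A + 1) by rewrite !divr_gt0 //; lra.
have e2 : 0 < e / 2 / (mxn B + 1) by rewrite !divr_gt0 //; lra.
have [d2 d20 h2] := hG _ e1; have [d3 d30 h3] := hH _ e2.
have zz : vn (z - z) = 0 by rewrite subrr vn0.
exists (Num.min (Num.min d1 d3) (d2 / (mxn A + 1))).
  by rewrite !lt_min d10 d30 divr_gt0 //; lra.
have A1 : 0 < mxn A + 1 by lra.
have B1 : 0 < mxn B + 1 by lra.
have near u : vn (u - z) < d1 -> vn (u - z) < d2 / (mxn A + 1) -> vn (H u - H z) < d2.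
  move=> k1 k2; apply: (le_lt_trans (h1 u z k1 _)); first by rewrite zz.
  by rewrite mulrC -ltr_pdivlMr.
move=> u v; rewrite !lt_min => /andP[/andP[u1 u3] u2] /andP[/andP[v1 v3] v2].
have k1 := h2 _ _ (near u u1 u2) (near v v1 v2).
have k2 := h3 _ _ u3 v3; have k3 := h1 _ _ u1 v1.
have -> : (G \o H) u - (G \o H) v - (u - v) *m (A *m B) =
   (G (H u) - G (H v) - (H u - H v) *m B) + (H u - H v - (u - v) *m A) *m B.
  rewrite /= (mulmxBl (H u - H v)) mulmxA.
  move: ((H u - H v) *m B) ((u - v) *m A *m B) => x y.
  by apply/rowP => i; rewrite !mxE; ring.
apply: le_trans (vnD _ _) _.
have -> : e * vn (u - v) = e / 2 / (mxn A + 1) * ((mxn A + 1) * vn (u - v)) +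
    (mxn B + 1) * (e / 2 / (mxn B + 1) * vn (u - v)).
  by field; rewrite !gt_eqF.
apply: lerD.
  by apply: le_trans k1 _; apply: ler_wpM2l => //; exact: ltW.
apply: le_trans (vn_mulmx _ _) _.
by apply: ler_pM; rewrite ?vn_ge0 //; lra.
Qed.

(** Newton's map with frozen derivative, [z - (H z - w) *m B], is a contraction near [z0] whose
    fixed points solve [H z = w]. The bound [Lip] then gives injectivity and the differentiability
    of the inverse. *)
Theorem inverse_function n (H : 'rV[C]_n -> 'rV[C]_n) (z0 : 'rV[C]_n)
    (D : 'rV[C]_n -> 'M[C]_n) (r : R) : 0 < r ->
  (forall z, vn (z - z0) < r -> strict_diff H z (D z)) -> D z0 \in unitmx ->
  exists (K : 'rV[C]_n -> 'rV[C]_n) (s : R), [/\ 0 < s, K (H z0) = z0,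
    forall w, vn (w - H z0) < s -> H (K w) = w,
    forall z, vn (z - z0) < s -> K (H z) = z &
    forall w, vn (w - H z0) < s -> strict_diff K w (invmx (D (K w)))].
Proof.
move=> r0 hD U; set B := invmx (D z0); set w0 := H z0.
have zz : vn (z0 - z0) = 0 by rewrite subrr vn0.
have B0 := mxn_ge0 B; have B1 : 0 < mxn B + 1 by lra.
(* Multiplication by [B] turns this tolerance into a contraction factor of at most one half. *)
have e0 : 0 < (2 * (mxn B + 1))^-1 by rewrite invr_gt0 mulr_gt0.
have h0 := hD z0; rewrite zz in h0; have [d d0 hd] := h0 r0 _ e0.
pose rho := Num.min d r / 2.
have dr0 : 0 < Num.min d r by rewrite lt_min d0.
have rho0 : 0 < rho by rewrite divr_gt0.
have rhod : rho < d.
  have : Num.min d r <= d by rewrite ge_min lexx. rewrite /rho; lra.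
have rhor : rho < r.
  have : Num.min d r <= r by rewrite ge_min lexx orbT. rewrite /rho; lra.
pose N w z := z - (H z - w) *m B.
have NL w u v : vn (u - z0) <= rho -> vn (v - z0) <= rho ->
    vn (N w u - N w v) <= 2^-1 * vn (u - v).
  move=> hu hv.
  have -> : N w u - N w v = - ((H u - H v - (u - v) *m D z0) *m B).
    rewrite mulmxBl -[_ *m D z0 *m B]mulmxA mulmxV // mulmx1 mulmxBl /N !mulmxBl.
    move: (H u *m B) (H v *m B) (w *m B) => p q x.
    by apply/rowP => i; rewrite !mxE; ring.
  rewrite vnN; apply: le_trans (vn_mulmx _ _) _.
  have h := hd u v (le_lt_trans hu rhod) (le_lt_trans hv rhod).
  apply: (@le_trans _ _ ((mxn B + 1) * ((2 * (mxn B + 1))^-1 * vn (u - v)))).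
    by apply: ler_pM; rewrite ?vn_ge0 //; lra.
  by rewrite le_eqVlt; apply/orP; left; apply/eqP; field; rewrite gt_eqF.
have fixE w z : N w z = z -> H z = w.
  rewrite /N => /eqP; rewrite -subr_eq0 addrAC subrr sub0r oppr_eq0 => /eqP h.
  apply/eqP; rewrite -subr_eq0; apply/eqP.
  by rewrite -[LHS]mulmx1 -(mulVmx U) mulmxA h mul0mx.
have Lip u v : vn (u - z0) <= rho -> vn (v - z0) <= rho ->
    vn (u - v) <= 2 * (mxn B * vn (H u - H v)).
  move=> hu hv; have h1 := NL (H u) u v hu hv.
  have E : u - v = (N (H u) u - N (H u) v) + (H u - H v) *m B.
    rewrite /N !mulmxBl; move: (H u *m B) (H v *m B) => p q.
    by apply/rowP => i; rewrite !mxE; ring.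
  have h2 := vnD (N (H u) u - N (H u) v) ((H u - H v) *m B).
  rewrite -E in h2; have h3 := vn_mulmx (H u - H v) B; lra.
(* For [w] this close to [w0] the first Newton step has length at most [rho / 4], as
   [contraction_fixpoint] requires. *)
pose s := rho / (4 * (mxn B + 1)).
have s0 : 0 < s by rewrite divr_gt0 // mulr_gt0.
have sB : mxn B * s <= rho / 4.
  apply: (@le_trans _ _ ((mxn B + 1) * s)); first by apply: ler_wpM2r; [exact: ltW|lra].
  by rewrite /s le_eqVlt; apply/orP; left; apply/eqP; field; rewrite gt_eqF.
have solve w : vn (w - w0) < s -> exists2 z, vn (z - z0) < rho & H z = w.
  move=> hw.
  have hN0 : vn (N w z0 - z0) <= rho / 4.
    have -> : N w z0 - z0 = (w - w0) *m B.
      rewrite /N /w0 !mulmxBl; move: (H z0 *m B) (w *m B) => p q.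
      by apply/rowP => i; rewrite !mxE; ring.
    apply: le_trans (vn_mulmx _ _) _; apply: le_trans sB.
    by apply: ler_wpM2l => //; exact: ltW.
  have [l lz lE] := contraction_fixpoint rho0 (NL w) hN0.
  by exists l => //; exact: fixE.
have [K0 hK0] : exists K : 'rV[C]_n -> 'rV[C]_n, forall w, vn (w - w0) < s ->
    vn (K w - z0) < rho /\ H (K w) = w.
  have : forall w, exists z, vn (w - w0) < s -> vn (z - z0) < rho /\ H z = w.
    move=> w; have [h|h] := pselect (is_true (vn (w - w0) < s)); last by exists z0.
    by have [z z1 z2] := solve w h; exists z.
  by case/choice => K hK; exists K.
have ww : vn (w0 - w0) < s by rewrite subrr vn0.
have inj u v : vn (u - z0) < rho -> vn (v - z0) < rho -> H u = H v -> u = v.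
  move=> hu hv E; apply/eqP; rewrite -subr_eq0; apply/eqP/vn_eq0.
  by have := Lip u v (ltW hu) (ltW hv); rewrite E subrr vn0 !mulr0.
have [d2 d20 h2] := strict_diff_lip (h0 r0).
have A1 : 0 < mxn (D z0) + 1 by have := mxn_ge0 (D z0); lra.
pose s1 := Num.min s (Num.min rho (Num.min d2 (s / (mxn (D z0) + 1)))).
have s1s : s1 <= s by rewrite ge_min lexx.
exists K0, s1; split.
- by rewrite !lt_min s0 rho0 d20 divr_gt0.
- have [h1 h3] := hK0 w0 ww; apply: inj => //; by rewrite zz.
- by move=> w hw; have [] := hK0 w (lt_le_trans hw s1s).
- move=> z; rewrite !lt_min => /and4P[_ z1 z2 z3].
  have hw : vn (H z - w0) < s.
    apply: (le_lt_trans (h2 z z0 z2 _)); first by rewrite zz.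
    by rewrite mulrC -ltr_pdivlMr.
  have [k1 k2] := hK0 _ hw; exact: inj.
move=> w1 hw1; have {}hw1 := lt_le_trans hw1 s1s.
have [kz kH] := hK0 _ hw1; set z1 := K0 w1 in kz kH *.
have hz1 := hD z1 (lt_trans kz rhor).
(* A kernel vector [x] of [D z1] would make [H] nearly stationary along [x], against the lower bound
   [Lip]; the factor [t] keeps [z1 + t x] inside the ball. *)
have U1 : D z1 \in unitmx.
  rewrite -row_free_unit; apply: inj_row_free => x xD.
  have e1 : 0 < (4 * (mxn B + 1))^-1 by rewrite invr_gt0 mulr_gt0.
  have [d1 d10 h1] := hz1 _ e1.
  pose m := Num.min d1 (rho - vn (z1 - z0)).
  have m0 : 0 < m by rewrite lt_min d10 subr_gt0.
  have X0 := vn_ge0 x.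
  pose t := m / (2 * (vn x + 1)).
  have t0 : 0 < t by rewrite divr_gt0 // mulr_gt0 //; lra.
  have tx : t * vn x <= m / 2.
    apply: (@le_trans _ _ (t * (vn x + 1))); first by apply: ler_wpM2l; [exact: ltW|lra].
    by rewrite /t le_eqVlt; apply/orP; left; apply/eqP; field; rewrite gt_eqF //; lra.
  have md1 : m <= d1 by rewrite ge_min lexx.
  have mr : m <= rho - vn (z1 - z0) by rewrite ge_min lexx orbT.
  pose u := z1 + t%:C%C *: x.
  have uz : u - z1 = t%:C%C *: x by rewrite /u addrC addKr.
  have vu : vn (u - z1) = t * vn x by rewrite uz vnZ cmod_real gtr0_norm.
  have z11 : vn (z1 - z1) = 0 by rewrite subrr vn0.
  have := h1 u z1; rewrite vu z11 uz -scalemxAl xD scaler0 subr0.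
  have c1 : t * vn x < d1 by lra.
  move=> /(_ c1 d10) k1.
  have c2 : vn (u - z0) <= rho by have := vn_triangle u z1 z0; lra.
  have k2 := Lip u z1 c2 (ltW kz); rewrite vu in k2.
  have k3 : t * vn x <= 2^-1 * (t * vn x).
    apply: le_trans k2 _.
    apply: (@le_trans _ _ (2 * ((mxn B + 1) * ((4 * (mxn B + 1))^-1 * (t * vn x))))).
      by apply: ler_wpM2l => //; apply: ler_pM; rewrite ?vn_ge0 //; lra.
    by rewrite le_eqVlt; apply/orP; left; apply/eqP; field; rewrite gt_eqF.
  have k4 : t * vn x <= 0 by lra.
  by apply: vn_eq0; rewrite -(pmulr_rle0 _ t0).
set Ai := invmx (D z1) => e ee0.
have I0 := mxn_ge0 Ai; have I1 : 0 < mxn Ai + 1 by lra.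
have e1 : 0 < e / ((mxn Ai + 1) * (2 * (mxn B + 1))) by rewrite divr_gt0 // !mulr_gt0.
have [d1 d10 h1] := hz1 _ e1.
exists (Num.min (s - vn (w1 - w0)) (d1 / (2 * (mxn B + 1)))).
  by rewrite lt_min subr_gt0 hw1 divr_gt0 // mulr_gt0.
have near w : vn (w - w1) < Num.min (s - vn (w1 - w0)) (d1 / (2 * (mxn B + 1))) ->
    [/\ vn (K0 w - z0) < rho, H (K0 w) = w & vn (K0 w - z1) < d1].
  rewrite lt_min => /andP[k1 k2].
  have hw : vn (w - w0) < s by have := vn_triangle w w1 w0; lra.
  have [k3 k4] := hK0 w hw; split => //.
  have := Lip _ _ (ltW k3) (ltW kz); rewrite k4 kH; move=> k5.
  apply: (le_lt_trans k5); rewrite ltr_pdivlMr ?mulr_gt0 // in k2.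
  by have := vn_ge0 (w - w1); lra.
move=> w w' /near[k1 k2 k3] /near[k1' k2' k3'].
have k4 := h1 _ _ k3 k3'; have k5 := Lip _ _ (ltW k1) (ltW k1').
rewrite k2 k2' in k4 k5; set z := K0 w in k1 k2 k3 k4 k5 *.
set z' := K0 w' in k1' k2' k3' k4 k5 *.
have -> : z - z' - (w - w') *m Ai = - ((w - w' - (z - z') *m D z1) *m Ai).
  by rewrite (mulmxBl (w - w')) -[_ *m D z1 *m Ai]mulmxA mulmxV // mulmx1 opprB.
rewrite vnN; apply: le_trans (vn_mulmx _ _) _.
apply: (@le_trans _ _ ((mxn Ai + 1) * (e / ((mxn Ai + 1) * (2 * (mxn B + 1))) * (2 * ((mxn B + 1) * vn (w - w')))))).
  apply: ler_pM; rewrite ?vn_ge0 //; first by lra.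
  apply: le_trans k4 _; apply: ler_wpM2l; first exact: ltW.
  by have := vn_ge0 (w - w'); lra.
by rewrite le_eqVlt; apply/orP; left; apply/eqP; field; rewrite !gt_eqF.
Qed.

End StrictDifferentiability.

(** * Strict differentiability of scalar functions *)

Section ScalarStrictDiff.
Variable R : realType.
Local Notation C := (R[i]).

(** The derivative is kept as a function, its column being known only to exist, so that the rules
    for sums and products produce readable formulas. *)
Definition sdiff n (h : 'rV[C]_n -> C) (z : 'rV[C]_n) (L : 'rV[C]_n -> C) :=
  (exists c : 'cV[C]_n, forall x, L x = (x *m c) 0 0) /\
  forall e : R, 0 < e -> exists2 d : R, 0 < d & forall u v,
    vn (u - z) < d -> vn (v - z) < d ->
    cmod (h u - h v - L (u - v)) <= e * vn (u - v).

Variable n : nat.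
Implicit Types (h k : 'rV[C]_n -> C) (z x u v : 'rV[C]_n) (L K : 'rV[C]_n -> C).

Lemma sdiff_ext h k z L K : (forall v, h v = k v) -> (forall x, L x = K x) ->
  sdiff h z L -> sdiff k z K.
Proof. by move=> /funext <- /funext <-. Qed.

Lemma sdiff_bound h z L : sdiff h z L ->
  exists2 M : R, 0 < M & forall x, cmod (L x) <= M * vn x.
Proof.
move=> [[c hc] _]; exists (mxn c + 1); first by have := mxn_ge0 c; lra.
move=> x; rewrite hc; apply: le_trans (cmod_le_vn _ _) _.
apply: le_trans (vn_mulmx _ _) _; apply: ler_wpM2r; [exact: vn_ge0|lra].
Qed.

Lemma sdiff_lip h z L : sdiff h z L -> exists (M d : R), [/\ 0 < M, 0 < d &
  forall u v, vn (u - z) < d -> vn (v - z) < d -> cmod (h u - h v) <= M * vn (u - v)].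
Proof.
move=> hL; have [M M0 hM] := sdiff_bound hL; have [_ H] := hL.
have [d d0 hd] := H 1 ltr01; exists (M + 1), d; split => //; first by lra.
move=> u v hu hv; have := cmodD (h u - h v - L (u - v)) (L (u - v)); rewrite subrK.
by have := hd u v hu hv; have := hM (u - v); rewrite mulrDl !mul1r; lra.
Qed.

Lemma sdiff_cst c z : sdiff (fun=> c) z (fun=> 0).
Proof.
split; first by exists 0 => x; rewrite mulmx0 mxE.
move=> e e0; exists 1 => // u v _ _; rewrite !subrr cmod0.
by rewrite mulr_ge0 ?vn_ge0 // ltW.
Qed.

Lemma sdiff_coord i z : sdiff (fun v => v 0 i) z (fun x => x 0 i).
Proof.
split; first by exists (delta_mx i 0) => x; rewrite -colE mxE.
move=> e e0; exists 1 => // u v _ _; rewrite !mxE subrr cmod0.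
by rewrite mulr_ge0 ?vn_ge0 // ltW.
Qed.

Lemma sdiffD h k z L K : sdiff h z L -> sdiff k z K ->
  sdiff (fun v => h v + k v) z (fun x => L x + K x).
Proof.
move=> [[c hc] hh] [[c' hc'] hk]; split.
  by exists (c + c') => x; rewrite mulmxDr mxE hc hc'.
move=> e e0; have e2 : 0 < e / 2 by rewrite divr_gt0.
have [d1 d10 h1] := hh _ e2; have [d2 d20 h2] := hk _ e2.
exists (Num.min d1 d2); first by rewrite lt_min d10.
move=> u v; rewrite !lt_min => /andP[u1 u2] /andP[v1 v2].
have -> : h u + k u - (h v + k v) - (L (u - v) + K (u - v)) =
  (h u - h v - L (u - v)) + (k u - k v - K (u - v)) by ring.
apply: le_trans (cmodD _ _) _.
have := h1 _ _ u1 v1; have := h2 _ _ u2 v2.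
set A := cmod _; set B := cmod _ => p q; have -> : e * vn (u - v) =
  e / 2 * vn (u - v) + e / 2 * vn (u - v) by field.
by rewrite addrC; exact: lerD.
Qed.

Lemma sdiffM h k z L K : sdiff h z L -> sdiff k z K ->
  sdiff (fun v => h v * k v) z (fun x => h z * K x + L x * k z).
Proof.
move=> dh dk; have [[c hc] hh] := dh; have [[c' hc'] hk] := dk; split.
  exists (h z *: c' + k z *: c) => x.
  by rewrite mulmxDr -!scalemxAr hc hc' !mxE [k z * _]mulrC.
move=> e e0.
have [ML ML0 hML] := sdiff_bound dh; have [MK MK0 hMK] := sdiff_bound dk.
have [Mh [dh1 [Mh0 dh10 lh]]] := sdiff_lip dh.
have [Mk [dk1 [Mk0 dk10 lk]]] := sdiff_lip dk.
have zz : vn (z - z) = 0 by rewrite subrr vn0.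
have H0 := cmod_ge0 (h z); have K0 := cmod_ge0 (k z).
pose Bh := cmod (h z) + Mh; pose Bk := cmod (k z) + Mk.
have Bh0 : 0 < Bh by rewrite /Bh; lra.
have Bk0 : 0 < Bk by rewrite /Bk; lra.
have e1 : 0 < e / 4 / Bk by rewrite !divr_gt0.
have e2 : 0 < e / 4 / Bh by rewrite !divr_gt0.
have [d1 d10 h1] := hh _ e1; have [d2 d20 h2] := hk _ e2.
exists (Num.min (Num.min (Num.min 1 dh1) (Num.min dk1 d1))
         (Num.min d2 (Num.min (e / 4 / (ML * Mk)) (e / 4 / (Mh * MK))))).
  by rewrite !lt_min ltr01 dh10 dk10 d10 d20 !divr_gt0 // mulr_gt0.
move=> u v; rewrite !lt_min.
move=> /andP[/andP[/andP[u1 u2] /andP[u3 u4]] /and3P[u5 u6 u7]].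
move=> /andP[/andP[/andP[v1 v2] /andP[v3 v4]] /and3P[v5 v6 v7]].
have ku := lk u z u3; rewrite zz in ku; have {}ku := ku dk10.
have hv := lh v z v2; rewrite zz in hv; have {}hv := hv dh10.
have kB : cmod (k u) <= Bk.
  apply: le_trans (cmod_sub_le (k u) (k z)) _; rewrite lerD2l.
  by apply: le_trans ku _; rewrite ler_piMr // ltW.
have hB : cmod (h v) <= Bh.
  apply: le_trans (cmod_sub_le (h v) (h z)) _; rewrite lerD2l.
  by apply: le_trans hv _; rewrite ler_piMr // ltW.
have -> : h u * k u - h v * k v - (h z * K (u - v) + L (u - v) * k z) =
  ((h u - h v - L (u - v)) * k u + L (u - v) * (k u - k z)) +
  (h v * (k u - k v - K (u - v)) + (h v - h z) * K (u - v)) by ring.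
set D := vn (u - v); have D0 : 0 <= D by exact: vn_ge0.
have t1 : cmod ((h u - h v - L (u - v)) * k u) <= e / 4 * D.
  rewrite cmodM; apply: (@le_trans _ _ (e / 4 / Bk * D * Bk)).
    by apply: ler_pM; rewrite ?cmod_ge0 //; exact: h1.
  by rewrite mulrAC divfK ?gt_eqF.
have t3 : cmod (h v * (k u - k v - K (u - v))) <= e / 4 * D.
  rewrite cmodM; apply: (@le_trans _ _ (Bh * (e / 4 / Bh * D))).
    by apply: ler_pM; rewrite ?cmod_ge0 //; exact: h2.
  by rewrite mulrA [Bh * _]mulrC divfK ?gt_eqF.
have t2 : cmod (L (u - v) * (k u - k z)) <= e / 4 * D.
  rewrite cmodM; apply: (@le_trans _ _ (ML * D * (Mk * vn (u - z)))).
    by apply: ler_pM; rewrite ?cmod_ge0 //; exact: hML.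
  have -> : ML * D * (Mk * vn (u - z)) = (vn (u - z) * (ML * Mk)) * D by ring.
  by apply: ler_wpM2r => //; rewrite -ler_pdivlMr ?mulr_gt0 // ltW.
have t4 : cmod ((h v - h z) * K (u - v)) <= e / 4 * D.
  rewrite cmodM; apply: (@le_trans _ _ ((Mh * vn (v - z)) * (MK * D))).
    by apply: ler_pM; rewrite ?cmod_ge0 //; exact: hMK.
  have -> : Mh * vn (v - z) * (MK * D) = (vn (v - z) * (Mh * MK)) * D by ring.
  by apply: ler_wpM2r => //; rewrite -ler_pdivlMr ?mulr_gt0 // ltW.
apply: le_trans (cmodD _ _) _.
have -> : e * D = (e / 4 * D + e / 4 * D) + (e / 4 * D + e / 4 * D) by field.
by apply: lerD; apply: le_trans (cmodD _ _) _; apply: lerD.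
Qed.

(** The inverse of one plus the sum of the [1 / d j] is positive and below every [d j], also when
    the index set is empty. *)
Lemma finite_delta m (P : 'I_m -> R -> Prop) :
  (forall j, exists2 d : R, 0 < d & P j d) ->
  (forall j d d', 0 < d' <= d -> P j d -> P j d') ->
  exists2 d : R, 0 < d & forall j, P j d.
Proof.
move=> hP mono.
have [d hd] : exists d : 'I_m -> R, forall j, 0 < d j /\ P j (d j).
  have : forall j, exists d : R, 0 < d /\ P j d.
    by move=> j; have [d d0 h] := hP j; exists d.
  by case/choice => d h; exists d.
pose s := \sum_j (d j)^-1 + 1.
have s0 : 0 < s.
  rewrite ltr_wpDl //; apply: sumr_ge0 => j _; rewrite invr_ge0.
  by have [/ltW] := hd j.
exists s^-1; first by rewrite invr_gt0.
move=> j; have [dj hj] := hd j; apply: mono hj; rewrite invr_gt0 s0 /=.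
rewrite -[leRHS]invrK lef_pV2 ?posrE ?invr_gt0 // /s (bigD1 j) //= -addrA lerDl.
by rewrite addr_ge0 //; apply: sumr_ge0 => i _; rewrite invr_ge0; have [/ltW] := hd i.
Qed.

Lemma strict_diff_row m (h : 'I_m -> 'rV[C]_n -> C) z (L : 'I_m -> 'rV[C]_n -> C) :
  (forall j, sdiff (h j) z (L j)) ->
  exists A : 'M[C]_(n, m), strict_diff (fun v => \row_j h j v) z A /\
    forall x, x *m A = \row_j L j x.
Proof.
move=> hL.
have [c hc] : exists c : 'I_m -> 'cV[C]_n, forall j x, L j x = (x *m c j) 0 0.
  have : forall j, exists c : 'cV[C]_n, forall x, L j x = (x *m c) 0 0.
    by move=> j; have [] := hL j.
  by case/choice => c h'; exists c.
pose A : 'M[C]_(n, m) := \matrix_(i, j) c j i 0.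
have hA x : x *m A = \row_j L j x.
  by apply/rowP => j; rewrite !mxE hc !mxE; apply: eq_bigr => i _; rewrite !mxE.
exists A; split => // e e0.
have em : 0 < e / m.+1%:R by rewrite divr_gt0.
have [|j d d' /andP[d'0 d'd] H u v hu hv|d d0 hd] :=
  @finite_delta m (fun j d => forall u v, vn (u - z) < d -> vn (v - z) < d ->
    cmod (h j u - h j v - L j (u - v)) <= e / m.+1%:R * vn (u - v)).
- by move=> j; have [_ H] := hL j; exact: H.
- by apply: H; [exact: lt_le_trans hu d'd|exact: lt_le_trans hv d'd].
exists d => // u v hu hv; rewrite hA.
apply: (@le_trans _ _ (\sum_(j < m) e / m.+1%:R * vn (u - v))).
  by apply: ler_sum => j _; rewrite !mxE; exact: hd.
rewrite sumr_const card_ord -(mulr_natl (e / m.+1%:R * vn (u - v))) mulrA.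
apply: ler_wpM2r; first exact: vn_ge0.
rewrite mulrCA ler_piMr ?(ltW e0) // ler_pdivrMr ?ltr0n // mul1r ler_nat //.
Qed.

Lemma strict_diff_coord m (H : 'rV[C]_n -> 'rV[C]_m) z A j : strict_diff H z A ->
  sdiff (fun v => H v 0 j) z (fun x => (x *m A) 0 j).
Proof.
move=> hH; split.
  by exists (col j A) => x; rewrite !mxE; apply: eq_bigr => i _; rewrite mxE.
move=> e e0; have [d d0 hd] := hH e e0; exists d => // u v hu hv.
by apply: le_trans (hd u v hu hv); have := cmod_le_vn (H u - H v - (u - v) *m A) j; rewrite !mxE.
Qed.

End ScalarStrictDiff.

(** * Normal form of the cusp *)

Section PolynomialExpressions.
Variable R : realType.
Local Notation C := (R[i]).

(** A syntax for plane polynomials, so that one term can be evaluated in [C], evaluated in the cubic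
    algebra, read as a polynomial in [y], and differentiated, each by recursion. *)
Inductive pexp := PC of C | PX | PY | PAdd of pexp & pexp | PMul of pexp & pexp.

Fixpoint peval (e : pexp) (x y : C) : C :=
  match e with
  | PC c => c | PX => x | PY => y
  | PAdd e1 e2 => peval e1 x y + peval e2 x y
  | PMul e1 e2 => peval e1 x y * peval e2 x y
  end.

Fixpoint psubst (e a b : pexp) : pexp :=
  match e with
  | PC c => PC c | PX => a | PY => b
  | PAdd e1 e2 => PAdd (psubst e1 a b) (psubst e2 a b)
  | PMul e1 e2 => PMul (psubst e1 a b) (psubst e2 a b)
  end.

Lemma peval_subst e a b x y :
  peval (psubst e a b) x y = peval e (peval a x y) (peval b x y).
Proof. by elim: e => //= e1 -> e2 ->. Qed.

Lemma pexp_division e : exists a b : pexp, forall x y,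
  peval e x y = peval e 0 0 + x * peval a x y + y * peval b x y.
Proof.
elim: e => [c|||e1 [a1 [b1 h1]] e2 [a2 [b2 h2]]|e1 [a1 [b1 h1]] e2 [a2 [b2 h2]]].
- by exists (PC 0), (PC 0) => x y /=; ring.
- by exists (PC 1), (PC 0) => x y /=; ring.
- by exists (PC 0), (PC 1) => x y /=; ring.
- by exists (PAdd a1 a2), (PAdd b1 b2) => x y /=; rewrite h1 h2; ring.
- exists (PAdd (PMul a1 e2) (PMul (PC (peval e1 0 0)) a2)),
    (PAdd (PMul b1 e2) (PMul (PC (peval e1 0 0)) b2)) => x y /=.
  by rewrite {1}h1 h2; ring.
Qed.

(** Every monomial other than [1], [x], [y], [y^2] lies in the ideal [(x^2, x y, y^3)]; three
    divisions expose the remainder. *)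
Lemma pexp_jet e : exists (c00 c10 c01 c02 : C) (a b c : pexp), forall x y,
  peval e x y = c00 + c10 * x + c01 * y + c02 * y ^+ 2
    + x ^+ 2 * peval a x y + x * y * peval b x y + y ^+ 3 * peval c x y.
Proof.
have [a [b h]] := pexp_division e.
have [a1 [b1 h1]] := pexp_division a; have [a2 [b2 h2]] := pexp_division b.
have [a3 [b3 h3]] := pexp_division b2.
exists (peval e 0 0), (peval a 0 0), (peval b 0 0), (peval b2 0 0).
exists a1, (PAdd (PAdd b1 a2) (PMul PY a3)), b3 => x y /=.
by rewrite h h1 h2 h3; ring.
Qed.

End PolynomialExpressions.

Arguments PX {R}.
Arguments PY {R}.

(** * The cubic algebra of the cusp *)

Section CubicAlgebra.
Variable R : realType.
Local Notation C := (R[i]).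

(* [(p0, p1, p2)] stands for the class of [p0 + p1 Y + p2 Y^2] in
   [C[Y] / (Y^3 + X Y - T)]. *)
Definition triple := (C * C * C)%type.

Definition tadd (p q : triple) : triple :=
  (p.1.1 + q.1.1, p.1.2 + q.1.2, p.2 + q.2).

(** The product is reduced by [Y^3 = T - X Y] and [Y^4 = T Y - X Y^2]. *)
Definition tmul (X T : C) (p q : triple) : triple :=
  (p.1.1 * q.1.1 + T * (p.1.2 * q.2 + p.2 * q.1.2),
   p.1.1 * q.1.2 + p.1.2 * q.1.1 + (- X) * (p.1.2 * q.2 + p.2 * q.1.2)
     + T * (p.2 * q.2),
   p.1.1 * q.2 + p.1.2 * q.1.2 + p.2 * q.1.1 + (- X) * (p.2 * q.2)).

Definition tval (p : triple) (Y : C) : C := p.1.1 + p.1.2 * Y + p.2 * Y ^+ 2.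

Fixpoint teval (X T : C) (xt yt : triple) (e : pexp R) : triple :=
  match e with
  | PC c => (c, 0, 0) | PX => xt | PY => yt
  | PAdd e1 e2 => tadd (teval X T xt yt e1) (teval X T xt yt e2)
  | PMul e1 e2 => tmul X T (teval X T xt yt e1) (teval X T xt yt e2)
  end.

(** On the graph of the cusp map, evaluation at [Y] is a ring morphism. A value without [Y] and
    [Y^2] components therefore depends on [(X, T)] alone. *)
Lemma tval_eval X T xt yt e Y : T = Y ^+ 3 + X * Y ->
  tval (teval X T xt yt e) Y = peval e (tval xt Y) (tval yt Y).
Proof.
move=> hT; elim: e => [c|||e1 IH1 e2 IH2|e1 IH1 e2 IH2] //=.
- by rewrite /tval /=; ring.
- by rewrite -IH1 -IH2 /tval /=; ring.
- by rewrite -IH1 -IH2 /tval /= hT; ring.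
Qed.

End CubicAlgebra.

(** * Rows with coordinates numbered by natural numbers *)

Section Rows.
Variable R : realType.
Local Notation C := (R[i]).

Definition co n (v : 'rV[C]_n.+1) (k : nat) : C := v 0 (inord k).

Definition mkrow n (s : seq C) : 'rV[C]_n.+1 := \row_j s`_j.

Lemma co_mkrow n s k : (k < n.+1)%N -> co (mkrow n s) k = s`_k.
Proof. by move=> kn; rewrite /co /mkrow mxE inordK. Qed.

Lemma co0 n k : co (0 : 'rV[C]_n.+1) k = 0.
Proof. by rewrite /co mxE. Qed.

Lemma row_co n (u v : 'rV[C]_n.+1) :
  (forall k, (k < n.+1)%N -> co u k = co v k) -> u = v.
Proof. by move=> h; apply/rowP => j; have := h j (ltn_ord j); rewrite /co inord_val. Qed.

Lemma sdiff_co n k (z : 'rV[C]_n.+1) : sdiff (fun v => co v k) z (fun x => co x k).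
Proof. exact: sdiff_coord. Qed.

End Rows.

(** * Linear part at the origin of polynomials in the cubic algebra *)

Section NormalForm.
Variable R : realType.
Local Notation C := (R[i]).
Local Notation V6 := ('rV[C]_6).

(** The coordinates of [v] are, in order, [x0], [x1], [x2], [y0], [X], [T]. The second unknown
    element is normalised to [y0 + Y]. *)
Definition xt (v : V6) : triple R := (co v 0, co v 1, co v 2).
Definition yt (v : V6) : triple R := (co v 3, 1, 0).
Definition tev (e : pexp R) (v : V6) : triple R :=
  teval (co v 4) (co v 5) (xt v) (yt v) e.

Definition tsdiff (P : V6 -> triple R) (z : V6) := exists L0 L1 L2,
  [/\ sdiff (fun v => (P v).1.1) z L0, sdiff (fun v => (P v).1.2) z L1 &
      sdiff (fun v => (P v).2) z L2].

Lemma tsdiff_tev e z : tsdiff (tev e) z.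
Proof.
elim: e => [c|||e1 IH1 e2 IH2|e1 IH1 e2 IH2].
- by do 3!eexists; split; exact: sdiff_cst.
- by do 3!eexists; split; exact: sdiff_co.
- by do 3!eexists; split; [exact: sdiff_co|exact: sdiff_cst|exact: sdiff_cst].
- have [L0 [L1 [L2 [p0 p1 p2]]]] := IH1; have [K0 [K1 [K2 [q0 q1 q2]]]] := IH2.
  by do 3!eexists; split; [exact: (sdiffD p0 q0)|exact: (sdiffD p1 q1)|exact: (sdiffD p2 q2)].
- have [L0 [L1 [L2 [p0 p1 p2]]]] := IH1; have [K0 [K1 [K2 [q0 q1 q2]]]] := IH2.
  have dT := @sdiff_co R 5 5 z.
  have dX := @sdiff_co R 5 4 z.
  have dN := sdiffM (@sdiff_cst R 6 (-1) z) dX.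
  have c3 := sdiffD (sdiffM p1 q2) (sdiffM p2 q1).
  have r0 := sdiffD (sdiffM p0 q0) (sdiffM dT c3).
  have r1 := sdiffD (sdiffD (sdiffD (sdiffM p0 q1) (sdiffM p1 q0)) (sdiffM dN c3))
               (sdiffM dT (sdiffM p2 q2)).
  have r2 := sdiffD (sdiffD (sdiffD (sdiffM p0 q2) (sdiffM p1 q1)) (sdiffM p2 q0))
               (sdiffM dN (sdiffM p2 q2)).
  do 3!eexists; split.
  + exact: r0.
  + by apply: sdiff_ext r1 => [v|x]; [rewrite /= mulN1r|].
  + by apply: sdiff_ext r2 => [v|x]; [rewrite /= mulN1r|].
Qed.

Definition zsdiff (P : V6 -> triple R) (L : V6 -> triple R) :=
  P 0 = (0, 0, 0) /\
  [/\ sdiff (fun v => (P v).1.1) 0 (fun x => (L x).1.1),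
      sdiff (fun v => (P v).1.2) 0 (fun x => (L x).1.2) &
      sdiff (fun v => (P v).2) 0 (fun x => (L x).2)].

Lemma zsdiff_add P Q L K : zsdiff P L -> zsdiff Q K ->
  zsdiff (fun v => tadd (P v) (Q v)) (fun x => tadd (L x) (K x)).
Proof.
move=> [P0 [p0 p1 p2]] [Q0 [q0 q1 q2]]; split.
  by rewrite P0 Q0 /tadd /= !addr0.
by split; [exact: (sdiffD p0 q0)|exact: (sdiffD p1 q1)|exact: (sdiffD p2 q2)].
Qed.

Lemma zsdiff_ext P Q L K : (forall v, P v = Q v) -> (forall x, L x = K x) ->
  zsdiff P L -> zsdiff Q K.
Proof. by move=> /funext <- /funext <-. Qed.

(** As [P] vanishes at 0, only the value [Q 0] enters the derivative; the reduction terms carry a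
    further factor [X] or [T] and are of second order. *)
Lemma zsdiff_mul P L Q : zsdiff P L -> tsdiff Q 0 ->
  zsdiff (fun v => tmul (co v 4) (co v 5) (P v) (Q v))
    (fun x => ((L x).1.1 * (Q 0).1.1,
               (L x).1.1 * (Q 0).1.2 + (L x).1.2 * (Q 0).1.1,
               (L x).1.1 * (Q 0).2 + (L x).1.2 * (Q 0).1.2 + (L x).2 * (Q 0).1.1)).
Proof.
move=> [P0 [p0 p1 p2]] [K0 [K1 [K2 [q0 q1 q2]]]]; split.
  by rewrite P0 /tmul /= !co0 !(mul0r, mulr0, addr0).
have dT := @sdiff_co R 5 5 0.
have dX := @sdiff_co R 5 4 0.
have dN := sdiffM (@sdiff_cst R 6 (-1) 0) dX.
have c3 := sdiffD (sdiffM p1 q2) (sdiffM p2 q1).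
have r0 := sdiffD (sdiffM p0 q0) (sdiffM dT c3).
have r1 := sdiffD (sdiffD (sdiffD (sdiffM p0 q1) (sdiffM p1 q0)) (sdiffM dN c3))
             (sdiffM dT (sdiffM p2 q2)).
have r2 := sdiffD (sdiffD (sdiffD (sdiffM p0 q2) (sdiffM p1 q1)) (sdiffM p2 q0))
             (sdiffM dN (sdiffM p2 q2)).
split.
- by apply: sdiff_ext r0 => [v|x] //=; rewrite P0 /= !co0; ring.
- by apply: sdiff_ext r1 => [v|x] /=; [rewrite mulN1r|rewrite P0 /= !co0; ring].
- by apply: sdiff_ext r2 => [v|x] /=; [rewrite mulN1r|rewrite P0 /= !co0; ring].
Qed.

Lemma zsdiff_x : zsdiff xt xt.
Proof.
by split; [rewrite /xt !co0|split; exact: sdiff_co].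
Qed.

(** The linear part of [y0^3 + 3 y0^2 Y + 3 y0 Y^2 + T - X Y]. This cube is how [y0], [X] and [T]
    enter the linearised system. *)
Lemma zsdiff_y3 : zsdiff (tev (PMul PY (PMul PY PY)))
  (fun x => (co x 5, - co x 4, 3 * co x 3)).
Proof.
have E v : (co v 5 + co v 3 * (co v 3 * co v 3),
             (-1) * co v 4 + 3 * (co v 3 * co v 3), 3 * co v 3) =
           tev (PMul PY (PMul PY PY)) v.
  by rewrite /tev /= /tmul /yt /=; congr (_, _, _); ring.
have d5 := @sdiff_co R 5 5 0; have d4 := @sdiff_co R 5 4 0.
have d3 := @sdiff_co R 5 3 0.
apply: (@zsdiff_ext _ _ _ _ E (fun=> erefl)); split.
  by rewrite !co0 !(mulr0, addr0).
split.
- apply: sdiff_ext (sdiffD d5 (sdiffM d3 (sdiffM d3 d3))) => [v|x] //=.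
  by rewrite !co0; ring.
- apply: sdiff_ext (sdiffD (sdiffM (sdiff_cst (-1) 0) d4)
      (sdiffM (sdiff_cst 3 0) (sdiffM d3 d3))) => [v|x] //=.
  by rewrite !co0; ring.
- apply: sdiff_ext (sdiffM (sdiff_cst 3 0) d3) => [v|x] //=; ring.
Qed.

Lemma tev0 e : (tev e 0).1.1 = peval e 0 0.
Proof.
have h : co (0 : V6) 5 = 0 ^+ 3 + co (0 : V6) 4 * 0 by rewrite !co0; ring.
have := tval_eval (xt 0) (yt 0) e h; rewrite -/(tev e 0) /tval /=.
by rewrite !co0 expr0n /= !mulr0 !addr0.
Qed.

Definition jet_exp (a b c : pexp R) : pexp R :=
  PAdd (PMul (PMul PX PX) a)
       (PAdd (PMul (PMul PX PY) b) (PMul (PMul PY (PMul PY PY)) c)).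

(** At the origin [y] is [Y], so the linear part of [x y] is the shift [(0, x0, x1)], while [x^2] is
    of second order; [b0], [c0] and the others come from the values of [b] and [c] there. *)
Lemma zsdiff_jet a b c :
  let b0 := (tev b 0).1.1 in let b1 := (tev b 0).1.2 in
  let c0 := (tev c 0).1.1 in let c1 := (tev c 0).1.2 in let c2 := (tev c 0).2 in
  zsdiff (tev (jet_exp a b c)) (fun x =>
    (co x 5 * c0,
     co x 0 * b0 + (co x 5 * c1 - co x 4 * c0),
     co x 0 * b1 + co x 1 * b0 + (co x 5 * c2 - co x 4 * c1 + 3 * co x 3 * c0))).
Proof.
move=> b0 b1 c0 c1 c2.
have hx : tsdiff xt 0 by exact: (tsdiff_tev (@PX R) 0).
have hy : tsdiff yt 0 by exact: (tsdiff_tev (@PY R) 0).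
have h1 := zsdiff_mul (zsdiff_mul zsdiff_x hx) (tsdiff_tev a 0).
have h2 := zsdiff_mul (zsdiff_mul zsdiff_x hy) (tsdiff_tev b 0).
have h3 := zsdiff_mul zsdiff_y3 (tsdiff_tev c 0).
apply: zsdiff_ext (zsdiff_add h1 (zsdiff_add h2 h3)) => [v|x] //.
rewrite /tadd /= -/b0 -/b1 -/c0 -/c1 -/c2 !co0.
by congr (_, _, _); ring.
Qed.

End NormalForm.

(** * Local biholomorphisms of rows *)

Section LocalBiholo.
Variable R : realType.
Local Notation C := (R[i]).

Definition local_biholo n (P : 'rV[C]_n -> 'rV[C]_n) := P 0 = 0 /\
  exists (Q : 'rV[C]_n -> 'rV[C]_n) (s : R), [/\ 0 < s, Q 0 = 0,
    forall w, vn w < s -> P (Q w) = w, forall z, vn z < s -> Q (P z) = z &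
    (forall z, vn z < s -> exists A, strict_diff P z A) /\
    (forall w, vn w < s -> exists A, strict_diff Q w A)].

Lemma local_inverse n (P : 'rV[C]_n -> 'rV[C]_n) A0 (r : R) : 0 < r ->
  P 0 = 0 -> (forall z, vn z < r -> exists A, strict_diff P z A) ->
  strict_diff P 0 A0 -> (forall x : 'rV[C]_n, x *m A0 = 0 -> x = 0) ->
  exists (Q : 'rV[C]_n -> 'rV[C]_n) (s : R), [/\ 0 < s <= r, Q 0 = 0,
    forall w, vn w < s -> P (Q w) = w, forall z, vn z < s -> Q (P z) = z &
    (forall w, vn w < s -> exists A, strict_diff Q w A) /\
    (A0 \in unitmx /\ strict_diff Q 0 (invmx A0))].
Proof.
move=> r0 P0 hP h0 inj.
have [D hD] : exists D : 'rV[C]_n -> 'M[C]_n, forall z, vn z < r -> strict_diff P z (D z).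
  have : forall z, exists A, vn z < r -> strict_diff P z A.
    move=> z; have [h|h] := pselect (is_true (vn z < r)); last by exists 0.
    by have [A hA] := hP z h; exists A.
  by case/choice => D h; exists D.
(* The chosen derivative at 0 is replaced by [A0], so that the inverse has derivative [invmx A0]
   there. *)
pose D' z := if z == 0 then A0 else D z.
have hD' z : vn (z - 0) < r -> strict_diff P z (D' z).
  by rewrite subr0 /D' => hz; case: eqP => [->//|_]; exact: hD.
have D'0 : D' 0 = A0 by rewrite /D' eqxx.
have U : D' 0 \in unitmx by rewrite D'0 -row_free_unit; exact: inj_row_free.
have [K [s [s0 K0 h1 h2 h3]]] := inverse_function r0 hD' U.
rewrite P0 in K0 h1 h3.
exists K, (Num.min s r); split.
- by rewrite lt_min s0 r0 ge_min lexx orbT.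
- by [].
- by move=> w; rewrite lt_min => /andP[hw _]; apply: h1; rewrite subr0.
- by move=> z; rewrite lt_min => /andP[hw _]; apply: h2; rewrite subr0.
split.
- move=> w; rewrite lt_min => /andP[hw _]; exists (invmx (D' (K w))).
  by apply: h3; rewrite subr0.
split; first by rewrite -D'0.
by have := h3 0; rewrite subr0 vn0 K0 D'0 => /(_ s0).
Qed.

Lemma local_biholo_of_diff n (P : 'rV[C]_n -> 'rV[C]_n) A0 (r : R) : 0 < r ->
  P 0 = 0 -> (forall z, vn z < r -> exists A, strict_diff P z A) ->
  strict_diff P 0 A0 -> (forall x : 'rV[C]_n, x *m A0 = 0 -> x = 0) -> local_biholo P.
Proof.
move=> r0 P0 hP h0 inj; split => //.
have [Q [s [/andP[s0 sr] Q0 h1 h2 [h3 _]]]] := local_inverse r0 P0 hP h0 inj.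
exists Q, s; split => //; split => // z hz; apply: hP; exact: lt_le_trans hz sr.
Qed.

Lemma strict_diff_mkrow n m (s : 'rV[C]_m.+1 -> seq C) z (L : 'rV[C]_m.+1 -> seq C) :
  (forall j, (j < n.+1)%N -> sdiff (fun v => (s v)`_j) z (fun x => (L x)`_j)) ->
  exists A : 'M[C]_(m.+1, n.+1), strict_diff (fun v => mkrow n (s v)) z A /\
    forall x, x *m A = mkrow n (L x).
Proof.
move=> h; have [j|A [h1 h2]] := @strict_diff_row R m.+1 n.+1
  (fun j v => (s v)`_j) z (fun j x => (L x)`_j); first exact: h.
by exists A.
Qed.

Lemma strict_diff_small n m (H : 'rV[C]_m -> 'rV[C]_n) A (s : R) : 0 < s ->
  strict_diff H 0 A -> H 0 = 0 ->
  exists2 d : R, 0 < d & forall q, vn q < d -> vn (H q) < s.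
Proof.
move=> s0 h H0; have [d d0 hd] := strict_diff_lip h.
have M0 : 0 < mxn A + 1 by have := mxn_ge0 A; lra.
exists (Num.min d (s / (mxn A + 1))); first by rewrite lt_min d0 divr_gt0.
move=> q; rewrite lt_min => /andP[q1 q2].
have := hd q 0; rewrite !subr0 vn0 H0 subr0 => /(_ q1 d0) k.
by apply: (le_lt_trans k); rewrite mulrC -ltr_pdivlMr.
Qed.

End LocalBiholo.

Local Arguments tev : simpl never.

(** * Solution of the system in six unknowns *)

Section CuspNormalForm.
Variable R : realType.
Local Notation C := (R[i]).
Variables a b c a' b' c' : pexp R.
Hypothesis b'0 : peval b' 0 0 != 0.
Hypothesis c'0 : peval c' 0 0 != 0.

Let ef : pexp R := PAdd PX (jet_exp a b c).
Let eg : pexp R := jet_exp a' b' c'.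

Let Lf (x : 'rV[C]_6) : triple R :=
  tadd (xt x)
    (co x 5 * (tev c 0).1.1,
     co x 0 * (tev b 0).1.1 + (co x 5 * (tev c 0).1.2 - co x 4 * (tev c 0).1.1),
     co x 0 * (tev b 0).1.2 + co x 1 * (tev b 0).1.1 +
      (co x 5 * (tev c 0).2 - co x 4 * (tev c 0).1.2 + 3 * co x 3 * (tev c 0).1.1)).
Let Lg (x : 'rV[C]_6) : triple R :=
    (co x 5 * (tev c' 0).1.1,
     co x 0 * (tev b' 0).1.1 + (co x 5 * (tev c' 0).1.2 - co x 4 * (tev c' 0).1.1),
     co x 0 * (tev b' 0).1.2 + co x 1 * (tev b' 0).1.1 +
      (co x 5 * (tev c' 0).2 - co x 4 * (tev c' 0).1.2 + 3 * co x 3 * (tev c' 0).1.1)).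

Let zf : zsdiff (tev ef) Lf.
Proof. exact: (zsdiff_add (@zsdiff_x R) (zsdiff_jet a b c)). Qed.

Let zg : zsdiff (tev eg) Lg.
Proof. exact: zsdiff_jet. Qed.

(** The linearised system is triangular: with [X = T = 0] its equations give in turn [x0 = 0] (by
    [b'0]), [x1 = 0], [y0 = 0] (by [c'0]) and [x2 = 0]. *)
Let kernel6 (x : 'rV[C]_6) : (Lf x).1.2 = 0 -> (Lf x).2 = 0 -> (Lg x).1.2 = 0 ->
  (Lg x).2 = 0 -> co x 4 = 0 -> co x 5 = 0 -> x = 0.
Proof.
rewrite /Lf /Lg /tadd /= !tev0 => f1 f2 g1 g2 x4 x5.
rewrite x4 x5 !mul0r subrr addr0 in g1.
have x0 : co x 0 = 0 by apply/eqP; move/eqP: g1; rewrite mulf_eq0 (negbTE b'0) orbF.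
rewrite x4 x5 x0 !mul0r subrr !addr0 in f1.
rewrite x4 x5 x0 f1 !mul0r subrr !add0r in g2.
have x3 : co x 3 = 0.
  by apply/eqP; move/eqP: g2; rewrite !mulf_eq0 (negbTE c'0) orbF pnatr_eq0.
rewrite x4 x5 x0 f1 x3 mulr0 !mul0r subrr !addr0 in f2.
by apply: row_co => -[|[|[|[|[|[|//]]]]]] _; rewrite co0.
Qed.

(** The components to be killed, followed by the parameters: the inverse of this map at
    [(0, 0, 0, 0, X, T)] is the solution for given [X] and [T]. *)
Let H6seq (v : 'rV[C]_6) : seq C :=
  [:: (tev ef v).1.2; (tev ef v).2; (tev eg v).1.2; (tev eg v).2; co v 4; co v 5].
Let L6seq (x : 'rV[C]_6) : seq C :=
  [:: (Lf x).1.2; (Lf x).2; (Lg x).1.2; (Lg x).2; co x 4; co x 5].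

Let H6 v : 'rV[C]_6 := mkrow 5 (H6seq v).

Let H6_diff0 : exists A, strict_diff H6 0 A /\ forall x, x *m A = mkrow 5 (L6seq x).
Proof.
have [_ [_ f1 f2]] := zf; have [_ [_ g1 g2]] := zg.
apply: (@strict_diff_mkrow R 5 5 H6seq 0 L6seq) => -[|[|[|[|[|[|//]]]]]] _ //=;
  exact: sdiff_co.
Qed.

Let H6_diff z : exists A, strict_diff H6 z A.
Proof.
have [F0 [F1 [F2 [_ f1 f2]]]] := tsdiff_tev ef z.
have [G0 [G1 [G2 [_ g1 g2]]]] := tsdiff_tev eg z.
have [|A [hA _]] := @strict_diff_mkrow R 5 5 H6seq z
  (fun x => [:: F1 x; F2 x; G1 x; G2 x; co x 4; co x 5]); last by exists A.
by move=> [|[|[|[|[|[|//]]]]]] _ //=; exact: sdiff_co.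
Qed.

Let emb (q : 'rV[C]_2) : 'rV[C]_6 := mkrow 5 [:: 0; 0; 0; 0; co q 0; co q 1].

Let emb_diff z : exists A, strict_diff emb z A /\ forall x, x *m A = emb x.
Proof.
apply: (@strict_diff_mkrow R 5 1 (fun q => [:: 0; 0; 0; 0; co q 0; co q 1]) z
        (fun q => [:: 0; 0; 0; 0; co q 0; co q 1])) => -[|[|[|[|[|[|//]]]]]] _ /=;
  (exact: sdiff_cst || exact: sdiff_co).
Qed.

Let emb0 : emb 0 = 0.
Proof. by apply: row_co => -[|[|[|[|[|[|//]]]]]] _; rewrite co_mkrow //= !co0. Qed.

Definition cusp_row (q : 'rV[C]_2) : 'rV[C]_2 :=
  mkrow 1 [:: co q 0; co q 1 ^+ 3 + co q 0 * co q 1].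

Let cusp_row0 : cusp_row 0 = 0.
Proof. by apply: row_co => -[|[|//]] _; rewrite co_mkrow //= !co0 // expr0n mulr0 addr0. Qed.

Let cusp_row_diff z : exists A, strict_diff cusp_row z A /\
  (z = 0 -> forall x, x *m A = mkrow 1 [:: co x 0; 0]).
Proof.
have d0 := @sdiff_co R 1 0 z; have d1 := @sdiff_co R 1 1 z.
have d3 := sdiffD (sdiffM d1 (sdiffM d1 d1)) (sdiffM d0 d1).
have [|A [h1 h2]] := @strict_diff_mkrow R 1 1
  (fun q => [:: co q 0; co q 1 ^+ 3 + co q 0 * co q 1]) z
  (fun x => [:: co x 0; co z 1 * (co z 1 * co x 1 + co x 1 * co z 1) +
     co x 1 * (co z 1 * co z 1) + (co z 0 * co x 1 + co x 0 * co z 1)]).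
  move=> [|[|//]] _ /=; first exact: d0.
  by apply: sdiff_ext d3 => // v; rewrite !exprS expr0 mulr1.
exists A; split => // z0 x; rewrite h2 z0; congr mkrow; congr [:: _; _].
by rewrite !co0; ring.
Qed.

(** [W] solves the system for given [(X, T)]. [Chi] collects the remaining constant components,
    functions of [(X, T)], and [Phi] evaluates the solution at [Y] with [T = Y^3 + X Y]; [tval_eval]
    identifies the two sides. *)
Theorem cusp_normal_form : exists (Phi Chi : 'rV[C]_2 -> 'rV[C]_2) (s : R),
  [/\ 0 < s, local_biholo Phi, local_biholo Chi &
    forall q, vn q < s ->
      peval ef (co (Phi q) 0) (co (Phi q) 1) = co (Chi (cusp_row q)) 0 /\
      peval eg (co (Phi q) 0) (co (Phi q) 1) = co (Chi (cusp_row q)) 1].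
Proof.
have [f00 [f0 _ _]] := zf; have [g00 [g0 _ _]] := zg.
have H60 : H6 0 = 0.
  have e : H6seq 0 = nseq 6 0 by rewrite /H6seq f00 g00 !co0.
  by apply: row_co => k k6; rewrite co_mkrow // e nth_nseq k6 co0.
have [A6 [hA6 LA6]] := H6_diff0.
have inj6 (x : 'rV[C]_6) : x *m A6 = 0 -> x = 0.
  rewrite LA6 => h.
  have e k : (k < 6)%N -> (L6seq x)`_k = 0.
    by move=> k6; have := congr1 (fun v => co v k) h; rewrite co_mkrow // co0.
  by apply: kernel6; [exact: (e 0%N)|exact: (e 1%N)|exact: (e 2)|exact: (e 3)|exact: (e 4)|exact: (e 5)].
have [K [s [/andP[s0 _] K0 HK _ [dK [U6 dK0]]]]] :=
  @local_inverse R 6 H6 A6 1 ltr01 H60 (fun z _ => H6_diff z) hA6 inj6.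
pose W q := K (emb q).
have W0 : W 0 = 0 by rewrite /W emb0 K0.
have [Ae [hAe LAe]] := emb_diff 0.
have [d1 d10 hd1] := strict_diff_small s0 hAe emb0.
have dW q : vn q < d1 -> exists A, strict_diff W q A.
  move=> hq; have [A1 [h1 _]] := emb_diff q; have [A2 h2] := dK _ (hd1 q hq).
  by exists (A1 *m A2); exact: (strict_diff_comp h1 h2).
have HW q : vn q < d1 -> H6 (W q) = emb q by move=> hq; exact: HK (hd1 q hq).
have HWk q k : vn q < d1 -> (k < 6)%N -> (H6seq (W q))`_k = co (emb q) k.
  by move=> hq k6; rewrite -HW // co_mkrow.
pose AW := Ae *m invmx A6.
have hAW : strict_diff W 0 AW by apply: strict_diff_comp hAe _; rewrite emb0.
have LW x : mkrow 5 (L6seq (x *m AW)) = emb x.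
  by rewrite -LA6 -LAe /AW -!mulmxA mulVmx // mulmx1.
have LWk x k : (k < 6)%N -> (L6seq (x *m AW))`_k = co (emb x) k.
  by move=> k6; rewrite -LW co_mkrow.
pose Chi q : 'rV[C]_2 := mkrow 1 [:: (tev ef (W q)).1.1; (tev eg (W q)).1.1].
pose fg v : 'rV[C]_2 := mkrow 1 [:: (tev ef v).1.1; (tev eg v).1.1].
have dfg v : exists A, strict_diff fg v A.
  have [F0 [F1 [F2 [h1 _ _]]]] := tsdiff_tev ef v.
  have [G0 [G1 [G2 [h2 _ _]]]] := tsdiff_tev eg v.
  have [|A [hA _]] := @strict_diff_mkrow R 1 5 (fun v => [:: (tev ef v).1.1; (tev eg v).1.1]) v
    (fun x => [:: F0 x; G0 x]); last by exists A.
  by move=> [|[|//]] _ /=.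
have [Afg [hAfg LAfg]] := @strict_diff_mkrow R 1 5 (fun v => [:: (tev ef v).1.1; (tev eg v).1.1]) 0
    (fun x => [:: (Lf x).1.1; (Lg x).1.1]) ltac:(by move=> [|[|//]] _ /=).
have Chi_bih : local_biholo Chi.
  apply: (@local_biholo_of_diff R 2 Chi (AW *m Afg) d1) => //.
  - by apply: row_co => -[|[|//]] _; rewrite co_mkrow // co0 W0 f00 g00.
  - move=> z /dW[A1 h1]; have [A2 h2] := dfg (W z).
    by exists (A1 *m A2); exact: (strict_diff_comp h1 h2).
  - have h : strict_diff fg (W 0) Afg by rewrite W0.
    exact: (strict_diff_comp hAW h).
  (* Injectivity of the derivative of [Chi]: the constant component of [g'] gives [T = 0], that of
     [f'] gives [x0 = 0], and the solved equation for the [Y] component of [g'] gives [X = 0]. *)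
  move=> x; rewrite mulmxA LAfg; set y := x *m AW => h.
  have h0 := congr1 (fun v => co v 0) h; have h1 := congr1 (fun v => co v 1) h.
  rewrite /= !co_mkrow // !co0 /= in h0 h1.
  have y5 : co y 5 = 0.
    by apply/eqP; move/eqP: h1; rewrite tev0 mulf_eq0 (negbTE c'0) orbF.
  rewrite y5 mul0r addr0 in h0.
  have y4 : co y 4 = 0.
    have := LWk x 2 isT; rewrite -/y co_mkrow //= h0 y5 !mul0r !add0r tev0 => /eqP.
    by rewrite oppr_eq0 mulf_eq0 (negbTE c'0) orbF => /eqP.
  have e4 := LWk x 4 isT; have e5 := LWk x 5 isT.
  rewrite -/y !co_mkrow //= y4 in e4; rewrite -/y !co_mkrow //= y5 in e5.
  by apply: row_co => -[|[|//]] _; rewrite co0.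
have [Am [hAm LAm]] := cusp_row_diff 0; have {}LAm := LAm erefl.
have [d3 d30 hd3] := strict_diff_small d10 hAm cusp_row0.
pose Z q := W (cusp_row q).
have Z0 : Z 0 = 0 by rewrite /Z cusp_row0 W0.
have dZ q : vn q < d3 -> exists A, strict_diff Z q A.
  move=> hq; have [A1 [h1 _]] := cusp_row_diff q; have [A2 h2] := dW _ (hd3 q hq).
  by exists (A1 *m A2); exact: (strict_diff_comp h1 h2).
have hZ0 : strict_diff Z 0 (Am *m AW) by apply: strict_diff_comp hAm _; rewrite cusp_row0.
pose Phis q : seq C := [:: tval (xt (Z q)) (co q 1); tval (yt (Z q)) (co q 1)].
pose Phi q : 'rV[C]_2 := mkrow 1 (Phis q).
have dPhi q A : strict_diff Z q A -> exists2 A' : 'M[C]_2, strict_diff Phi q A' &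
    (q = 0 -> forall x, x *m A' = mkrow 1 [:: co (x *m A) 0; co (x *m A) 3 + co x 1]).
  move=> hZ; have dz k := @strict_diff_coord R 2 6 Z q A (inord k) hZ.
  have dY := @sdiff_co R 1 1 q.
  have p0 := sdiffD (sdiffD (dz 0%N) (sdiffM (dz 1%N) dY)) (sdiffM (dz 2) (sdiffM dY dY)).
  have p1 := sdiffD (dz 3) dY.
  have [|A' [h1 h2]] := @strict_diff_mkrow R 1 1 Phis q (fun x =>
     [:: co (x *m A) 0 + (co (Z q) 1 * co x 1 + co (x *m A) 1 * co q 1) +
         (co (Z q) 2 * (co q 1 * co x 1 + co x 1 * co q 1) + co (x *m A) 2 * (co q 1 * co q 1));
       co (x *m A) 3 + co x 1]).
    move=> [|[|//]] _ /=.
      by apply: sdiff_ext p0 => // v; rewrite /tval /= expr2.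
    by apply: sdiff_ext p1 => // v; rewrite /tval /= mul1r mul0r addr0.
  exists A' => // q0 x; rewrite h2 q0 Z0; congr mkrow; congr [:: _; _].
  by rewrite !co0; ring.
have [AP hAP LAP] := dPhi 0 _ hZ0; have {}LAP := LAP erefl.
have Phi_bih : local_biholo Phi.
  apply: (@local_biholo_of_diff R 2 Phi AP d3) => //.
  - apply: row_co => -[|[|//]] _; rewrite co_mkrow // co0 /= Z0 /tval /= !co0; ring.
  - by move=> z /dZ[A1 /dPhi[A2 h2 _]]; exists A2.
  (* The cusp map has linear part [(X, 0)] at 0. From [x0 = 0] the [Y] component of [g'] forces
     [X = 0]; then [kernel6] annihilates the whole solution and the second coordinate leaves
     [Y = 0]. *)
  move=> x; rewrite LAP mulmxA LAm; set x1 := mkrow 1 [:: co x 0; 0]; set y := x1 *m AW => h.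
  have h0 := congr1 (fun v => co v 0) h; have h1 := congr1 (fun v => co v 1) h.
  rewrite /= !co_mkrow // !co0 /= in h0 h1.
  have e k := LWk x1 k; rewrite -/y in e.
  have y5 : co y 5 = 0 by have := e 5 isT; rewrite co_mkrow //= /x1 co_mkrow //=.
  have y4E : co y 4 = co x 0 by have := e 4 isT; rewrite co_mkrow //= /x1 co_mkrow //=.
  have y4 : co y 4 = 0.
    have := e 2 isT; rewrite co_mkrow //= h0 y5 !mul0r !add0r tev0 => /eqP.
    by rewrite oppr_eq0 mulf_eq0 (negbTE c'0) orbF => /eqP.
  have y0 : y = 0.
    apply: kernel6 => //; [have := e 0%N isT|have := e 1%N isT|have := e 2 isT|have := e 3 isT];
      by rewrite co_mkrow.
  rewrite y0 co0 add0r in h1.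
  by apply: row_co => -[|[|//]] _; rewrite co0 // -y4E.
exists Phi, Chi, d3; split => // q hq.
have hm := hd3 q hq; have hw k := @HWk (cusp_row q) k hm; rewrite -/(Z q) in hw.
have e4 : co (Z q) 4 = co q 0 by have := hw 4 isT; rewrite co_mkrow //= ?co_mkrow //=.
have e5 : co (Z q) 5 = co q 1 ^+ 3 + co (Z q) 4 * co q 1.
  by rewrite e4; have := hw 5 isT; rewrite co_mkrow //= ?co_mkrow //=.
have key e : (tev e (Z q)).1.2 = 0 -> (tev e (Z q)).2 = 0 ->
    peval e (co (Phi q) 0) (co (Phi q) 1) = (tev e (Z q)).1.1.
  move=> t1 t2; rewrite !co_mkrow //=.
  rewrite -(tval_eval (xt (Z q)) (yt (Z q)) e e5) -/(tev e (Z q)) /tval t1 t2.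
  by rewrite !mul0r !addr0.
split; rewrite key ?[co (Chi _) _]co_mkrow //.
- by have := hw 0%N isT; rewrite co_mkrow.
- by have := hw 1%N isT; rewrite co_mkrow.
- by have := hw 2 isT; rewrite co_mkrow.
- by have := hw 3 isT; rewrite co_mkrow.
Qed.

End CuspNormalForm.

(** * Germs of polynomial maps of the plane *)

Section Bridge.
Variable R : realType.
Local Notation C := (R[i]).
Local Notation CC := (CC R).
Local Notation C2 := (C2 R).

Definition p2r (p : C2) : 'rV[C]_2 := mkrow 1 [:: (p.1 : C); (p.2 : C)].
Definition r2p (v : 'rV[C]_2) : C2 := (co v 0, co v 1).

Lemma p2rK p : r2p (p2r p) = p.
Proof. by rewrite /r2p /p2r !co_mkrow //= -surjective_pairing. Qed.

Lemma r2pK v : p2r (r2p v) = v.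
Proof. by apply: row_co => -[|[|//]] _; rewrite co_mkrow. Qed.

Lemma vn2 (v : 'rV[C]_2) : vn v = cmod (co v 0) + cmod (co v 1).
Proof.
rewrite /vn !big_ord_recl big_ord0 addr0 /co.
by congr (cmod (v 0 _) + cmod (v 0 _)); apply/val_inj; rewrite /= inordK.
Qed.

Lemma coB n (u v : 'rV[C]_n.+1) k : co (u - v) k = co u k - co v k.
Proof. by rewrite /co !mxE. Qed.

Lemma coD n (u v : 'rV[C]_n.+1) k : co (u + v) k = co u k + co v k.
Proof. by rewrite /co !mxE. Qed.

Lemma coZ n (c : C) (u : 'rV[C]_n.+1) k : co (c *: u) k = c * co u k.
Proof. by rewrite /co !mxE. Qed.

Lemma co_p2rB p q : p2r p - p2r q = mkrow 1 [:: (p.1 : C) - q.1; (p.2 : C) - q.2].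
Proof. by apply: row_co => -[|[|//]] _; rewrite coB !co_mkrow. Qed.

Lemma vn_p2rB p q : vn (p2r p - p2r q) = dist2 p q.
Proof. by rewrite co_p2rB vn2 !co_mkrow. Qed.

Lemma p2r0 : p2r 0 = 0.
Proof. by apply: row_co => -[|[|//]] _; rewrite co_mkrow // co0. Qed.

Lemma vn_p2r p : vn (p2r p) = dist2 p 0.
Proof. by rewrite -vn_p2rB p2r0 subr0. Qed.

Lemma sdiff_fdiff (H : 'rV[C]_2 -> C) (p : C2) L : sdiff H (p2r p) L ->
  fdiff (fun q => H (p2r q)) p (L (mkrow 1 [:: 1; 0])) (L (mkrow 1 [:: 0; 1])).
Proof.
move=> [[c hc] h] e e0; have [d d0 hd] := h e e0; exists d => // z hz.
have pp : vn (p2r p - p2r p) < d by rewrite subrr vn0.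
have := hd (p2r z) (p2r p); rewrite vn_p2rB => /(_ hz pp).
suff -> : L (p2r z - p2r p) = L (mkrow 1 [:: 1; 0]) * ((z.1 : C) - p.1)
   + L (mkrow 1 [:: 0; 1]) * ((z.2 : C) - p.2) by [].
rewrite co_p2rB; move: ((z.1 : C) - p.1) ((z.2 : C) - p.2) => x y.
have -> : mkrow 1 [:: x; y] = x *: mkrow 1 [:: 1; 0] + y *: mkrow 1 [:: 0; 1].
  by apply: row_co => -[|[|//]] _; rewrite coD !coZ !co_mkrow //= !(mulr1, mulr0, addr0, add0r).
rewrite !hc mulmxDl -!scalemxAl mxE [X in X + _ = _]mxE [X in _ + X = _]mxE.
by rewrite mulrC [X in _ + X = _]mulrC.
Qed.

Fixpoint pdX (e : pexp R) : pexp R :=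
  match e with
  | PC _ => PC 0 | PX => PC 1 | PY => PC 0
  | PAdd e1 e2 => PAdd (pdX e1) (pdX e2)
  | PMul e1 e2 => PAdd (PMul e1 (pdX e2)) (PMul (pdX e1) e2)
  end.

Fixpoint pdY (e : pexp R) : pexp R :=
  match e with
  | PC _ => PC 0 | PX => PC 0 | PY => PC 1
  | PAdd e1 e2 => PAdd (pdY e1) (pdY e2)
  | PMul e1 e2 => PAdd (PMul e1 (pdY e2)) (PMul (pdY e1) e2)
  end.

Definition pfun (e : pexp R) (p : C2) : CC := peval e p.1 p.2.

Lemma sdiff_peval e (z : 'rV[C]_2) :
  sdiff (fun v => peval e (co v 0) (co v 1)) z
    (fun x => peval (pdX e) (co z 0) (co z 1) * co x 0 +
              peval (pdY e) (co z 0) (co z 1) * co x 1).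
Proof.
elim: e => [c|||e1 IH1 e2 IH2|e1 IH1 e2 IH2] /=.
- by apply: sdiff_ext (sdiff_cst c z) => // x; rewrite !mul0r addr0.
- by apply: sdiff_ext (sdiff_co 0 z) => // x; rewrite mul0r mul1r addr0.
- by apply: sdiff_ext (sdiff_co 1 z) => // x; rewrite mul0r mul1r add0r.
- by apply: sdiff_ext (sdiffD IH1 IH2) => // x; ring.
- by apply: sdiff_ext (sdiffM IH1 IH2) => // x; ring.
Qed.

Lemma fdiff_pfun e p : fdiff (pfun e) p (pfun (pdX e) p) (pfun (pdY e) p).
Proof.
have h := sdiff_fdiff (sdiff_peval e (p2r p)).
have E q : peval e (co (p2r q) 0) (co (p2r q) 1) = pfun e q by rewrite !co_mkrow.
have := h; rewrite !co_mkrow //= !mulr0 !mulr1 addr0 add0r.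
by congr fdiff; apply/funext => q; exact: E.
Qed.

Lemma pdx_pfun e : pdx (pfun e) = pfun (pdX e).
Proof. by apply/funext => p; have [_ h _] := fdiff_differentiable (fdiff_pfun e p). Qed.

Lemma pdy_pfun e : pdy (pfun e) = pfun (pdY e).
Proof. by apply/funext => p; have [_ _ h] := fdiff_differentiable (fdiff_pfun e p). Qed.

Lemma holo_pfun e a : holo_near (pfun e) a.
Proof.
apply/near_C2P; exists 1 => // p _.
by have [] := fdiff_differentiable (fdiff_pfun e p).
Qed.

Definition pjac (e1 e2 : pexp R) : pexp R :=
  PAdd (PMul (pdX e1) (pdY e2)) (PMul (PC (-1)) (PMul (pdY e1) (pdX e2))).

Lemma pfun_pjac (f g : pexp R) (z : C2) : pfun (pjac f g) z =
  (pfun (pdX f) z : C) * pfun (pdY g) z - (pfun (pdY f) z : C) * pfun (pdX g) z.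
Proof. by rewrite /pfun /= mulN1r. Qed.

Lemma Jac_pfun e1 e2 : Jac (pfun e1) (pfun e2) = pfun (pjac e1 e2).
Proof.
apply/funext => p; rewrite /Jac !pdx_pfun !pdy_pfun /pfun /= mulN1r //.
Qed.

Lemma J11_pfun e1 e2 : J11 (pfun e1) (pfun e2) = pfun (pjac (pjac e1 e2) e1).
Proof.
apply/funext => p; rewrite /J11 Jac_pfun; move: (pjac e1 e2) => J.
by rewrite !pdx_pfun !pdy_pfun /pfun /= mulN1r.
Qed.

Lemma poly2_pfun d (h : C2 -> CC) : poly2_le d h -> exists e, h = pfun e.
Proof.
move=> [c hc].
have sum n (P : pred 'I_n) (F : 'I_n -> C2 -> CC) : (forall i, exists e, F i = pfun e) ->
    exists e, (fun p => \sum_(i < n | P i) F i p) = pfun e.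
  move=> hF; have [E hE] := choice hF.
  exists (\big[@PAdd R/PC 0]_(i < n | P i) E i); apply/funext => p.
  rewrite /pfun; elim/big_rec2: _ => [//|i y1 y2 _ ->]; by rewrite hE.
have pow e n : exists e', pfun e' = (fun p => pfun e p ^+ n).
  elim: n => [|n [e' IH]]; first by exists (PC 1).
  exists (PMul e e'); apply/funext => p; have := congr1 (@^~ p) IH => /= hp.
  by rewrite exprS -hp.
have [i|E hE] := sum d.+1 xpredT (fun (i : 'I_d.+1) p =>
    \sum_(j < d.+1 | (i + j <= d)%N) c i j * p.1 ^+ i * p.2 ^+ j); last first.
  by exists E; rewrite -hE; apply/funext => p; rewrite hc.
apply: sum => j; have [e1 h1] := pow PX i; have [e2 h2] := pow PY j.
exists (PMul (PMul (PC (c i j)) e1) e2); apply/funext => p.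
have k1 := congr1 (@^~ p) h1; have k2 := congr1 (@^~ p) h2.
by rewrite /pfun /= in k1 k2; rewrite /pfun /= k1 k2.
Qed.

End Bridge.

(** * Biholomorphic germs *)

Section Germs.
Variable R : realType.
Local Notation C := (R[i]).
Local Notation CC := (CC R).
Local Notation C2 := (C2 R).

Lemma near_comp (f : C2 -> C2) (p q : C2) (P : C2 -> Prop) : f p = q ->
  differentiable f p -> (\forall w \near q, P w) -> \forall z \near p, P (f z).
Proof.
move=> fp df hP; have cf := differentiable_continuous df.
by apply: cf; rewrite fp.
Qed.

Lemma near_C2_imp2 (p : C2) (P Q S : C2 -> Prop) :
  (\forall z \near p, P z) -> (\forall z \near p, Q z) ->
  (forall z, P z -> Q z -> S z) -> \forall z \near p, S z.
Proof.
move=> /near_C2P[d1 d10 h1] /near_C2P[d2 d20 h2] H; apply/near_C2P.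
exists (Num.min d1 d2); first by rewrite lt_min d10.
by move=> z; rewrite lt_min => /andP[k1 k2]; apply: H; [exact: h1|exact: h2].
Qed.

Lemma near_C2_all (p : C2) (P : C2 -> Prop) : (forall z, P z) -> \forall z \near p, P z.
Proof. by move=> h; apply/near_C2P; exists 1. Qed.

Lemma near_C2_center (p : C2) (P : C2 -> Prop) : (\forall z \near p, P z) -> P p.
Proof. by move=> /near_C2P[d d0]; apply; rewrite /dist2 !subrr cmod0 addr0. Qed.

Lemma biholo_germ_inv f (p q : C2) : biholo_germ f p q ->
  exists g, [/\ biholo_germ g q p, (\forall z \near p, g (f z) = z) &
                (\forall w \near q, f (g w) = w)].
Proof.
by move=> [h1 [g [h2 [h3 [h4 [h5 h6]]]]]]; exists g; split => //; split => //; exists f.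
Qed.

Lemma biholo_germ_comp f g (p q r : C2) : biholo_germ f p q -> biholo_germ g q r ->
  biholo_germ (g \o f) p r.
Proof.
move=> [f1 [f' [f2 [f3 [f4 [f5 f6]]]]]] [g1 [g' [g2 [g3 [g4 [g5 g6]]]]]].
have df := near_C2_center f3; have dg' := near_C2_center g4.
split; first by rewrite /= f1.
exists (f' \o g'); split; first by rewrite /= g2.
split.
  by apply: near_C2_imp2 f3 (near_comp f1 df g3) _ => z; exact: differentiable_comp.
split.
  by apply: near_C2_imp2 g4 (near_comp g2 dg' f4) _ => z; exact: differentiable_comp.
split.
  by apply: near_C2_imp2 f5 (near_comp f1 df g5) _ => z h1 h2; rewrite /= h2.
by apply: near_C2_imp2 g6 (near_comp g2 dg' f6) _ => z h1 h2; rewrite /= h2.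
Qed.

Definition polymap (e1 e2 : pexp R) (p : C2) : C2 := (pfun e1 p, pfun e2 p).

Lemma differentiable_pairC2 (f g : C2 -> CC) (p : C2) : differentiable f p ->
  differentiable g p -> differentiable (fun q => (f q, g q) : C2) p.
Proof. exact: differentiable_pair. Qed.

Lemma differentiable_polymap e1 e2 p : differentiable (polymap e1 e2) p.
Proof.
apply: differentiable_pairC2.
  by have [] := fdiff_differentiable (fdiff_pfun e1 p).
by have [] := fdiff_differentiable (fdiff_pfun e2 p).
Qed.

Lemma biholo_germ_polymap e1 e2 e1' e2' (p q : C2) : polymap e1 e2 p = q ->
  cancel (polymap e1 e2) (polymap e1' e2') -> cancel (polymap e1' e2') (polymap e1 e2) ->
  biholo_germ (polymap e1 e2) p q.
Proof.
move=> h c1 c2; split => //; exists (polymap e1' e2'); split; first by rewrite -h c1.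
split; first by apply: near_C2_all => z; exact: differentiable_polymap.
split; first by apply: near_C2_all => z; exact: differentiable_polymap.
by split; apply: near_C2_all => z; [exact: c1|exact: c2].
Qed.

Lemma strict_diff_differentiable (P : 'rV[C]_2 -> 'rV[C]_2) (p : C2) A :
  strict_diff P (p2r p) A -> differentiable (fun q => r2p (P (p2r q))) p.
Proof.
move=> h; apply: differentiable_pairC2.
  by have [] := fdiff_differentiable (sdiff_fdiff (strict_diff_coord (inord 0) h)).
by have [] := fdiff_differentiable (sdiff_fdiff (strict_diff_coord (inord 1) h)).
Qed.

Lemma biholo_germ_row (P : 'rV[C]_2 -> 'rV[C]_2) : local_biholo P ->
  biholo_germ (fun q => r2p (P (p2r q))) 0 0.
Proof.
move=> [P0 [Q [s [s0 Q0 h1 h2 [h3 h4]]]]].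
have r0 : r2p (0 : 'rV[C]_2) = 0 :> C2 by rewrite -p2r0 p2rK.
split; first by rewrite p2r0 P0 r0.
exists (fun q => r2p (Q (p2r q))); split; first by rewrite p2r0 Q0 r0.
split.
  apply/near_C2P; exists s => // z; rewrite -vn_p2r => /h3[A hA].
  exact: strict_diff_differentiable hA.
split.
  apply/near_C2P; exists s => // z; rewrite -vn_p2r => /h4[A hA].
  exact: strict_diff_differentiable hA.
split; apply/near_C2P; exists s => // z; rewrite -vn_p2r => hz.
  by rewrite r2pK h2 // p2rK.
by rewrite r2pK h1 // p2rK.
Qed.

End Germs.

(** * Jets and Jacobians under affine changes *)

Section Jets.
Variable R : realType.
Local Notation C := (R[i]).
Local Notation CC := (CC R).
Local Notation C2 := (C2 R).
Implicit Types (e f g : pexp R).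

Lemma pfunE e (x y : C) : pfun e (x, y) = peval e x y.
Proof. by []. Qed.

(** The formal derivatives compute [pdx] and [pdy], which see only the values. *)
Lemma peval_pdX_ext e f : (forall x y, peval e x y = peval f x y) ->
  (forall x y, peval (pdX e) x y = peval (pdX f) x y) /\
  (forall x y, peval (pdY e) x y = peval (pdY f) x y).
Proof.
move=> ef; have E : pfun e = pfun f by apply/funext => -[x y]; exact: ef.
split=> x y.
  by rewrite -!pfunE -!pdx_pfun E.
by rewrite -!pfunE -!pdy_pfun E.
Qed.

Lemma peval_pdX_subst e s t x y :
  peval (pdX (psubst e s t)) x y =
    peval (pdX e) (peval s x y) (peval t x y) * peval (pdX s) x y +
    peval (pdY e) (peval s x y) (peval t x y) * peval (pdX t) x y.
Proof.
by elim: e => [c|||e1 IH1 e2 IH2|e1 IH1 e2 IH2] /=;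
  rewrite ?IH1 ?IH2 ?peval_subst; ring.
Qed.

Lemma peval_pdY_subst e s t x y :
  peval (pdY (psubst e s t)) x y =
    peval (pdX e) (peval s x y) (peval t x y) * peval (pdY s) x y +
    peval (pdY e) (peval s x y) (peval t x y) * peval (pdY t) x y.
Proof.
by elim: e => [c|||e1 IH1 e2 IH2|e1 IH1 e2 IH2] /=;
  rewrite ?IH1 ?IH2 ?peval_subst; ring.
Qed.

Definition paff (a v w : C) : pexp R :=
  PAdd (PC a) (PAdd (PMul (PC v) PX) (PMul (PC w) PY)).

(** Determinant 1 leaves no factor, so the rule can be iterated from [J] to [K]. *)
Lemma pjac_subst f g (a1 a2 v1 v2 w1 w2 : C) : v1 * w2 - v2 * w1 = 1 ->
  let s := paff a1 v1 w1 in let t := paff a2 v2 w2 in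
  forall x y, peval (pjac (psubst f s t) (psubst g s t)) x y =
              peval (psubst (pjac f g) s t) x y.
Proof.
move=> d s t x y; rewrite peval_subst.
rewrite {1}/pjac; cbn [peval].
rewrite !peval_pdX_subst !peval_pdY_subst.
have -> : peval (pdX s) x y = v1 by rewrite /=; ring.
have -> : peval (pdX t) x y = v2 by rewrite /=; ring.
have -> : peval (pdY s) x y = w1 by rewrite /=; ring.
have -> : peval (pdY t) x y = w2 by rewrite /=; ring.
set fx := peval (pdX f) _ _; set fy := peval (pdY f) _ _.
set gx := peval (pdX g) _ _; set gy := peval (pdY g) _ _.
transitivity ((v1 * w2 - v2 * w1) * (fx * gy + -1 * (fy * gx))); first by ring.
by rewrite d mul1r.
Qed.

Lemma peval_pjac_ext f f' g g' : (forall x y, peval f x y = peval f' x y) ->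
  (forall x y, peval g x y = peval g' x y) ->
  forall x y, peval (pjac f g) x y = peval (pjac f' g') x y.
Proof.
move=> hf hg x y; have [f1 f2] := peval_pdX_ext hf; have [g1 g2] := peval_pdX_ext hg.
by rewrite /pjac; cbn [peval]; rewrite f1 f2 g1 g2.
Qed.

Definition jet5 (c00 c10 c01 c02 : C) (a b c : pexp R) : pexp R :=
  PAdd (PC c00) (PAdd (PMul (PC c10) PX) (PAdd (PMul (PC c01) PY)
   (PAdd (PMul (PC c02) (PMul PY PY)) (jet_exp a b c)))).

Lemma jet5_partials c00 c10 c01 c02 a b c :
  let e := jet5 c00 c10 c01 c02 a b c in
  [/\ peval (pdX e) 0 0 = c10, peval (pdY e) 0 0 = c01 &
   [/\ peval (pdX (pdY e)) 0 0 = peval b 0 0, peval (pdY (pdX e)) 0 0 = peval b 0 0,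
       peval (pdY (pdY e)) 0 0 = 2 * c02 &
       peval (pdY (pdY (pdY e))) 0 0 = 6 * peval c 0 0]].
Proof. by split; [..|split]; rewrite /=; ring. Qed.

(** Once the gradient of [f] is [(1, 0)], the vanishing of [K] is that of [J_y]. The determinant of
    the gradients of [J] and [K] is then [J_x K_y], and its factors are the two quantities required
    by the normal form. *)
Lemma pjac_values f g : let J := pjac f g in let K := pjac J f in
  peval (pdX f) 0 0 = 1 -> peval (pdY f) 0 0 = 0 -> peval J 0 0 = 0 ->
  peval K 0 0 = 0 ->
  peval (pdY (pdX f)) 0 0 = peval (pdX (pdY f)) 0 0 ->
  peval (pdY (pdX g)) 0 0 = peval (pdX (pdY g)) 0 0 ->
  let al := peval (pdX g) 0 0 in let be := peval (pdX (pdY f)) 0 0 in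
  let be' := peval (pdX (pdY g)) 0 0 in let k := peval (pdY (pdY f)) 0 0 in
  [/\ peval (pdY g) 0 0 = 0, peval (pdY (pdY g)) 0 0 = al * k,
      peval (pdY J) 0 0 = 0, peval (pdX J) 0 0 = be' - al * be &
      peval (pdY K) 0 0 = 3 * k * (be' - al * be)
        - (peval (pdY (pdY (pdY g))) 0 0 - al * peval (pdY (pdY (pdY f))) 0 0)].
Proof.
move=> J K fx fy J0 K0 sf sg al be be' k.
have gy : peval (pdY g) 0 0 = 0.
  by move: J0; rewrite /J /= fx fy mul1r mul0r mulr0 addr0.
have Jy : peval (pdY J) 0 0 = peval (pdY (pdY g)) 0 0 - al * k.
  by rewrite /J /= fx fy gy -/al -/k; ring.
have Jx : peval (pdX J) 0 0 = be' - al * be.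
  by rewrite /J /= fx fy gy -/al -/be -/be'; ring.
have Jy0 : peval (pdY J) 0 0 = 0.
  move: K0; rewrite /K {1}/pjac; cbn [peval]; rewrite fx fy mulr0 mulr1 add0r mulN1r.
  by move/eqP; rewrite oppr_eq0 => /eqP.
have g2 : peval (pdY (pdY g)) 0 0 = al * k by apply/eqP; rewrite -subr_eq0 -Jy Jy0.
split => //.
have -> : peval (pdY K) 0 0 = peval (pdX J) 0 0 * k - peval (pdY (pdY J)) 0 0.
  have gen (A B : pexp R) : peval (pdY (pjac A B)) 0 0 =
      peval (pdX A) 0 0 * peval (pdY (pdY B)) 0 0
      + peval (pdY (pdX A)) 0 0 * peval (pdY B) 0 0
      - (peval (pdY A) 0 0 * peval (pdY (pdX B)) 0 0
         + peval (pdY (pdY A)) 0 0 * peval (pdX B) 0 0) by rewrite /=; ring.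
  by rewrite /K gen fx fy Jy0 -/k; ring.
have -> : peval (pdY (pdY J)) 0 0 = (peval (pdY (pdY (pdY g))) 0 0
   - al * peval (pdY (pdY (pdY f))) 0 0) + 2 * be * (al * k) - 2 * k * be'.
  by rewrite /J /= fx fy gy g2 sf sg -/al -/be -/be' -/k; ring.
by rewrite Jx; ring.
Qed.

End Jets.

(** * From nondegenerate jets to the cusp *)

Section JetsToCusp.
Variable R : realType.
Local Notation C := (R[i]).
Local Notation CC := (CC R).
Local Notation C2 := (C2 R).
Implicit Types (e f g : pexp R).

Lemma cusp_model_polymap :
  @cusp_model R = polymap PX (PAdd (PMul PY (PMul PY PY)) (PMul PX PY)).
Proof.
by apply/funext => -[x y]; rewrite /cusp_model /polymap /pfun /= !exprS expr0 mulr1.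
Qed.

Lemma near_cusp_model (P : C2 -> Prop) : (\forall w \near (0 : C2), P w) ->
  \forall z \near (0 : C2), P (cusp_model z).
Proof.
apply: near_comp; last by rewrite cusp_model_polymap; exact: differentiable_polymap.
by rewrite cusp_model_polymap /polymap /pfun /= !mulr0 addr0.
Qed.

Lemma has_cusp_of_form (F : C2 -> C2) (p : C2) (s t : C2 -> C2) (a b c a' b' c' : pexp R) :
  peval b' 0 0 != 0 -> peval c' 0 0 != 0 ->
  biholo_germ s 0 p -> biholo_germ t 0 (F p) ->
  (forall z, F (s z) = t (polymap (PAdd PX (jet_exp a b c)) (jet_exp a' b' c') z)) ->
  has_cusp F p.
Proof.
move=> b0 c0 hs ht hF.
have [Phi [Chi [r [r0 hPhi hChi hE]]]] := cusp_normal_form a b c a' b0 c0.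
have gPhi := biholo_germ_row hPhi; have gChi := biholo_germ_row hChi.
have g1 := biholo_germ_comp gPhi hs; have g2 := biholo_germ_comp gChi ht.
have [psi [hpsi k1 k2]] := biholo_germ_inv g2.
exists (s \o (fun q => r2p (Phi (p2r q)))), psi; split => //; split => //.
have kQ : \forall z \near (0 : C2), vn (p2r z) < r.
  by apply/near_C2P; exists r => // z; rewrite -vn_p2r.
apply: near_C2_imp2 (near_cusp_model k1) kQ _ => z hz /hE[e1 e2].
have cr : cusp_row (p2r z) = p2r (cusp_model z) by rewrite /cusp_row /p2r !co_mkrow.
rewrite cr in e1 e2; rewrite /comp hF -[RHS]hz; congr (psi (t _)).
by rewrite /r2p -e1 -e2.
Qed.

(** In the source, an affine change makes the gradient of [f] equal to [(1, 0)] and a shear removes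
    its [y^2] term; in the target, the constants and [al] times the first component are split off.
    The determinant says that the new [b'] and [c'] are nonzero at 0. *)
Theorem cusp_of_jets f g (p : C2) :
  let J := pjac f g in let K := pjac J f in
  (pfun (pdX f) p != 0) || (pfun (pdY f) p != 0) ->
  pfun J p = 0 -> pfun K p = 0 ->
  (pfun (pdX J) p : C) * pfun (pdY K) p - (pfun (pdY J) p : C) * pfun (pdX K) p != 0 ->
  has_cusp (polymap f g) p.
Proof.
case: p => a1 a2 J K; rewrite !pfunE => hgrad J0 K0 hdet.
set fx := peval (pdX f) a1 a2 in hgrad; set fy := peval (pdY f) a1 a2 in hgrad.
(* [w] is tangent to the level curve of [f], and [v] is a direction in which [f] has derivative 1;
   their determinant is that same derivative. *)
pose w1 := - fy; pose w2 := fx.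
have [v1 [v2 [dvw fv]]] : exists v1 v2, v1 * w2 - v2 * w1 = 1 /\ fx * v1 + fy * v2 = 1.
  case/orP: hgrad => h.
    by exists fx^-1, 0; rewrite /w1 /w2; split; field.
  by exists 0, fy^-1; rewrite /w1 /w2; split; field.
have fw : fx * w1 + fy * w2 = 0 by rewrite /w1 /w2; ring.
pose s := paff a1 v1 w1; pose t := paff a2 v2 w2.
have s0 : peval s 0 0 = a1 by rewrite /=; ring.
have t0 : peval t 0 0 = a2 by rewrite /=; ring.
pose f1 := psubst f s t; pose g1 := psubst g s t.
have [c00 [c10 [c01 [ka [a [b [c hf]]]]]]] := pexp_jet f1.
have [d00 [al [d01 [la [a' [b' [c' hg]]]]]]] := pexp_jet g1.
pose F := jet5 c00 c10 c01 ka a b c; pose G := jet5 d00 al d01 la a' b' c'.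
have hF x y : peval F x y = peval f1 x y by rewrite hf /=; ring.
have hG x y : peval G x y = peval g1 x y by rewrite hg /=; ring.
have [F1 F2] := peval_pdX_ext hF.
have hJ x y : peval (pjac F G) x y = peval (psubst J s t) x y.
  by rewrite (peval_pjac_ext hF hG) (pjac_subst f g a1 a2 dvw).
have hK x y : peval (pjac (pjac F G) F) x y = peval (psubst K s t) x y.
  by rewrite (peval_pjac_ext hJ hF) (pjac_subst J f a1 a2 dvw).
have [J1 J2] := peval_pdX_ext hJ; have [K1 K2] := peval_pdX_ext hK.
have sx x y : peval (pdX s) x y = v1 by rewrite /=; ring.
have tx x y : peval (pdX t) x y = v2 by rewrite /=; ring.
have sy x y : peval (pdY s) x y = w1 by rewrite /=; ring.
have ty x y : peval (pdY t) x y = w2 by rewrite /=; ring.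
have [pf1 pf2 [pf3 pf4 pf5 pf6]] := jet5_partials c00 c10 c01 ka a b c.
have [pg1 pg2 [pg3 pg4 pg5 pg6]] := jet5_partials d00 al d01 la a' b' c'.
rewrite -/F in pf1 pf2 pf3 pf4 pf5 pf6; rewrite -/G in pg1 pg2 pg3 pg4 pg5 pg6.
have Fx : peval (pdX F) 0 0 = 1.
  by rewrite F1 peval_pdX_subst s0 t0 sx tx.
have Fy : peval (pdY F) 0 0 = 0.
  by rewrite F2 peval_pdY_subst s0 t0 sy ty.
have JJ0 : peval (pjac F G) 0 0 = 0 by rewrite hJ peval_subst s0 t0.
have KK0 : peval (pjac (pjac F G) F) 0 0 = 0 by rewrite hK peval_subst s0 t0.
have [] := @pjac_values R F G Fx Fy JJ0 KK0; rewrite ?pf3 ?pf4 ?pg3 ?pg4 //.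
rewrite pg1 pg2 pf5 pg5 pf6 pg6 => d010 laE JY JX KY.
have {}laE : la = al * ka.
  have h2 : (2 : C) != 0 by rewrite pnatr_eq0.
  by apply: (mulfI h2); rewrite laE; ring.
have det2 : peval (pdX (pjac F G)) 0 0 * peval (pdY (pjac (pjac F G) F)) 0 0
   - peval (pdY (pjac F G)) 0 0 * peval (pdX (pjac (pjac F G) F)) 0 0 != 0.
  rewrite J1 J2 K1 K2 !peval_pdX_subst !peval_pdY_subst s0 t0 !sx !tx !sy !ty.
  set A := peval (pdX J) a1 a2 in hdet *; set B := peval (pdY J) a1 a2 in hdet *.
  set D := peval (pdX K) a1 a2 in hdet *; set E := peval (pdY K) a1 a2 in hdet *.
  have -> : (A * v1 + B * v2) * (D * w1 + E * w2) - (A * w1 + B * w2) * (D * v1 + E * v2)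
     = (v1 * w2 - v2 * w1) * (A * E - B * D) by ring.
  by rewrite dvw mul1r.
rewrite JY mul0r subr0 mulf_eq0 negb_or JX KY in det2.
case/andP: det2 => nb nc.
set b0 := peval b 0 0 in nb nc; set b0' := peval b' 0 0 in nb nc.
set c0 := peval c 0 0 in nc; set c0' := peval c' 0 0 in nc.
rewrite pf1 in Fx; rewrite pf2 in Fy.
(* Substituting [x - ka y^2] for [x] cancels [ka y^2] in [f]. Expanding [x^2 u + x y w + y^3 z]
   under it gives the new coefficients [tb] of [x y] and [tc] of [y^3]. *)
pose sh : pexp R := PAdd PX (PMul (PC (- ka)) (PMul PY PY)).
pose S e := psubst e sh PY.
pose lin (u u' : pexp R) := PAdd u' (PMul (PC (- al)) u).
pose tb (u w : pexp R) := PAdd (S w) (PMul (PC (- (2 * ka))) (PMul PY (S u))).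
pose tc (u w z : pexp R) := PAdd (S z) (PAdd (PMul (PC (- ka)) (S w))
                                  (PMul (PC (ka ^+ 2)) (PMul PY (S u)))).
pose s1 := psubst s sh PY; pose s2 := psubst t sh PY.
pose dx : pexp R := PAdd PX (PC (- a1)); pose dy : pexp R := PAdd PY (PC (- a2)).
pose iX : pexp R := PAdd (PMul (PC w2) dx) (PMul (PC (- w1)) dy).
pose iY : pexp R := PAdd (PMul (PC v1) dy) (PMul (PC (- v2)) dx).
pose t1 : pexp R := PAdd PX (PC c00).
pose t2 : pexp R := PAdd PY (PAdd (PMul (PC al) PX) (PC d00)).
have dvw' : v1 * w2 = 1 + v2 * w1 by rewrite -dvw; ring.
apply: (@has_cusp_of_form (polymap f g) (a1, a2) (polymap s1 s2) (polymap t1 t2)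
   (S a) (tb a b) (tc a b c)
   (S (lin a a')) (tb (lin a a') (lin b b')) (tc (lin a a') (lin b b') (lin c c'))).
- rewrite /= !peval_subst /= !(mulr0, mul0r, addr0) -/b0 -/b0'.
  by have -> : b0' + - al * b0 = b0' - al * b0 by ring.
(* The new [y^3] coefficient is, up to the factor [-6], the second factor of the determinant. *)
- rewrite /= !peval_subst /= !(mulr0, mul0r, addr0) -/b0 -/b0' -/c0 -/c0'.
  apply: contraNN nc => /eqP h.
  have -> : 3 * (2 * ka) * (b0' - al * b0) - (6 * c0' - al * (6 * c0)) =
    -6 * (c0' + - al * c0 + (- ka * (b0' + - al * b0))) by ring.
  by rewrite h mulr0.
- apply: (@biholo_germ_polymap _ _ _ (PAdd iX (PMul (PC ka) (PMul iY iY))) iY).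
  + by rewrite /polymap /pfun /= !(mulr0, addr0).
  + move=> [x y]; rewrite /polymap /pfun /= ?peval_subst /=.
    have E1 : w2 * (a1 + (v1 * (x + - ka * (y * y)) + w1 * y) + - a1) +
       - w1 * (a2 + (v2 * (x + - ka * (y * y)) + w2 * y) + - a2) =
       (v1 * w2 - v2 * w1) * (x + - ka * (y * y)) by ring.
    have E2 : v1 * (a2 + (v2 * (x + - ka * (y * y)) + w2 * y) + - a2) +
       - v2 * (a1 + (v1 * (x + - ka * (y * y)) + w1 * y) + - a1) =
       (v1 * w2 - v2 * w1) * y by ring.
    by rewrite E1 E2 dvw !mul1r; congr (_, _); ring.
  + move=> [x y]; rewrite /polymap /pfun /= ?peval_subst /=.
    congr (_, _).
      transitivity (a1 + (v1 * w2 - v2 * w1) * (x - a1)); first by ring.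
      by rewrite dvw; ring.
    transitivity (a2 + (v1 * w2 - v2 * w1) * (y - a2)); first by ring.
    by rewrite dvw; ring.
- apply: (@biholo_germ_polymap _ _ _ (PAdd PX (PC (- c00)))
    (PAdd PY (PAdd (PC (- d00)) (PMul (PC (- al)) (PAdd PX (PC (- c00))))))).
  + rewrite /polymap /pfun /= !(mulr0, add0r).
    have hf0 := hf 0 0; have hg0 := hg 0 0; rewrite !peval_subst s0 t0 in hf0 hg0.
    rewrite hf0 hg0; congr (_, _); ring.
  + by move=> [x y]; rewrite /polymap /pfun /=; congr (_, _); ring.
  + by move=> [x y]; rewrite /polymap /pfun /=; congr (_, _); ring.
move=> [x y]; rewrite /polymap /pfun /= ?peval_subst /=.
set X := x + - ka * (y * y).
have Ef : peval f (a1 + (v1 * X + w1 * y)) (a2 + (v2 * X + w2 * y)) = peval f1 X y.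
  by rewrite peval_subst.
have Eg : peval g (a1 + (v1 * X + w1 * y)) (a2 + (v2 * X + w2 * y)) = peval g1 X y.
  by rewrite peval_subst.
rewrite Ef Eg hf hg d010 Fx Fy laE.
move: (peval a X y) (peval b X y) (peval c X y) (peval a' X y) (peval b' X y) (peval c' X y).
by rewrite /X => A B D A' B' D'; congr (_, _); ring.
Qed.

End JetsToCusp.

(** * Local algebras of dimension at most one *)

Section HoloRing.
Variable R : realType.
Local Notation C := (R[i]).
Local Notation CC := (CC R).
Local Notation C2 := (C2 R).

Lemma differentiableM_C2 (f g : C2 -> CC) (p : C2) : differentiable f p ->
  differentiable g p -> differentiable (fun z => (f z : C) * g z : CC) p.
Proof. exact: differentiableM. Qed.

Lemma differentiableD_C2 (f g : C2 -> CC) (p : C2) : differentiable f p ->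
  differentiable g p -> differentiable (fun z => (f z : C) + g z : CC) p.
Proof. exact: differentiableD. Qed.

Lemma differentiableV_C2 (f : C2 -> CC) (p : C2) : differentiable f p ->
  (f p : C) != 0 -> differentiable (fun z => (f z : C)^-1 : CC) p.
Proof. by move=> df f0; exact: differentiableV. Qed.

Lemma holoM (f g : C2 -> CC) a : holo_near f a -> holo_near g a ->
  holo_near (fun z => (f z : C) * g z : CC) a.
Proof. by move=> hf hg; apply: near_C2_imp2 hf hg _ => z; exact: differentiableM_C2. Qed.

Lemma holoD (f g : C2 -> CC) a : holo_near f a -> holo_near g a ->
  holo_near (fun z => (f z : C) + g z : CC) a.
Proof. by move=> hf hg; apply: near_C2_imp2 hf hg _ => z; exact: differentiableD_C2. Qed.

Lemma holo_cst (c : CC) a : holo_near (fun=> c : CC) a.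
Proof. exact: (holo_pfun (PC (c : C)) a). Qed.

Lemma fcont_neq0 (f : C2 -> C) a : fcont f a -> f a != 0 ->
  \forall z \near a, f z != 0.
Proof.
move=> hf f0; have h2 : 0 < cmod (f a) / 2 by rewrite divr_gt0 ?cmod_gt0.
have [d d0 hd] := hf _ h2; apply/near_C2P; exists d => // z /hd h.
have fp : 0 < cmod (f a) by rewrite cmod_gt0.
rewrite -cmod_gt0; have := cmod_sub_le (f a) (f z); rewrite cmodB; lra.
Qed.

Lemma holo_fcont (f : C2 -> CC) a : holo_near f a -> fcont f a.
Proof. by move=> /near_C2_center/differentiable_fdiff; exact: fdiff_fcont. Qed.

Lemma holoV (f : C2 -> CC) a : holo_near f a -> (f a : C) != 0 ->
  holo_near (fun z => (f z : C)^-1 : CC) a.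
Proof.
move=> hf f0; apply: near_C2_imp2 hf (fcont_neq0 (holo_fcont hf) f0) _ => z.
exact: differentiableV_C2.
Qed.

Lemma fdiff_near (f g : C2 -> C) a L1 L2 : (\forall z \near a, f z = g z) ->
  fdiff f a L1 L2 -> fdiff g a L1 L2.
Proof.
move=> /near_C2P[d d0 h] hf e e0; have [d1 d10 h1] := hf e e0.
exists (Num.min d d1); first by rewrite lt_min d0.
move=> z; rewrite lt_min => /andP[k1 k2]; rewrite -h // -(h a); first exact: h1.
by rewrite /dist2 !subrr cmod0 addr0.
Qed.

Lemma fdiff_unique (f : C2 -> CC) a L1 L2 K1 K2 : fdiff f a L1 L2 -> fdiff f a K1 K2 ->
  L1 = K1 /\ L2 = K2.
Proof.
by move=> /fdiff_differentiable[_ <- <-] /fdiff_differentiable[_ <- <-].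
Qed.

Lemma fdiffD (f g : C2 -> C) a L1 L2 K1 K2 : fdiff f a L1 L2 -> fdiff g a K1 K2 ->
  fdiff (fun z => f z + g z) a (L1 + K1) (L2 + K2).
Proof.
move=> hf hg e e0; have e2 : 0 < e / 2 by rewrite divr_gt0.
have [d1 d10 h1] := hf _ e2; have [d2 d20 h2] := hg _ e2.
exists (Num.min d1 d2); first by rewrite lt_min d10.
move=> z; rewrite lt_min => /andP[/h1 k1 /h2 k2].
move: ((z.1 : C) - a.1) ((z.2 : C) - a.2) k1 k2 => x y k1 k2.
have -> : f z + g z - (f a + g a) - ((L1 + K1) * x + (L2 + K2) * y) =
  (f z - f a - (L1 * x + L2 * y)) + (g z - g a - (K1 * x + K2 * y)) by ring.
by apply: le_trans (cmodD _ _) _; apply: le_trans (lerD k1 k2) _; lra.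
Qed.

(* Only continuity of [u] is needed where [k] vanishes. *)
Lemma fdiff_mul_cont (u k : C2 -> C) a L1 L2 : fcont u a -> fdiff k a L1 L2 ->
  k a = 0 -> fdiff (fun z => u z * k z) a (u a * L1) (u a * L2).
Proof.
move=> hu hk k0 e e0.
have [d1 d10 lk] := fdiff_lipschitz hk.
set M := cmod L1 + cmod L2 + 1 in lk.
have M0 : 0 < M by have := cmod_ge0 L1; have := cmod_ge0 L2; rewrite /M; lra.
have U0 : 0 < cmod (u a) + 1 by have := cmod_ge0 (u a); lra.
have e1 : 0 < e / 2 / M by rewrite !divr_gt0.
have e2 : 0 < e / 2 / (cmod (u a) + 1) by rewrite !divr_gt0.
have [d2 d20 h2] := hu _ e1; have [d3 d30 h3] := hk _ e2.
exists (Num.min d1 (Num.min d2 d3)); first by rewrite !lt_min d10 d20.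
move=> z; rewrite !lt_min => /and3P[z1 z2 z3].
have := lk _ z1; have := h2 _ z2; have := h3 _ z3; rewrite k0 !subr0 mulr0 subr0.
move: ((z.1 : C) - a.1) ((z.2 : C) - a.2) => x y k3 k2 k1.
have -> : u z * k z - (u a * L1 * x + u a * L2 * y) =
   (u z - u a) * k z + u a * (k z - (L1 * x + L2 * y)) by ring.
apply: le_trans (cmodD _ _) _; rewrite !cmodM.
have D0 := dist2_ge0 z a.
have -> : e * dist2 z a = e / 2 / M * (M * dist2 z a) +
   (cmod (u a) + 1) * (e / 2 / (cmod (u a) + 1) * dist2 z a).
  by field; rewrite !gt_eqF.
apply: lerD; first by apply: ler_pM; rewrite ?cmod_ge0.
by apply: ler_pM; rewrite ?cmod_ge0 //; lra.
Qed.

End HoloRing.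

(** * Local algebras of dimension zero and one *)

Section QuotientDimension.
Variable R : realType.
Local Notation C := (R[i]).
Local Notation CC := (CC R).
Local Notation C2 := (C2 R).
Implicit Types (a : C2) (p q h : C2 -> CC).

(** A generator that is nonzero at [a] is invertible as a germ, by continuity. *)
Lemma in_ideal_unit a p q h : holo_near p a -> holo_near q a -> holo_near h a ->
  ((p a : C) != 0) || ((q a : C) != 0) -> in_ideal2 a p q h.
Proof.
move=> hp hq hh /orP[p0|q0].
  exists (fun z => (h z : C) * (p z : C)^-1 : CC), (fun=> 0); split.
  - exact: holoM hh (holoV hp p0).
  - exact: holo_cst.
  - apply: near_C2_imp2 (fcont_neq0 (holo_fcont hp) p0) (near_C2_all a (fun=> I)) _ => z pz _.
    by rewrite mul0r addr0 divfK.
exists (fun=> 0), (fun z => (h z : C) * (q z : C)^-1 : CC); split.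
- exact: holo_cst.
- exact: holoM hh (holoV hq q0).
- apply: near_C2_imp2 (fcont_neq0 (holo_fcont hq) q0) (near_C2_all a (fun=> I)) _ => z qz _.
  by rewrite mul0r add0r divfK.
Qed.

Lemma quot_dim_unit a p q : holo_near p a -> holo_near q a ->
  ((p a : C) != 0) || ((q a : C) != 0) -> forall n, quot_dim a p q n <-> n = 0%N.
Proof.
move=> hp hq hu n; split; last first.
  move=> ->; exists (fun=> fun=> 0); split.
  - by case.
  - move=> h hh; exists (fun=> 0); apply: in_ideal_unit => //.
    by under eq_fun do rewrite big_ord0 subr0.
  - by move=> c _; case.
case: n => // n [e [he _ hi]].
have := hi (fun i => (i == ord0)%:R) _ ord0; rewrite eqxx => h.
have /eqP : (1 : CC) = 0.
  apply: h; apply: in_ideal_unit => //.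
  have -> : (fun z => \sum_(i < n.+1) (i == ord0)%:R * e i z) = e ord0.
    apply/funext => z; rewrite (bigD1 ord0) //= big1.
      by rewrite addr0 ?eqxx mul1r.
    by move=> i /negbTE ->; rewrite mul0r.
  exact: he.
by rewrite oner_eq0.
Qed.

(** In dimension one every germ vanishing at [a] lies in the ideal. For the two coordinate functions
    this writes the unit vectors as combinations of the gradients of [p] and [q]. *)
Lemma quot_dim1_grad a p q (p1 p2 q1 q2 : C) : holo_near p a -> holo_near q a ->
  fdiff p a p1 p2 -> fdiff q a q1 q2 -> quot_dim a p q 1 ->
  [/\ p a = 0, q a = 0 & p1 * q2 - p2 * q1 != 0].
Proof.
move=> hp hq dp dq hQ.
have [pa qa] : p a = 0 /\ q a = 0.
  have [//|] := pselect (p a = 0 /\ q a = 0) => nh.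
  have hu : ((p a : C) != 0) || ((q a : C) != 0).
    have [p0|p0] := eqVneq (p a : C) 0 => //=.
    by apply/eqP => q0; apply: nh.
  by have := (quot_dim_unit hp hq hu 1).1 hQ.
split => //.
have [e [he hs _]] := hQ.
have ideal0 h : in_ideal2 a p q h -> h a = 0.
  by move=> [u1 [u2 [_ _ /near_C2_center ->]]]; rewrite pa qa !mulr0 addr0.
(* The class of 1 is a multiple of the basis germ, and members of the ideal vanish at [a]. *)
have e0 : (e ord0 a : C) != 0.
  have [c /ideal0] := hs (fun=> 1) (holo_cst 1 a).
  rewrite big_ord1 => /eqP; rewrite subr_eq0 => /eqP h.
  by apply/eqP => ee; move: h; rewrite ee mulr0 => /eqP; rewrite oner_eq0.
have key h (h1 h2 : C) : holo_near h a -> h a = 0 -> fdiff h a h1 h2 ->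
    exists x y : C, h1 = x * p1 + y * q1 /\ h2 = x * p2 + y * q2.
  move=> hh h0 dh; have [c hc] := hs h hh.
  have c0 : c ord0 = 0.
    have := ideal0 _ hc; rewrite big_ord1 h0 sub0r => /eqP.
    by rewrite oppr_eq0 mulf_eq0 (negbTE e0) orbF => /eqP.
  have [u1 [u2 [hu1 hu2 hE]]] := hc.
  have d1 := fdiff_mul_cont (holo_fcont hu1) dp pa.
  have d2 := fdiff_mul_cont (holo_fcont hu2) dq qa.
  have d3 := fdiffD d1 d2.
  exists (u1 a), (u2 a); apply: fdiff_unique dh _.
  apply: fdiff_near d3; apply: near_C2_imp2 hE (near_C2_all a (fun=> I)) _ => z hz _.
  by rewrite -[LHS]hz big_ord1 c0 mul0r subr0.
pose X : pexp R := PAdd PX (PC (- (a.1 : C))); pose Y : pexp R := PAdd PY (PC (- (a.2 : C))).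
have [|x [y [X1 X2]]] := key (pfun X) _ _ (holo_pfun X a) _ (fdiff_pfun X a).
  by rewrite /pfun /= subrr.
have [|x' [y' [Y1 Y2]]] := key (pfun Y) _ _ (holo_pfun Y a) _ (fdiff_pfun Y a).
  by rewrite /pfun /= subrr.
rewrite /pfun /= !addr0 in X1 X2 Y1 Y2.
apply/eqP => D0.
have : (x * y' - y * x') * (p1 * q2 - p2 * q1) = 1.
  have -> : (x * y' - y * x') * (p1 * q2 - p2 * q1) =
    (x * p1 + y * q1) * (x' * p2 + y' * q2) - (x * p2 + y * q2) * (x' * p1 + y' * q1) by ring.
  by rewrite -X1 -X2 -Y1 -Y2 mul0r subr0 mul1r.
by rewrite D0 mulr0 => /eqP; rewrite eq_sym oner_eq0.
Qed.

End QuotientDimension.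

(** * Generators of the maximal ideal *)

Section MaximalIdeal.
Variable R : realType.
Local Notation C := (R[i]).
Local Notation CC := (CC R).
Local Notation C2 := (C2 R).

Lemma pexp_division_at (e : pexp R) (a : C2) : exists A B : pexp R,
  [/\ forall z : C2, (pfun e z : C) = (pfun e a : C)
        + ((z.1 : C) - a.1) * pfun A z + ((z.2 : C) - a.2) * pfun B z,
      pfun A a = pfun (pdX e) a & pfun B a = pfun (pdY e) a].
Proof.
case: a => a1 a2.
have [A [B h]] := pexp_division (psubst e (PAdd PX (PC a1)) (PAdd PY (PC a2))).
pose X : pexp R := PAdd PX (PC (- a1)); pose Y : pexp R := PAdd PY (PC (- a2)).
pose A' := psubst A X Y; pose B' := psubst B X Y.
have E x y : peval e x y = peval e a1 a2 + (x - a1) * peval A' x y + (y - a2) * peval B' x y.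
  have := h (x - a1) (y - a2).
  by rewrite !peval_subst /= !subrK !add0r.
have E2 x y : peval e x y =
    peval (PAdd (PC (peval e a1 a2)) (PAdd (PMul X A') (PMul Y B'))) x y.
  by rewrite E /= addrA.
have [k1 k2] := peval_pdX_ext E2.
exists A', B'; split.
- by move=> [x y]; exact: E.
- by rewrite !pfunE k1 /=; rewrite !subrr; ring.
- by rewrite !pfunE k2 /=; rewrite !subrr; ring.
Qed.

(** [P] and [Q] are combinations of the two coordinates with a matrix of germs invertible at [a];
    Hadamard's lemma for [h] and Cramer's rule put [h - h a] into the ideal. *)
Lemma quot_dim1_intro (P Q : pexp R) (a : C2) : pfun P a = 0 -> pfun Q a = 0 ->
  (pfun (pdX P) a : C) * pfun (pdY Q) a - (pfun (pdY P) a : C) * pfun (pdX Q) a != 0 ->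
  quot_dim a (pfun P) (pfun Q) 1.
Proof.
move=> P0 Q0 hdet.
have [A [B [hP A0 B0]]] := pexp_division_at P a.
have [A' [B' [hQ A0' B0']]] := pexp_division_at Q a.
rewrite -A0 -B0 -A0' -B0' in hdet.
pose D : pexp R := PAdd (PMul A B') (PMul (PC (-1)) (PMul B A')).
have Da : (pfun D a : C) != 0.
  move: hdet; rewrite /D /pfun /=; set x := (_ * _); set y := (_ * _).
  by rewrite mulN1r.
have hDi := holoV (holo_pfun D a) Da.
have nD := fcont_neq0 (holo_fcont (holo_pfun D a)) Da.
exists (fun=> fun=> 1); split.
- by move=> _; exact: holo_cst.
- move=> h hh; exists (fun=> h a).
  have [_ [u [v [hu hv [d d0 hE]]]]] := holo_structure hh.
  have hE' : \forall z \near a, (h z : C) = (h a : C) + (u z : C) * ((z.1 : C) - a.1)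
      + (v z : C) * ((z.2 : C) - a.2) by apply/near_C2P; exists d.
  pose nv := holoM (holo_cst (-1) a) hv; pose nu := holoM (holo_cst (-1) a) hu.
  have U1 := holoM (holoD (holoM hu (holo_pfun B' a)) (holoM nv (holo_pfun A' a))) hDi.
  have U2 := holoM (holoD (holoM hv (holo_pfun A a)) (holoM nu (holo_pfun B a))) hDi.
  do 2!eexists; split; [exact: U1|exact: U2|].
  apply: near_C2_imp2 hE' nD _ => z -> Dz.
  rewrite big_ord1 mulr1 hP hQ P0 Q0 !add0r.
  have DE : (pfun D z : C) = (pfun A z : C) * pfun B' z - (pfun B z : C) * pfun A' z.
    by rewrite /D /pfun /= mulN1r.
  rewrite DE in Dz *.
  move: (h a : C) (u z : C) (v z : C) ((z.1 : C) - a.1) ((z.2 : C) - a.2)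
    (pfun A z : C) (pfun B z : C) (pfun A' z : C) (pfun B' z : C) Dz.
  by move=> ha uz vz x y Az Bz Az' Bz' Dz; field.
- move=> c [u1 [u2 [_ _ /near_C2_center]]]; rewrite P0 Q0 !mulr0 addr0 big_ord1 mulr1.
  by move=> h i; rewrite (ord1 i).
Qed.

End MaximalIdeal.

(** * Dimensions of nested ideals *)

Section IdealDimension.
Variable R : realType.
Local Notation C := (R[i]).
Local Notation CC := (CC R).
Local Notation C2 := (C2 R).
Implicit Types (a : C2) (p q h k : C2 -> CC).

Lemma in_idealD a p q h k : in_ideal2 a p q h -> in_ideal2 a p q k ->
  in_ideal2 a p q (fun z => (h z : C) + k z).
Proof.
move=> [u1 [u2 [h1 h2 h3]]] [v1 [v2 [k1 k2 k3]]].
do 2!eexists; split; [exact: (holoD h1 k1)|exact: (holoD h2 k2)|].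
apply: near_C2_imp2 h3 k3 _ => z -> ->.
by move: (u1 z : C) (u2 z : C) (v1 z : C) (v2 z : C) (p z : C) (q z : C) => *; ring.
Qed.

Lemma in_idealZ a p q h (c : C) : in_ideal2 a p q h ->
  in_ideal2 a p q (fun z => c * (h z : C)).
Proof.
move=> [u1 [u2 [h1 h2 h3]]].
do 2!eexists; split; [exact: (holoM (holo_cst c a) h1)|exact: (holoM (holo_cst c a) h2)|].
apply: near_C2_imp2 h3 (near_C2_all a (fun=> I)) _ => z -> _.
by move: (u1 z : C) (u2 z : C) (p z : C) (q z : C) => *; ring.
Qed.

Lemma in_ideal0 a p q : in_ideal2 a p q (fun=> 0).
Proof.
exists (fun=> 0), (fun=> 0); split; [exact: holo_cst|exact: holo_cst|].
by apply: near_C2_all => z; rewrite !mul0r addr0.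
Qed.

Lemma in_ideal_sum a p q n (h : 'I_n -> C2 -> CC) : (forall i, in_ideal2 a p q (h i)) ->
  in_ideal2 a p q (fun z => \sum_(i < n) (h i z : C)).
Proof.
elim: n h => [|n IH] h hh.
  by under eq_fun do rewrite big_ord0; exact: in_ideal0.
under eq_fun do rewrite big_ord_recr.
by apply: in_idealD (hh _); exact: (IH (fun i => h (widen_ord (leqnSn n) i))).
Qed.

(** The [n] basis germs together with [p] and [q] are [n + 2] vectors in a quotient of dimension
    [n + 1], so they satisfy a relation. Read modulo [(p, q)], it has zero coefficients on the basis
    germs. *)
Lemma quot_dim_drop a p q p' q' n : holo_near p a -> holo_near q a ->
  (forall h, in_ideal2 a p' q' h -> in_ideal2 a p q h) ->
  quot_dim a p' q' n.+1 -> quot_dim a p q n ->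
  exists al be : C, ((al != 0) || (be != 0)) /\
    in_ideal2 a p' q' (fun z => al * (p z : C) + be * (q z : C)).
Proof.
move=> hp hq sub [E' [hE' gE' _]] [E [hE _ iE]].
pose w (j : 'I_(n + 2)) : C2 -> CC :=
  match fintype.split j with inl i => E i | inr k => if k == ord0 then p else q end.
have hw j : holo_near (w j) a by rewrite /w; case: (fintype.split j) => [i|k]; last case: ifP.
have [c hc] := choice (fun j => gE' (w j) (hw j)).
pose M : 'M[C]_(n + 2, n.+1) := \matrix_(j, i) c j i.
have [x x0 xM] : exists2 x : 'rV[C]_(n + 2), x != 0 & x *m M = 0.
  have : kermx M != 0.
    rewrite kermx_eq0 /row_free neq_ltn; apply/orP; left.
    by apply: leq_ltn_trans (rank_leq_col M) _; rewrite addn2.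
  by case/rowV0Pn => v /sub_kermxP vM v0; exists v.
have inI : in_ideal2 a p' q' (fun z => \sum_(j < n + 2) x 0 j * (w j z : C)).
  have h := in_ideal_sum (fun j => in_idealZ (x 0 j) (hc j)).
  suff -> : (fun z => \sum_(j < n + 2) x 0 j * (w j z : C)) =
    (fun z => \sum_(j < n + 2) x 0 j * ((w j z : C) - \sum_(i < n.+1) (c j i : C) * E' i z)) by [].
  apply/funext => z; under [RHS]eq_bigr do rewrite mulrBr.
  rewrite sumrB; set S := (X in _ = _ - X); suff -> : S = 0 by rewrite subr0.
  rewrite /S; under eq_bigr do rewrite mulr_sumr.
  rewrite exchange_big big1 //= => i _.
  have e' : \sum_(j < n + 2) x 0 j * (c j i : C) = 0.
    have := congr1 (fun N : 'rV[C]_n.+1 => N 0 i) xM; rewrite /= mxE [RHS]mxE => e.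
    by rewrite -[RHS]e; apply: eq_bigr => j _; rewrite mxE.
  transitivity ((\sum_(j < n + 2) x 0 j * (c j i : C)) * (E' i z : C)); last by rewrite e' mul0r.
  by rewrite mulr_suml; apply: eq_bigr => j _; rewrite mulrA.
pose al := x 0 (rshift n ord0); pose be := x 0 (rshift n (lift ord0 ord0)).
have wE z : \sum_(j < n + 2) x 0 j * (w j z : C) =
    \sum_(i < n) x 0 (lshift 2 i) * (E i z : C) + (al * (p z : C) + be * (q z : C)).
  rewrite big_split_ord /=; congr (_ + _).
    by apply: eq_bigr => i _; rewrite /w (unsplitK (inl i)).
  rewrite big_ord_recl big_ord1 /w (unsplitK (inr _)) /=.
  by rewrite (unsplitK (inr (lift ord0 ord0))).
have pqI : in_ideal2 a p q (fun z => (-1) * (al * (p z : C) + be * (q z : C))).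
  apply: in_idealZ; exists (fun=> al), (fun=> be); split; [exact: holo_cst|exact: holo_cst|].
  by apply: near_C2_all.
have x_l i : x 0 (lshift 2 i) = 0.
  apply: (iE (fun i => x 0 (lshift 2 i))).
  have := in_idealD (sub _ inI) pqI.
  congr in_ideal2; apply/funext => z; rewrite wE; ring.
exists al, be; split.
  rewrite -negb_and; apply: contraNN x0 => /andP[/eqP a0 /eqP b0].
  apply/eqP/rowP => j; rewrite mxE -(splitK j); case: (fintype.split j) => [i|k] /=.
    exact: x_l.
  have [->|k0] := eqVneq k ord0; first exact: a0.
  have -> : k = lift ord0 ord0 by apply/val_inj; case: k k0 => -[|[|//]].
  exact: b0.
have := inI; congr in_ideal2; apply/funext => z; rewrite wE big1 ?add0r // => i _.
by rewrite x_l mul0r.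
Qed.

End IdealDimension.

(** * Zeros of plane polynomials are not isolated *)

Section NonIsolatedZeros.
Variable R : realType.
Local Notation C := (R[i]).
Local Notation CC := (CC R).
Local Notation C2 := (C2 R).

(** A factor [X - z] with [d <= cmod z] raises the bound on the weighted coefficients by at most
    [2 * cmod z], and the modulus of the constant term by exactly [cmod z]. *)
Lemma coef_bound_seq (d : R) (r : seq C) : 0 < d -> (forall z, z \in r -> d <= cmod z) ->
  let P := \prod_(z <- r) ('X - z%:P) in
  forall k, cmod P`_k * d ^+ k <= 2 ^+ size r * cmod P`_0.
Proof.
move=> d0; elim: r => [|z r IH] hr /=.
  move=> k; rewrite big_nil !coef1 expr0 mul1r.
  have -> : (0%N == 0%N)%:R = 1 :> C by [].
  case: k => [|k]; first by rewrite expr0 mulr1.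
  by have -> : (k.+1 == 0%N)%:R = 0 :> C by []; rewrite cmod0 mul0r cmod_ge0.
have hz : d <= cmod z by apply: hr; rewrite inE eqxx.
have hr' u : u \in r -> d <= cmod u by move=> ur; apply: hr; rewrite inE ur orbT.
have {}IH := IH hr'.
rewrite big_cons; set P := \prod_(_ <- _) _ in IH *.
set B := 2 ^+ size r * cmod P`_0 in IH.
have B0 : 0 <= B by rewrite mulr_ge0 ?exprn_ge0 ?cmod_ge0.
have E0 : cmod (('X - z%:P) * P)`_0 = cmod z * cmod P`_0.
  by rewrite mulrBl coefB coefXM coefCM /= sub0r cmodN cmodM.
move=> k; rewrite E0 exprS.
apply: (@le_trans _ _ (2 * (cmod z * B))); last by rewrite /B; lra.
have t : cmod (z * P`_k) * d ^+ k <= cmod z * B.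
  by rewrite cmodM -mulrA ler_wpM2l ?cmod_ge0.
rewrite mulrBl coefB coefXM coefCM; case: k t => [|k] /= t.
  by rewrite sub0r cmodN; have := mulr_ge0 (cmod_ge0 z) B0; lra.
have dk : 0 <= d ^+ k.+1 by rewrite exprn_ge0 // ltW.
apply: le_trans (ler_wpM2r dk (cmodD _ _)) _; rewrite cmodN mulrDl.
have t2 : cmod P`_k * d ^+ k.+1 <= cmod z * B.
  rewrite exprS mulrCA; apply: ler_pM; rewrite ?mulr_ge0 ?cmod_ge0 ?exprn_ge0 ?(ltW d0) //.
lra.
Qed.

Lemma coef_bound (d : R) (p : {poly C}) : 0 < d ->
  (forall z, root p z -> d <= cmod z) ->
  forall k, cmod p`_k * d ^+ k <= 2 ^+ size p * cmod p`_0.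
Proof.
move=> d0 hp k; have [->|p0] := eqVneq p 0; first by rewrite !coef0 cmod0 mul0r mulr0.
have [r hr] := closed_field_poly_normal p.
have l0 : lead_coef p != 0 by rewrite lead_coef_eq0.
have sz : size p = (size r).+1.
  by rewrite hr size_scale // size_prod_XsubC.
have rr z : z \in r -> d <= cmod z.
  by move=> zr; apply: hp; rewrite hr rootZ // root_prod_XsubC.
have pk j : p`_j = lead_coef p * (\prod_(z <- r) ('X - z%:P))`_j.
  by rewrite {1}hr coefZ.
have := coef_bound_seq d0 rr k; rewrite /= !pk !cmodM sz exprS.
set A := cmod (lead_coef p); set B := cmod (_`_k); set D := cmod (_`_0) => h.
have A0 : 0 <= A by exact: cmod_ge0.
have h2 : A * (B * d ^+ k) <= A * (2 ^+ size r * D) by rewrite ler_wpM2l.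
have h3 : 0 <= A * (2 ^+ size r * D) by rewrite !mulr_ge0 ?exprn_ge0 ?cmod_ge0.
rewrite -mulrA; apply: le_trans h2 _; lra.
Qed.

Fixpoint ypoly (e : pexp R) (x : C) : {poly C} :=
  match e with
  | PC c => c%:P | PX => x%:P | PY => 'X
  | PAdd e1 e2 => ypoly e1 x + ypoly e2 x
  | PMul e1 e2 => ypoly e1 x * ypoly e2 x
  end.

Lemma horner_ypoly e x y : (ypoly e x).[y] = peval e x y.
Proof.
by elim: e => [c|||e1 IH1 e2 IH2|e1 IH1 e2 IH2] /=;
  rewrite ?(hornerC, hornerX, hornerD, hornerM) ?IH1 ?IH2.
Qed.

Lemma size_ypoly e : exists N, forall x, (size (ypoly e x) <= N)%N.
Proof.
elim: e => [c|||e1 [N1 h1] e2 [N2 h2]|e1 [N1 h1] e2 [N2 h2]] /=.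
- by exists 1%N => x; exact: size_polyC_leq1.
- by exists 1%N => x; exact: size_polyC_leq1.
- by exists 2%N => x; rewrite size_polyX.
- exists (maxn N1 N2) => x; apply: leq_trans (size_polyD _ _) _.
  by rewrite geq_max !leq_max h1 h2 orbT.
- exists (N1 + N2)%N => x; apply: leq_trans (size_polyMleq _ _) _.
  by apply: leq_trans (leq_pred _) _; exact: leq_add.
Qed.

Lemma coef_ypoly e k : exists q : pexp R, forall x, (ypoly e x)`_k = peval q x 0.
Proof.
elim: e k => [c|||e1 IH1 e2 IH2|e1 IH1 e2 IH2] k /=.
- by exists (PC (if k == 0%N then c else 0)) => x; rewrite coefC.
- case: k => [|k]; first by exists PX => x; rewrite coefC.
  by exists (PC 0) => x; rewrite coefC.
- by exists (PC (k == 1%N)%:R) => x; rewrite coefX.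
- have [q1 h1] := IH1 k; have [q2 h2] := IH2 k.
  by exists (PAdd q1 q2) => x; rewrite coefD h1 h2.
- have [q1 h1] := choice IH1; have [q2 h2] := choice IH2.
  exists (\big[@PAdd R/PC 0]_(j < k.+1) PMul (q1 j) (q2 (k - j)%N)) => x.
  rewrite coefM; elim/big_rec2: _ => [//|j y1 y2 _ ->] /=.
  by rewrite h1 h2.
Qed.

(** If for a small [x] all roots in [y] had modulus at least [del], then [coef_bound] would control
    a coefficient that is nonzero at [x = 0] by the constant term, which tends to 0 with [x]. The
    degree bound [N] is uniform in [x]. *)
Lemma zeros_not_isolated (e : pexp R) (a : C2) : pfun e a = 0 ->
  forall d : R, 0 < d -> exists z : C2, [/\ z <> a, dist2 z a < d & pfun e z = 0].
Proof.
have aux1 (w : R) : w / 2 <= w / 4 -> 0 < w -> False by lra.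
have aux2 (x y z : R) : x <= y + z -> z <= x / 2 -> x / 2 <= y by lra.
case: a => a1 a2 e0 d d0.
pose f := psubst e (PAdd PX (PC a1)) (PAdd PY (PC a2)).
have fE x y : peval f x y = pfun e (x + a1, y + a2) by rewrite peval_subst.
suff [x [y [nz hx hy hz]]] : exists x y : C, [/\ (x != 0) || (y != 0), cmod x < d / 2,
    cmod y < d / 2 & peval f x y = 0].
  exists (x + a1, y + a2); split.
  - case=> /eqP; rewrite -subr_eq0 addrK => /eqP x0 /eqP; rewrite -subr_eq0 addrK => /eqP y0.
    by move: nz; rewrite x0 y0 eqxx.
  - by rewrite /dist2 /= !addrK; lra.
  - by rewrite -fE.
have d2 : 0 < d / 2 by rewrite divr_gt0.
have d4 : 0 < d / 4 by rewrite divr_gt0.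
have small (r : R) : 0 < r -> (r / 2)%:C%C != 0 :> C /\ cmod (r / 2)%:C%C < r.
  move=> r0; have r2 : 0 < r / 2 by rewrite divr_gt0.
  by rewrite -cmod_gt0 cmod_real gtr0_norm //; split => //; lra.
(* If [f] vanishes on the whole axis [x = 0], a point of the axis will do. *)
have [Q0|Q0] := eqVneq (ypoly f 0) 0.
  have [s1 s2] := small _ d2.
  exists 0, (d / 2 / 2)%:C%C; rewrite s1 orbT cmod0; split => //.
  by rewrite -horner_ypoly Q0 horner0.
have [k k1 ck] : exists2 k, (0 < k)%N & (ypoly f 0)`_k != 0.
  exists (size (ypoly f 0)).-1; last by rewrite -lead_coefE lead_coef_eq0.
  have c0 : (ypoly f 0)`_0 = 0.
    by rewrite -horner_coef0 horner_ypoly fE !add0r.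
  have : lead_coef (ypoly f 0) != 0 by rewrite lead_coef_eq0.
  by rewrite lead_coefE; case: (_.-1) => // ; rewrite c0 eqxx.
have [N hN] := size_ypoly f.
have [qk hqk] := coef_ypoly f k; have [q0 hq0] := coef_ypoly f 0.
have cont (q : pexp R) (r : R) : 0 < r -> exists2 d' : R, 0 < d' & forall x : C, cmod x < d' ->
    cmod (peval q x 0 - peval q 0 0) <= r.
  move=> r0; have [d' d'0 h] := fdiff_fcont (fdiff_pfun q (0, 0)) r0.
  exists d' => // x hx; have := h (x, 0); rewrite /dist2 /= !subr0 cmod0 addr0.
  exact.
set c := (ypoly f 0)`_k in ck; have cp : 0 < cmod c by rewrite cmod_gt0.
pose del := d / 2; have delk : 0 < del ^+ k by rewrite exprn_gt0.
have [d1 d10 h1] : exists2 d' : R, 0 < d' & forall x : C, cmod x < d' ->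
    cmod (peval qk x 0 - peval qk 0 0) <= cmod c / 2 by apply: cont; rewrite divr_gt0.
(* With the constant term this small, [coef_bound] yields at most a quarter of [cmod c * del ^+ k],
   against a lower bound of one half. *)
have t0 : 0 < cmod c * del ^+ k / (4 * 2 ^+ N).
  by rewrite divr_gt0 ?mulr_gt0 // exprn_gt0.
have [d3 d30 h3] := cont q0 _ t0.
pose r := Num.min (d / 2) (Num.min d1 d3).
have r0 : 0 < r by rewrite !lt_min d2 d10.
have [x0 xr] := small r r0; set x := (r / 2)%:C%C in x0 xr.
move: xr; rewrite !lt_min => /and3P[x2 xd1 xd3].
have [[y [hy ry]]|nr] := pselect (exists y, cmod y < del /\ root (ypoly f x) y).
  exists x, y; rewrite x0; split => //.
  by rewrite -horner_ypoly; exact/eqP.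
exfalso.
have hroot z : root (ypoly f x) z -> del <= cmod z.
  by move=> hz; rewrite leNgt; apply/negP => zd; apply: nr; exists z.
have := coef_bound d2 hroot k; rewrite hqk hq0.
have := h1 _ xd1; have := h3 _ xd3.
have e00 : peval q0 0 0 = 0 by rewrite -hq0 -horner_coef0 horner_ypoly fE !add0r.
have ek : peval qk 0 0 = c by rewrite -hqk.
rewrite e00 ek subr0.
move=> k3 k4 k5.
have k6 : cmod c / 2 <= cmod (peval qk x 0).
  by apply: aux2 (cmod_sub_le c (peval qk x 0)) _; rewrite cmodB.
have k7 : cmod c / 2 * del ^+ k <= 2 ^+ size (ypoly f x) * cmod (peval q0 x 0).
  by apply: le_trans k5; rewrite ler_pM2r.
have k8 : 2 ^+ size (ypoly f x) * cmod (peval q0 x 0) <=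
    2 ^+ N * (cmod c * del ^+ k / (4 * 2 ^+ N)).
  apply: ler_pM; rewrite ?exprn_ge0 ?cmod_ge0 //.
  by rewrite ler_eXn2l // ?ltr1n.
have k9 : 2 ^+ N * (cmod c * del ^+ k / (4 * 2 ^+ N)) = cmod c * del ^+ k / 4.
  by field; rewrite expf_neq0.
have k10 : 0 < cmod c * del ^+ k by rewrite mulr_gt0.
rewrite k9 in k8; apply: (aux1 _ _ k10).
by apply: le_trans k8; rewrite mulrAC.
Qed.

End NonIsolatedZeros.

(** * Generic matrices *)

Section GenericMatrix.
Variable R : realType.
Local Notation C := (R[i]).
Local Notation CC := (CC R).

Lemma det_mx2 (T : 'M[C]_2) : \det T = T 0 0 * T 1 1 - T 0 1 * T 1 0.
Proof.
rewrite (expand_det_row _ ord0) !big_ord_recl big_ord0 addr0 /cofactor !det_mx11 !mxE /=.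
rewrite /bump /= expr0 mul1r expr1 mulN1r mulrN.
by congr (_ * T _ _ - T _ _ * T _ _); apply/val_inj.
Qed.

(** On the line from [T0] to a matrix [T1] satisfying the other two conditions, all three become
    nonzero polynomials in one variable, and their product has a non-root. *)
Lemma generic_matrix (P : 'M[CC]_2 -> CC) (T0 : 'M[CC]_2) (al be : C) : polyM P ->
  P T0 != 0 -> (al != 0) || (be != 0) ->
  exists T : 'M[CC]_2, [/\ P T != 0, \det T != 0 & (T 0 0 : C) * al + (T 0 1 : C) * be != 0].
Proof.
move=> [d [c hP]] P0 ab.
have [T1 t1 t2] : exists2 T1 : 'M[C]_2, \det T1 != 0 & T1 0 0 * al + T1 0 1 * be != 0.
  case/orP: ab => h.
    by exists 1%:M; rewrite ?det1 ?oner_neq0 // !mxE /= mul1r mul0r addr0.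
  exists (\matrix_(i, j) (i != j)%:R).
    by rewrite det_mx2 !mxE /= mul0r mul1r sub0r oppr_eq0 oner_neq0.
  by rewrite !mxE /= mul0r mul1r add0r.
pose q i j : {poly C} := (T0 i j : C)%:P + (T1 i j - (T0 i j : C))%:P * 'X.
pose T (x : C) : 'M[C]_2 := \matrix_(i, j) (q i j).[x].
have qE i j x : (q i j).[x] = (T0 i j : C) + (T1 i j - (T0 i j : C)) * x.
  by rewrite /q !hornerE.
have T00 : T 0 = T0 by apply/matrixP => i j; rewrite mxE qE mulr0 addr0.
have T11 : T 1 = T1 by apply/matrixP => i j; rewrite mxE qE mulr1 addrC subrK.
pose pP : {poly C} := \sum_(i < d.+1) \sum_(j < d.+1) \sum_(k < d.+1) \sum_(l < d.+1)
   (c i j k l : C)%:P * q 0 0 ^+ i * q 0 1 ^+ j * q 1 0 ^+ k * q 1 1 ^+ l.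
have pPE x : pP.[x] = P (T x).
  rewrite hP /pP horner_sum; apply: eq_bigr => i _.
  rewrite horner_sum; apply: eq_bigr => j _.
  rewrite horner_sum; apply: eq_bigr => k _.
  rewrite horner_sum; apply: eq_bigr => l _.
  by rewrite !(hornerM, horner_exp, hornerC) !mxE.
pose pD := q 0 0 * q 1 1 - q 0 1 * q 1 0.
have pDE x : pD.[x] = \det (T x) by rewrite det_mx2 !mxE /pD !hornerE.
pose pL := q 0 0 * al%:P + q 0 1 * be%:P.
have pLE x : pL.[x] = T x 0 0 * al + T x 0 1 * be by rewrite !mxE /pL !hornerE.
have n0 (p : {poly C}) x : p.[x] != 0 -> p != 0 by apply: contraNneq => ->; rewrite horner0.
have : pP * pD * pL != 0.
  rewrite !mulf_neq0 //; first by apply: (n0 _ 0); rewrite pPE T00.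
    by apply: (n0 _ 1); rewrite pDE T11.
  by apply: (n0 _ 1); rewrite pLE T11.
case/closed_nonrootP => x; rewrite rootE !hornerM !mulf_eq0 !negb_or => /andP[/andP[h1 h2] h3].
exists (T x); split; first by rewrite -pPE.
  by rewrite -pDE.
by rewrite -pLE.
Qed.

End GenericMatrix.

(** * Index one implies cusp *)

Section IndexOneImpliesCusp.
Variable R : realType.
Local Notation C := (R[i]).
Local Notation CC := (CC R).
Local Notation C2 := (C2 R).
Implicit Types (f g : pexp R) (a : C2).

Definition plc (s t : C) f g : pexp R := PAdd (PMul (PC s) f) (PMul (PC t) g).

Lemma plcE (s t : C) f g :
  (fun p => (s : CC) * pfun f p + (t : CC) * pfun g p) = pfun (plc s t f g).
Proof. by []. Qed.

Lemma pjac_plc (s t s' t' : C) f g (z : C2) :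
  pfun (pjac (plc s t f g) (plc s' t' f g)) z = (s * t' - t * s') * pfun (pjac f g) z.
Proof. by rewrite /pfun /=; ring. Qed.

Lemma has_cusp_target (F : C2 -> C2) (t : C2 -> C2) a :
  biholo_germ t (F a) (t (F a)) -> has_cusp (t \o F) a -> has_cusp F a.
Proof.
move=> ht [phi [psi [h1 [h2 h3]]]]; exists phi, (psi \o t); split => //; split => //.
exact: biholo_germ_comp ht h2.
Qed.

Lemma has_cusp_linear f g a (T : 'M[C]_2) : \det T != 0 ->
  has_cusp (polymap (plc (T 0 0) (T 0 1) f g) (plc (T 1 0) (T 1 1) f g)) a ->
  has_cusp (polymap f g) a.
Proof.
rewrite det_mx2; set D := (_ - _) => D0 h.
pose t := polymap (plc (T 0 0) (T 0 1) PX PY) (plc (T 1 0) (T 1 1) PX PY).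
apply: (@has_cusp_target _ t); last exact: h.
apply: (@biholo_germ_polymap _ _ _ (plc (T 1 1 / D) (- T 0 1 / D) PX PY)
          (plc (- T 1 0 / D) (T 0 0 / D) PX PY)) => //.
  by move=> [x y]; rewrite /polymap /pfun /=; congr (_, _); rewrite /D; field; exact: D0.
by move=> [x y]; rewrite /polymap /pfun /=; congr (_, _); rewrite /D; field; exact: D0.
Qed.

(* [j] and [k] lie in the maximal ideal times [(f_x, f_y)], so a gap of one between
   the dimensions puts a nontrivial combination of [f_x] and [f_y] in [(j, k)]. *)
Lemma index_degenerate f g a n (J : C2 -> CC) :
  let j := pjac f g in let k := pjac j f in
  pfun (pdX f) a = 0 -> pfun (pdY f) a = 0 -> pfun (pdX g) a = 0 -> pfun (pdY g) a = 0 ->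
  (forall z, pfun j z = 0 -> J z = 0) ->
  grad_ok_on_branches J (pfun f) a ->
  quot_dim a (pfun j) (pfun k) n.+1 -> quot_dim a (pfun (pdX f)) (pfun (pdY f)) n -> False.
Proof.
move=> j k fx fy gx gy hJ [U [oU [Ua hU]]] q1 q2.
rewrite pdx_pfun pdy_pfun in hU.
have jE z := pfun_pjac f g z; have kE z := pfun_pjac j f z.
rewrite -/j in jE; rewrite -/k in kE.
have jx : pfun (pdX j) a = 0.
  by move: fx fy gx gy; rewrite /j /pfun /= => -> -> -> ->; rewrite !(mulr0, mul0r, addr0).
have jy : pfun (pdY j) a = 0.
  by move: fx fy gx gy; rewrite /j /pfun /= => -> -> -> ->; rewrite !(mulr0, mul0r, addr0).
pose N e : pexp R := PMul (PC (-1)) e.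
have NE e z : pfun (N e) z = - (pfun e z : C) by rewrite /pfun /= mulN1r.
(* The cofactors of [f_x] and [f_y] in [j] and [k] are first derivatives of [g] and [j], all of
   which vanish at [a]. *)
have coef (u1 u2 : C2 -> CC) : holo_near u1 a -> holo_near u2 a ->
    exists A B : C2 -> CC, [/\ holo_near A a, holo_near B a, A a = 0, B a = 0 &
      forall z, (u1 z : C) * pfun j z + (u2 z : C) * pfun k z =
                (A z : C) * pfun (pdX f) z + (B z : C) * pfun (pdY f) z].
  move=> h1 h2.
  have hA := holoD (holoM h1 (holo_pfun (pdY g) a)) (holoM h2 (holo_pfun (N (pdY j)) a)).
  have hB := holoD (holoM h2 (holo_pfun (pdX j) a)) (holoM h1 (holo_pfun (N (pdX g)) a)).
  do 2!eexists; split; [exact: hA|exact: hB|..].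
  - by cbv beta; rewrite NE gy jy oppr0 !mulr0 addr0.
  - by cbv beta; rewrite NE gx jx oppr0 !mulr0 addr0.
  - move=> z; cbv beta; rewrite jE kE !NE.
    move: (u1 z : C) (u2 z : C) (pfun (pdX f) z : C) (pfun (pdY f) z : C)
      (pfun (pdX g) z : C) (pfun (pdY g) z : C) (pfun (pdX j) z : C) (pfun (pdY j) z : C).
    by move=> *; ring.
have sub h : in_ideal2 a (pfun j) (pfun k) h -> in_ideal2 a (pfun (pdX f)) (pfun (pdY f)) h.
  move=> [u1 [u2 [h1 h2 h3]]]; have [A [B [hA hB _ _ E]]] := coef _ _ h1 h2.
  exists A, B; split => //.
  by apply: near_C2_imp2 h3 (near_C2_all a (fun=> I)) _ => z -> _; exact: E.
have [al [be [ab [u1 [u2 [h1 h2 h3]]]]]] :=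
  quot_dim_drop (holo_pfun _ a) (holo_pfun _ a) sub q1 q2.
have [A [B [hA hB A0 B0 E]]] := coef _ _ h1 h2.
have hU' : \forall z \near a, U z by apply: open_nbhs_nbhs.
(* One of the partial derivatives of [f] is a multiple of the other near [a]. *)
have key (e e' : pexp R) (x : C) (X Y : C2 -> CC) : x != 0 -> holo_near X a -> X a = 0 ->
    pfun e' a = 0 ->
    (\forall z \near a, x * (pfun e z : C) + (Y z : C) * pfun e' z = (X z : C) * pfun e z) ->
    (forall z, pfun e z = 0 -> pfun e' z = 0 -> pfun (pdX f) z = 0 /\ pfun (pdY f) z = 0) ->
    False.
  move=> x0 hX X0 e0 hE hfx.
  have xX : \forall z \near a, (X z : C) - x != 0.
    have hh := holoD hX (holo_cst (- x) a).
    apply: (fcont_neq0 (holo_fcont hh)); by rewrite X0 add0r oppr_eq0.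
  (* Near [a], zeros of [e'] are common zeros of [f_x] and [f_y], hence of [j] and [J], so only [a]
     is left; yet the zeros of [e'] are not isolated. *)
  have : \forall z \near a, pfun e' z = 0 -> z = a.
    have H : \forall z \near a, pfun e' z = 0 -> pfun e z = 0.
      apply: near_C2_imp2 hE xX _ => z hz nz ez.
      move: hz; rewrite ez mulr0 addr0 => /eqP; rewrite eq_sym -subr_eq0 -mulrBl mulf_eq0.
      by rewrite (negbTE nz) => /eqP.
    apply: near_C2_imp2 H hU' _ => z hz Uz ez.
    have [z1 z2] := hfx z (hz ez) ez.
    by apply: hU => //; apply: hJ; rewrite jE z1 z2 !mul0r subr0.
  move=> /near_C2P[d d0 hd].
  have [z [za zd ez]] := zeros_not_isolated e0 d0.
  by apply: za; exact: hd.
have h4 : \forall z \near a, al * (pfun (pdX f) z : C) + be * (pfun (pdY f) z : C) =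
    (A z : C) * pfun (pdX f) z + (B z : C) * pfun (pdY f) z.
  by apply: near_C2_imp2 h3 (near_C2_all a (fun=> I)) _ => z -> _; exact: E.
case/orP: ab => x0.
  apply: (key (pdX f) (pdY f) al A (fun z => be - (B z : C)) x0 hA A0 fy) => //.
  apply: near_C2_imp2 h4 (near_C2_all a (fun=> I)) _ => z hz _.
  by rewrite mulrBl addrA hz addrK.
apply: (key (pdY f) (pdX f) be B (fun z => al - (A z : C)) x0 hB B0 fx) => //.
apply: near_C2_imp2 h4 (near_C2_all a (fun=> I)) _ => z hz _.
rewrite mulrBl addrCA addrA hz; move: (_ * _) (_ * _) => x y; ring.
Qed.

Theorem index_one_cusp f g a : mu_eq1 (pfun f) (pfun g) a -> has_cusp (polymap f g) a.
Proof.
move=> [P [hP [T0 P0] hQ]].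
(* [(al, be)] holds the derivatives of [f] and [g] along one axis; the first row of [T] must not
   annihilate it. When [DF a = 0] the pair [(1, 0)] is a placeholder. *)
have [al [be [ab hab]]] : exists al be : C, ((al != 0) || (be != 0)) /\
   ((al = pfun (pdX f) a /\ be = pfun (pdX g) a) \/
    (al = pfun (pdY f) a /\ be = pfun (pdY g) a) \/
    [/\ pfun (pdX f) a = 0, pfun (pdY f) a = 0, pfun (pdX g) a = 0 & pfun (pdY g) a = 0]).
  have [h|] := boolP (((pfun (pdX f) a : C) != 0) || ((pfun (pdX g) a : C) != 0)).
    by exists (pfun (pdX f) a), (pfun (pdX g) a); split => //; left.
  rewrite negb_or !negbK => /andP[/eqP fx /eqP gx].
  have [h|] := boolP (((pfun (pdY f) a : C) != 0) || ((pfun (pdY g) a : C) != 0)).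
    by exists (pfun (pdY f) a), (pfun (pdY g) a); split => //; right; left.
  rewrite negb_or !negbK => /andP[/eqP fy /eqP gy].
  by exists 1, 0; rewrite oner_neq0; split => //; right; right.
have [T [PT dT TL]] := generic_matrix hP P0 ab.
have [gok [n [q1 q2]]] := hQ T dT PT.
pose f' := plc (T 0 0) (T 0 1) f g; pose g' := plc (T 1 0) (T 1 1) f g.
rewrite (plcE (T 0 0) (T 0 1)) (plcE (T 1 0) (T 1 1)) -/f' -/g' Jac_pfun J11_pfun in q1.
rewrite (plcE (T 0 0) (T 0 1)) -/f' pdx_pfun pdy_pfun in q2.
rewrite (plcE (T 0 0) (T 0 1)) -/f' in gok.
apply: (has_cusp_linear dT); rewrite -/f' -/g'.
have f'x : pfun (pdX f') a = (T 0 0 : C) * pfun (pdX f) a + (T 0 1 : C) * pfun (pdX g) a.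
  by rewrite /pfun /=; ring.
have f'y : pfun (pdY f') a = (T 0 0 : C) * pfun (pdY f) a + (T 0 1 : C) * pfun (pdY g) a.
  by rewrite /pfun /=; ring.
have [deg|ndeg] := pselect [/\ pfun (pdX f) a = 0, pfun (pdY f) a = 0,
    pfun (pdX g) a = 0 & pfun (pdY g) a = 0].
  case: deg => fx fy gx gy; exfalso.
  have g'x : pfun (pdX g') a = 0 by rewrite /pfun /= -/(pfun (pdX f) a) -/(pfun (pdX g) a) fx gx; ring.
  have g'y : pfun (pdY g') a = 0 by rewrite /pfun /= -/(pfun (pdY f) a) -/(pfun (pdY g) a) fy gy; ring.
  have f'x0 : pfun (pdX f') a = 0 by rewrite f'x fx gx !mulr0 addr0.
  have f'y0 : pfun (pdY f') a = 0 by rewrite f'y fy gy !mulr0 addr0.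
  apply: (index_degenerate f'x0 f'y0 g'x g'y _ gok q1 q2) => z.
  rewrite Jac_pfun pjac_plc => /eqP; rewrite mulf_eq0 => /orP[h|/eqP //].
  by move: dT; rewrite (det_mx2 T) (eqP h) eqxx.
have hu : ((pfun (pdX f') a : C) != 0) || ((pfun (pdY f') a : C) != 0).
  rewrite f'x f'y; case: hab => [[<- <-]|[[<- <-]|//]]; first by rewrite TL.
  by rewrite TL orbT.
have n0 := (quot_dim_unit (holo_pfun _ a) (holo_pfun _ a) hu n).1 q2.
rewrite n0 in q1.
have [J0 K0 hdet] := quot_dim1_grad (holo_pfun _ a) (holo_pfun _ a)
   (fdiff_pfun _ a) (fdiff_pfun _ a) q1.
exact: (cusp_of_jets hu J0 K0 hdet).
Qed.

End IndexOneImpliesCusp.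

(** * Cusp implies index one *)

Section ChainRule.
Variable R : realType.
Local Notation C := (R[i]).
Local Notation CC := (CC R).
Local Notation C2 := (C2 R).
Implicit Types (u v h : C2 -> C) (p q z : C2).

Lemma dist2_triangle z p q : dist2 z q <= dist2 z p + dist2 p q.
Proof.
rewrite /dist2; have := cmod_triangle (z.1 : C) p.1 q.1.
have := cmod_triangle (z.2 : C) p.2 q.2; lra.
Qed.

Lemma near_near_C2 p (P : C2 -> Prop) : (\forall z \near p, P z) ->
  \forall z \near p, \forall w \near z, P w.
Proof.
move=> /near_C2P[d d0 h]; apply/near_C2P; exists d => // z hz; apply/near_C2P.
exists (d - dist2 z p); first by rewrite subr_gt0.
by move=> w hw; apply: h; have := dist2_triangle w z p; lra.
Qed.

Lemma fcontD u v p : fcont u p -> fcont v p -> fcont (fun z => u z + v z) p.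
Proof.
move=> hu hv e e0; have e2 : 0 < e / 2 by rewrite divr_gt0.
have [d1 d10 h1] := hu _ e2; have [d2 d20 h2] := hv _ e2.
exists (Num.min d1 d2); first by rewrite lt_min d10.
move=> z; rewrite lt_min => /andP[/h1 k1 /h2 k2].
have -> : u z + v z - (u p + v p) = (u z - u p) + (v z - v p) by ring.
by apply: le_trans (cmodD _ _) _; lra.
Qed.

Lemma fcontN u p : fcont u p -> fcont (fun z => - u z) p.
Proof.
move=> hu e e0; have [d d0 h] := hu e e0; exists d => // z /h.
by rewrite cmodB opprK [- _ + _]addrC.
Qed.

Lemma fcontM u v p : fcont u p -> fcont v p -> fcont (fun z => u z * v z) p.
Proof.
move=> hu hv e e0.
have U0 : 0 < cmod (u p) + 1 by have := cmod_ge0 (u p); lra.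
have V0 : 0 < cmod (v p) + 1 by have := cmod_ge0 (v p); lra.
have e1 : 0 < e / 2 / (cmod (v p) + 1) by rewrite !divr_gt0.
have e2 : 0 < e / 2 / (cmod (u p) + 1) by rewrite !divr_gt0.
have [d1 d10 h1] := hu _ e1; have [d2 d20 h2] := hv _ e2.
have [d3 d30 h3] := hu _ ltr01.
exists (Num.min d1 (Num.min d2 d3)); first by rewrite !lt_min d10 d20.
move=> z; rewrite !lt_min => /and3P[/h1 k1 /h2 k2 /h3 k3].
have -> : u z * v z - u p * v p = u z * (v z - v p) + (u z - u p) * v p by ring.
apply: le_trans (cmodD _ _) _; rewrite !cmodM.
have -> : e = (cmod (u p) + 1) * (e / 2 / (cmod (u p) + 1)) +
   e / 2 / (cmod (v p) + 1) * (cmod (v p) + 1) by field; rewrite !gt_eqF.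
have uz : cmod (u z) <= cmod (u p) + 1 by have := cmod_sub_le (u z) (u p); lra.
by apply: lerD; apply: ler_pM; rewrite ?cmod_ge0 //; lra.
Qed.

Lemma fcont_cst (c : C) p : fcont (fun=> c) p.
Proof. by move=> e e0; exists 1 => // z _; rewrite subrr cmod0 ltW. Qed.

Lemma fcont_comp u (q1 q2 : C2 -> CC) p : fcont u (q1 p, q2 p) -> fcont q1 p ->
  fcont q2 p -> fcont (fun z => u (q1 z, q2 z)) p.
Proof.
move=> hu h1 h2 e e0; have [d d0 h] := hu e e0.
have d3 : 0 < d / 3 by rewrite divr_gt0.
have [d1 d10 k1] := h1 _ d3; have [d2 d20 k2] := h2 _ d3.
exists (Num.min d1 d2); first by rewrite lt_min d10.
move=> z; rewrite lt_min => /andP[/k1 l1 /k2 l2]; apply: h; rewrite /dist2 /=; lra.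
Qed.

Lemma fdiff_comp h (q1 q2 : C2 -> CC) p (h1 h2 q11 q12 q21 q22 : C) :
  fdiff h (q1 p, q2 p) h1 h2 -> fdiff q1 p q11 q12 -> fdiff q2 p q21 q22 ->
  fdiff (fun z => h (q1 z, q2 z)) p (h1 * q11 + h2 * q21) (h1 * q12 + h2 * q22).
Proof.
move=> hh dq1 dq2 e e0.
have [r1 r10 l1] := fdiff_lipschitz dq1; have [r2 r20 l2] := fdiff_lipschitz dq2.
set M1 := cmod q11 + cmod q12 + 1 in l1; set M2 := cmod q21 + cmod q22 + 1 in l2.
have M10 : 0 < M1 by have := cmod_ge0 q11; have := cmod_ge0 q12; rewrite /M1; lra.
have M20 : 0 < M2 by have := cmod_ge0 q21; have := cmod_ge0 q22; rewrite /M2; lra.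
have M0 : 0 < M1 + M2 by rewrite addr_gt0.
have H10 : 0 < cmod h1 + 1 by have := cmod_ge0 h1; lra.
have H20 : 0 < cmod h2 + 1 by have := cmod_ge0 h2; lra.
have e1 : 0 < e / 3 / (M1 + M2) by rewrite !divr_gt0.
have e2 : 0 < e / 3 / (cmod h1 + 1) by rewrite !divr_gt0.
have e3 : 0 < e / 3 / (cmod h2 + 1) by rewrite !divr_gt0.
have [d1 d10 k1] := hh _ e1; have [d2 d20 k2] := dq1 _ e2; have [d3 d30 k3] := dq2 _ e3.
exists (Num.min (Num.min r1 r2) (Num.min (d1 / (M1 + M2)) (Num.min d2 d3))).
  by rewrite !lt_min r10 r20 d20 d30 divr_gt0.
move=> z; rewrite !lt_min => /and3P[/andP[/l1 z1 /l2 z2] z3 /andP[/k2 z4 /k3 z5]].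
have D0 := dist2_ge0 z p.
have zD : dist2 (q1 z, q2 z) (q1 p, q2 p) <= (M1 + M2) * dist2 z p.
  by rewrite {1}/dist2 /= mulrDl; exact: lerD.
have z6 : dist2 (q1 z, q2 z) (q1 p, q2 p) < d1.
  by apply: le_lt_trans zD _; rewrite mulrC -ltr_pdivlMr.
have {k1} := k1 _ z6; rewrite /= => k1.
move: z4 z5 k1.
set x := (z.1 : C) - p.1; set y := (z.2 : C) - p.2.
move: (h (q1 z, q2 z) : C) (h (q1 p, q2 p) : C) => hz hp z4 z5 k1.
have -> : hz - hp - ((h1 * q11 + h2 * q21) * x + (h1 * q12 + h2 * q22) * y) =
  (hz - hp - (h1 * ((q1 z : C) - q1 p) + h2 * ((q2 z : C) - q2 p))) +
  (h1 * ((q1 z : C) - q1 p - (q11 * x + q12 * y)) +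
   h2 * ((q2 z : C) - q2 p - (q21 * x + q22 * y))) by ring.
apply: le_trans (cmodD _ _) _.
have -> : e * dist2 z p = e / 3 / (M1 + M2) * ((M1 + M2) * dist2 z p) +
   ((cmod h1 + 1) * (e / 3 / (cmod h1 + 1) * dist2 z p) +
    (cmod h2 + 1) * (e / 3 / (cmod h2 + 1) * dist2 z p)).
  by field; rewrite !gt_eqF.
apply: lerD; first by apply: le_trans k1 _; apply: ler_wpM2l => //; exact: ltW.
apply: le_trans (cmodD _ _) _; rewrite !cmodM.
by apply: lerD; apply: ler_pM; rewrite ?cmod_ge0 //; lra.
Qed.

Lemma holo_comp (u : C2 -> CC) (q : C2 -> C2) p : holo_near u (q p) ->
  (\forall z \near p, differentiable q z) -> holo_near (fun z => u (q z)) p.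
Proof.
move=> hu hq; apply: near_C2_imp2 hq (near_comp erefl (near_C2_center hq) hu) _ => z dq du.
exact: differentiable_comp dq du.
Qed.

Lemma holo_components (q : C2 -> C2) p : (\forall z \near p, differentiable q z) ->
  holo_near (fun z => (q z).1) p /\ holo_near (fun z => (q z).2) p.
Proof.
move=> hq; split; [exact: (holo_comp (holo_pfun PX (q p)) hq)|].
exact: (holo_comp (holo_pfun PY (q p)) hq).
Qed.

(** Continuous first partials, the regularity that [holo_structure] supplies for the coordinate
    changes. *)
Definition C1_near h (hx hy : C2 -> C) p :=
  \forall z \near p, [/\ fdiff h z (hx z) (hy z), fcont hx z & fcont hy z].

Lemma holo_C1 (h : C2 -> CC) p : holo_near h p -> C1_near h (pdx h) (pdy h) p.
Proof.
move=> hh; have [/near_C2P h1 _] := holo_structure hh.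
by apply: near_C2_imp2 hh h1 _ => z /differentiable_fdiff ? [].
Qed.

(** By the chain rule for the local inverse composed with [q], the two determinants have product
    1. *)
Lemma biholo_germ_det (q : C2 -> C2) p r : biholo_germ q p r ->
  (pdx (fun z => (q z).1) p : C) * pdy (fun z => (q z).2) p -
  (pdy (fun z => (q z).1) p : C) * pdx (fun z => (q z).2) p != 0.
Proof.
move=> [qp [q' [_ [dq [dq' [h _]]]]]].
pose q1 z := (q z).1; pose q2 z := (q z).2; rewrite -/q1 -/q2.
have [/near_C2_center/differentiable_fdiff a1 /near_C2_center/differentiable_fdiff a2] :=
  holo_components dq.
have [/near_C2_center/differentiable_fdiff b1 /near_C2_center/differentiable_fdiff b2] :=
  holo_components dq'.
have qE z : (q1 z, q2 z) = q z by rewrite /q1 /q2; case: (q z).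
rewrite -qp -qE in b1 b2.
have c1 := fdiff_comp b1 a1 a2; have c2 := fdiff_comp b2 a1 a2.
have [] := @fdiff_unique _ (pfun PX) _ _ _ _ _ (fdiff_pfun PX p) (fdiff_near _ c1).
  by apply: near_C2_imp2 h (near_C2_all p (fun=> I)) _ => z hz _; rewrite -/(q1 z) -/(q2 z) qE hz.
have [] := @fdiff_unique _ (pfun PY) _ _ _ _ _ (fdiff_pfun PY p) (fdiff_near _ c2).
  by apply: near_C2_imp2 h (near_C2_all p (fun=> I)) _ => z hz _; rewrite -/(q1 z) -/(q2 z) qE hz.
rewrite /pfun /= -/q1 -/q2.
move: (pdx q1 p : C) (pdy q1 p : C) (pdx q2 p : C) (pdy q2 p : C).
move: (pdx _ _ : C) (pdy _ _ : C) (pdx _ _ : C) (pdy _ _ : C).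
move=> x1 x2 x3 x4 y1 y2 y3 y4 e1 e2 e3 e4; apply/eqP => D.
have : (x1 * x4 - x2 * x3) * (y1 * y4 - y2 * y3) = 1.
  have -> : (x1 * x4 - x2 * x3) * (y1 * y4 - y2 * y3) =
    (x3 * y1 + x4 * y3) * (x1 * y2 + x2 * y4) * -1 +
    (x1 * y1 + x2 * y3) * (x3 * y2 + x4 * y4) by ring.
  by rewrite -e1 -e2 -e3 -e4; ring.
by rewrite D mulr0 => /eqP; rewrite eq_sym oner_eq0.
Qed.

End ChainRule.

(** * Gradients of [J] and [K] at a cusp *)

Section CuspImpliesIndexOne.
Variable R : realType.
Local Notation C := (R[i]).
Local Notation CC := (CC R).
Local Notation C2 := (C2 R).
Implicit Types (f g : pexp R) (a : C2).

Definition cuspY : pexp R := PAdd (PMul PY (PMul PY PY)) (PMul PX PY).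

(** The Jacobian of [cusp_model]. *)
Definition cusp_crit : pexp R := PAdd PX (PMul (PC 3) (PMul PY PY)).

Lemma cusp_modelE (z : C2) : cusp_model z = (pfun PX z, pfun cuspY z).
Proof. by rewrite cusp_model_polymap. Qed.

Lemma C1_at (h hx hy : C2 -> C) (p : C2) : C1_near h hx hy p ->
  [/\ fdiff h p (hx p) (hy p), fcont hx p & fcont hy p].
Proof. exact: near_C2_center. Qed.

Lemma fdiff_cusp_model (s sx sy : C2 -> C) (z : C2) :
  fdiff s (cusp_model z) (sx (cusp_model z)) (sy (cusp_model z)) ->
  fdiff (fun w => s (cusp_model w)) z
    (sx (cusp_model z) + sy (cusp_model z) * (z.2 : C))
    (sy (cusp_model z) * pfun cusp_crit z).
Proof.
move=> h; have := h; rewrite {1}cusp_modelE => h'.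
have := fdiff_comp h' (fdiff_pfun PX z) (fdiff_pfun cuspY z).
have -> : (fun w => s (pfun PX w, pfun cuspY w)) = (fun w => s (cusp_model w)).
  by apply/funext => w; rewrite cusp_modelE.
move: (sx _) (sy _) => A B; rewrite /pfun /=.
by congr (fdiff _ _ _ _); ring.
Qed.

Lemma fcont_cusp_model (s : C2 -> C) (z : C2) : fcont s (cusp_model z) ->
  fcont (fun w => s (cusp_model w)) z.
Proof.
rewrite cusp_modelE => h.
have -> : (fun w => s (cusp_model w)) = (fun w => s (pfun PX w, pfun cuspY w)).
  by apply/funext => w; rewrite cusp_modelE.
exact: fcont_comp h (fdiff_fcont (fdiff_pfun PX z)) (fdiff_fcont (fdiff_pfun cuspY z)).
Qed.

Variables (f g : pexp R) (a : C2).
Variables (p1 p1x p1y p2 p2x p2y s1 s1x s1y s2 s2x s2y : C2 -> C).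
Hypotheses (hp1 : C1_near p1 p1x p1y 0) (hp2 : C1_near p2 p2x p2y 0).
Hypotheses (hs1 : C1_near s1 s1x s1y 0) (hs2 : C1_near s2 s2x s2y 0).
Hypothesis pa : (p1 0, p2 0) = a :> C2.
Hypothesis eqf : \forall z \near (0 : C2), pfun f (p1 z, p2 z) = s1 (cusp_model z).
Hypothesis eqg : \forall z \near (0 : C2), pfun g (p1 z, p2 z) = s2 (cusp_model z).

Let ph (z : C2) : C2 := (p1 z, p2 z).
Let m := @cusp_model R.
(** The determinant of the source chart; [v] below is that of the target chart along the cusp
    map. *)
Let delta z := p1x z * p2y z - p1y z * p2x z.
Let v z := s1x (m z) * s2y (m z) - s1y (m z) * s2x (m z).

Let deltaC : \forall z \near (0 : C2), fcont delta z.
Proof.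
apply: near_C2_imp2 hp1 hp2 _ => z [_ a1 a2] [_ b1 b2].
exact: fcontD (fcontM a1 b2) (fcontN (fcontM a2 b1)).
Qed.

Let vC : \forall z \near (0 : C2), fcont v z.
Proof.
apply: near_C2_imp2 (near_cusp_model hs1) (near_cusp_model hs2) _ => z [_ a1 a2] [_ b1 b2].
have c1 := fcont_cusp_model a1; have c2 := fcont_cusp_model a2.
have c3 := fcont_cusp_model b1; have c4 := fcont_cusp_model b2.
exact: fcontD (fcontM c1 c4) (fcontN (fcontM c2 c3)).
Qed.

Let partials (h : pexp R) (s sx sy : C2 -> C) : C1_near s sx sy 0 ->
  (\forall z \near (0 : C2), pfun h (p1 z, p2 z) = s (cusp_model z)) ->
  \forall z \near (0 : C2),
    (pfun (pdX h) (ph z) : C) * p1x z + (pfun (pdY h) (ph z) : C) * p2x z =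
       sx (m z) + sy (m z) * (z.2 : C) /\
    (pfun (pdX h) (ph z) : C) * p1y z + (pfun (pdY h) (ph z) : C) * p2y z =
       sy (m z) * pfun cusp_crit z.
Proof.
move=> hs eqh.
have hp : \forall z \near (0 : C2), fdiff p1 z (p1x z) (p1y z) /\ fdiff p2 z (p2x z) (p2y z).
  by apply: near_C2_imp2 hp1 hp2 _ => z [? _ _] [? _ _].
have hs' : \forall z \near (0 : C2), fdiff s (m z) (sx (m z)) (sy (m z)).
  by apply: near_C2_imp2 (near_cusp_model hs) hp _ => z [].
have hsn : \forall z \near (0 : C2), fdiff s (m z) (sx (m z)) (sy (m z)) /\
    \forall w \near z, pfun h (p1 w, p2 w) = s (cusp_model w).
  by apply: near_C2_imp2 hs' (near_near_C2 eqh) _.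
apply: near_C2_imp2 hp hsn _ => z [d1 d2] [d3 hE].
have d4 := fdiff_cusp_model d3.
have d5 := fdiff_comp (fdiff_pfun h (ph z)) d1 d2.
exact: (fdiff_unique (fdiff_near hE d5) d4).
Qed.

Let jac_ph : \forall z \near (0 : C2),
  (pfun (pjac f g) (ph z) : C) * delta z = v z * pfun cusp_crit z.
Proof.
apply: near_C2_imp2 (partials hs1 eqf) (partials hs2 eqg) _ => z [a1 a2] [b1 b2].
rewrite pfun_pjac /v /delta.
have -> : forall fx fy gx gy px py qx qy : C, (fx * gy - fy * gx) * (px * qy - py * qx) =
   (fx * px + fy * qx) * (gx * py + gy * qy) - (fx * py + fy * qy) * (gx * px + gy * qx).
  by move=> *; ring.
rewrite a1 a2 b1 b2.
move: (s1x _) (s1y _) (s2x _) (s2y _) (pfun cusp_crit z : C) (z.2 : C) => *; ring.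
Qed.

Hypotheses (delta0 : delta 0 != 0) (v0 : v 0 != 0) (s1x0 : s1x 0 != 0).

Let J := pjac f g.
Let K := pjac J f.

(* Along the critical curve only the values of [v] and [delta] are needed,
   since [cusp_crit] vanishes there. *)
Let jac_grad : \forall z \near (0 : C2), pfun cusp_crit z = 0 ->
  [/\ pfun J (ph z) = 0,
      delta z * ((pfun (pdX J) (ph z) : C) * p1x z + (pfun (pdY J) (ph z) : C) * p2x z) = v z &
      delta z * ((pfun (pdX J) (ph z) : C) * p1y z + (pfun (pdY J) (ph z) : C) * p2y z) =
        v z * (6 * (z.2 : C))].
Proof.
have dn0 := fcont_neq0 (near_C2_center deltaC) delta0.
have h1 : \forall z \near (0 : C2), [/\ fdiff p1 z (p1x z) (p1y z), fdiff p2 z (p2x z) (p2y z)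
     & delta z != 0].
  have hp : \forall z \near (0 : C2), fdiff p1 z (p1x z) (p1y z) /\ fdiff p2 z (p2x z) (p2y z).
    by apply: near_C2_imp2 hp1 hp2 _ => z [? _ _] [? _ _].
  by apply: near_C2_imp2 hp dn0 _ => z [].
have h2 : \forall z \near (0 : C2), fcont delta z /\ fcont v z.
  by apply: near_C2_imp2 deltaC vC _.
have h3 : \forall z \near (0 : C2), (fcont delta z /\ fcont v z) /\
   \forall w \near z, (pfun J (ph w) : C) * delta w = v w * pfun cusp_crit w.
  by apply: near_C2_imp2 h2 (near_near_C2 jac_ph) _.
apply: near_C2_imp2 h1 h3 _ => z [d1 d2 dz] [[cd cv] hE] kz.
have J0 : pfun J (ph z) = 0.
  have := near_C2_center hE; rewrite kz mulr0 => /eqP; rewrite mulf_eq0 (negbTE dz) orbF.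
  by move/eqP.
split => //.
all: have := fdiff_mul_cont cd (fdiff_comp (fdiff_pfun J (ph z)) d1 d2) J0.
all: have := fdiff_mul_cont cv (fdiff_pfun cusp_crit z) kz.
all: move=> e1 e2; have [] := fdiff_unique e2 (fdiff_near _ e1).
all: try by apply: near_C2_imp2 hE (near_C2_all z (fun=> I)) _ => w hw _; rewrite -[LHS]hw mulrC.
  by move=> -> _; rewrite /pfun /=; ring.
by move=> _ ->; rewrite /pfun /=; ring.
Qed.

(** On the critical curve the [y]-derivative of [f] in the chart vanishes, so the determinant
    defining [K] there reduces to the product of the [y]-derivative of [J] and the [x]-derivative of
    [f]. *)
Let K_crit : \forall z \near (0 : C2), pfun cusp_crit z = 0 ->
  delta z * delta z * pfun K (ph z) =
  - (6 * (z.2 : C)) * (v z * (s1x (m z) + s1y (m z) * (z.2 : C))).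
Proof.
apply: near_C2_imp2 jac_grad (partials hs1 eqf) _ => z hz [a1 a2] kz.
have [_ b1 b2] := hz kz; rewrite kz mulr0 in a2.
rewrite /K pfun_pjac; rewrite -a1; move: a2 b2; rewrite /delta.
move: (pfun (pdX J) (ph z) : C) (pfun (pdY J) (ph z) : C) (pfun (pdX f) (ph z) : C)
  (pfun (pdY f) (ph z) : C) (p1x z) (p1y z) (p2x z) (p2y z) (v z) (z.2 : C).
move=> Jx Jy fx fy px py qx qy V y a2 b2.
have -> : - (6 * y) * (V * (fx * px + fy * qx)) = - (V * (6 * y)) * (fx * px + fy * qx) by ring.
rewrite -b2.
have -> : (px * qy - py * qx) * (px * qy - py * qx) * (Jx * fy - Jy * fx) =
  (px * qy - py * qx) * ((Jx * px + Jy * qx) * (fx * py + fy * qy) -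
                         (Jx * py + Jy * qy) * (fx * px + fy * qx)) by ring.
by rewrite a2; ring.
Qed.

(** In the chart [J] has gradient [(v / delta, 0)] at 0, and [K] has derivative
    [- 6 v s1x / delta^2] in the direction [(0, 1)] tangent to the critical curve; hence the
    gradients are independent. *)
Lemma cusp_gradients :
  [/\ pfun J a = 0, pfun K a = 0,
      (pfun (pdX J) a : C) * pfun (pdY K) a - (pfun (pdY J) a : C) * pfun (pdX K) a != 0 &
      ((pfun (pdX f) a : C) != 0) || ((pfun (pdY f) a : C) != 0)].
Proof.
have k0 : pfun cusp_crit (0 : C2) = 0 by rewrite /pfun /= !mulr0 addr0.
have m0 : m 0 = 0 by rewrite /m cusp_modelE /pfun /= !mulr0 addr0.
have ph0 : ph 0 = a by rewrite /ph pa.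
have [J0 G1 G2] := near_C2_center jac_grad k0.
have K0 := near_C2_center K_crit k0.
have [F1 _] := near_C2_center (partials hs1 eqf).
have y0 : (0 : C2).2 = 0 by [].
rewrite ph0 ?m0 ?y0 in J0 G1 G2 K0 F1.
rewrite !mulr0 in G2 K0; rewrite oppr0 mul0r in K0; rewrite mulr0 addr0 in F1.
have Ka : pfun K a = 0.
  by move/eqP: K0; rewrite !mulf_eq0 (negbTE delta0) => /eqP.
have [d1 _ _] := C1_at hp1; have [d2 _ _] := C1_at hp2.
pose w z := v z * (s1x (m z) + s1y (m z) * (z.2 : C)).
have w0 : w 0 = v 0 * s1x 0 by rewrite /w m0 /= mulr0 addr0.
have cw : fcont w 0.
  have [_ c1 c2] := C1_at hs1; rewrite -m0 in c1 c2.
  have c3 := fcont_cusp_model c1; have c4 := fcont_cusp_model c2.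
  have c5 := fdiff_fcont (fdiff_pfun PY (0 : C2)).
  exact: fcontM (near_C2_center vC) (fcontD c3 (fcontM c4 c5)).
have cd := near_C2_center deltaC.
have dK : fdiff (pfun K) (p1 0, p2 0) (pfun (pdX K) a) (pfun (pdY K) a).
  by rewrite pa; exact: fdiff_pfun.
have Kph : pfun K (p1 0, p2 0) = 0 by rewrite pa.
have e1 := fdiff_mul_cont (fcontM cd cd) (fdiff_comp dK d1 d2) Kph.
pose Y6 : pexp R := PMul (PC 6) PY.
have Y60 : pfun Y6 (0 : C2) = 0 by rewrite /pfun /= mulr0.
have e2 := fdiff_mul_cont cw (fdiff_pfun Y6 (0 : C2)) Y60.
have e3 := fdiffD e1 e2.
(* Restricting to the parametrised critical curve [(- 3 y^2, y)]. *)
pose c1 : pexp R := PMul (PC (- 3)) (PMul PY PY).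
have c00 : (pfun c1 (0 : C2), pfun PY (0 : C2)) = 0 :> C2 by rewrite /pfun /= !mulr0.
have e4 := e3; rewrite -[X in fdiff _ X]c00 in e4.
have e5 := fdiff_comp e4 (fdiff_pfun c1 (0 : C2)) (fdiff_pfun PY (0 : C2)).
have kc : \forall z \near (0 : C2),
    delta (pfun c1 z, pfun PY z) * delta (pfun c1 z, pfun PY z) *
    pfun K (ph (pfun c1 z, pfun PY z)) +
    w (pfun c1 z, pfun PY z) * pfun Y6 (pfun c1 z, pfun PY z) = 0.
  have dc := differentiable_polymap c1 PY (0 : C2).
  apply: near_C2_imp2 (near_comp c00 dc K_crit) (near_C2_all 0 (fun=> I)) _ => z hz _.
  rewrite /polymap in hz; rewrite hz; last by rewrite /pfun /=; ring.
  rewrite /w -/m; move: (v _) (s1x _ + _) => V W; rewrite /pfun /=; ring.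
have z0 : fdiff (pfun (PC (0 : C))) (0 : C2) 0 0.
  by have := fdiff_pfun (PC (0 : C)) (0 : C2); rewrite /pfun /=.
have [_] := fdiff_unique z0 (fdiff_near kc e5).
have -> : pfun (pdY c1) (0 : C2) = 0 by rewrite /pfun /= !(mul0r, mulr0, addr0).
have -> : pfun (pdY PY) (0 : C2) = 1 by [].
have -> : pfun (pdY Y6) (0 : C2) = 6 by rewrite /pfun /= !(mul0r, mulr0, addr0, mulr1).
rewrite w0 mulr0 add0r mulr1 => hK.
split => //.
  move: G1 G2 hK; move: delta0 v0 s1x0; rewrite /delta.
  move: (pfun (pdX J) a : C) (pfun (pdY J) a : C) (pfun (pdX K) a : C) (pfun (pdY K) a : C)
    (p1x 0) (p1y 0) (p2x 0) (p2y 0) (v 0) (s1x 0).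
  move=> Jx Jy Kx Ky px py qx qy V s D0 V0 s0 G1 G2 hK.
  have G2' : Jx * py + Jy * qy = 0.
    by move/eqP: G2; rewrite mulf_eq0 (negbTE D0) => /eqP.
  apply/eqP => det0.
  have n6 : (6 : C) != 0 by rewrite pnatr_eq0.
  have : (px * qy - py * qx) ^+ 2 * ((px * qy - py * qx) * (Jx * Ky - Jy * Kx) * (px * qy - py * qx)) =
      - (V * (V * s * 6)).
    have -> : (px * qy - py * qx) * (Jx * Ky - Jy * Kx) * (px * qy - py * qx) =
      ((px * qy - py * qx) * (Jx * px + Jy * qx)) * (Kx * py + Ky * qy) -
      (px * qy - py * qx) * (Jx * py + Jy * qy) * (Kx * px + Ky * qx) by ring.
    rewrite G1 G2' mulr0 mul0r subr0.
    have -> : V * s * 6 = - ((px * qy - py * qx) * (px * qy - py * qx) * (Kx * py + Ky * qy)).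
      by apply/eqP; rewrite -addr_eq0 addrC -hK.
    ring.
  rewrite det0 !(mulr0, mul0r) => /eqP.
  by rewrite eq_sym oppr_eq0 !mulf_eq0 (negbTE V0) (negbTE s0) (negbTE n6).
rewrite -negb_and; apply: contra s1x0 => /andP[/eqP fx /eqP fy].
by rewrite -F1 fx fy !mul0r addr0.
Qed.

End CuspImpliesIndexOne.

(** * The index of a cusp *)

Section IndexOfCusp.
Variable R : realType.
Local Notation C := (R[i]).
Local Notation CC := (CC R).
Local Notation C2 := (C2 R).
Implicit Types (f g : pexp R) (a : C2).

Lemma C1_lincomb (s t : C) (u ux uy v vx vy : C2 -> C) (p : C2) :
  C1_near u ux uy p -> C1_near v vx vy p ->
  C1_near (fun z => s * u z + t * v z) (fun z => s * ux z + t * vx z)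
          (fun z => s * uy z + t * vy z) p.
Proof.
move=> hu hv; apply: near_C2_imp2 hu hv _ => z [du u1 u2] [dv v1 v2].
split; last 2 first.
- exact: fcontD (fcontM (fcont_cst s z) u1) (fcontM (fcont_cst t z) v1).
- exact: fcontD (fcontM (fcont_cst s z) u2) (fcontM (fcont_cst t z) v2).
have := fdiff_comp (fdiff_pfun (plc s t PX PY) (u z, v z)) du dv.
rewrite /pfun /=; congr (fdiff _ _ _ _); ring.
Qed.

Lemma polyM_row0 (al be : CC) : polyM (fun T : 'M[CC]_2 => T 0 0 * al + T 0 1 * be).
Proof.
exists 1%N, (fun i j k l => if (k + l == 0)%N then
   (if (i == 1 :> nat) && (j == 0 :> nat) then al else
    if (i == 0 :> nat) && (j == 1 :> nat) then be else 0) else 0).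
move=> T; rewrite !big_ord_recl !big_ord0 /= /bump /= !(expr0, expr1, mulr1, mul0r, addr0, add0r).
by rewrite addrC [_ * al]mulrC [_ * be]mulrC.
Qed.

Lemma grad_ok_regular f a (J : C2 -> CC) :
  ((pfun (pdX f) a : C) != 0) || ((pfun (pdY f) a : C) != 0) ->
  grad_ok_on_branches J (pfun f) a.
Proof.
move=> hu.
have h : \forall z \near a, pfun (pdX f) z = 0 -> pfun (pdY f) z = 0 -> z = a.
  case/orP: hu => /(fcont_neq0 (holo_fcont (holo_pfun _ a))) hn.
    by apply: near_C2_imp2 hn (near_C2_all a (fun=> I)) _ => z /eqP n0 _ z0; case: n0.
  by apply: near_C2_imp2 hn (near_C2_all a (fun=> I)) _ => z /eqP n0 _ _ z0; case: n0.
move: h; rewrite /prop_near1 nbhsE => -[U [oU Ua] hU].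
exists U; split => //; split => // p Up _.
by rewrite pdx_pfun pdy_pfun; exact: hU.
Qed.

Theorem cusp_index_one f g a : has_cusp (polymap f g) a -> mu_eq1 (pfun f) (pfun g) a.
Proof.
move=> [phi [psi0 [hphi [hpsi0 hE]]]].
have [psi [hpsi hK _]] := biholo_germ_inv hpsi0.
have [phi0 [_ [_ [dphi _]]]] := hphi; have [psi00 [_ [_ [dpsi _]]]] := hpsi.
pose p1 z := (phi z).1; pose p2 z := (phi z).2.
pose s1 z := (psi z).1; pose s2 z := (psi z).2.
have phE z : (p1 z, p2 z) = phi z by rewrite /p1 /p2; case: (phi z).
have psE z : (s1 z, s2 z) = psi z by rewrite /s1 /s2; case: (psi z).
have [/holo_C1 cp1 /holo_C1 cp2] := holo_components dphi.
have [/holo_C1 cs1 /holo_C1 cs2] := holo_components dpsi.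
have dd := biholo_germ_det hphi; have dv := biholo_germ_det hpsi.
rewrite -/p1 -/p2 in cp1 cp2 dd; rewrite -/s1 -/s2 in cs1 cs2 dv.
have FE : \forall z \near (0 : C2), polymap f g (phi z) = psi (cusp_model z).
  have hK' : \forall z \near a, psi (psi0 (polymap f g z)) = polymap f g z.
    exact: (near_comp erefl (differentiable_polymap f g a) hK).
  apply: near_C2_imp2 hE (near_comp phi0 (near_C2_center dphi) hK') _ => z e1 e2.
  by rewrite -e2 e1.
(* In the chart the gradient of [f'] at 0 is [(T 0 0 * al + T 0 1 * be, 0)], so the generic
   condition says that [f'] is not critical at [a]. *)
pose al : C := pdx s1 0; pose be : C := pdx s2 0.
exists (fun T : 'M[CC]_2 => T 0 0 * al + T 0 1 * be); split; first exact: polyM_row0.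
  have ab : (al != 0) || (be != 0).
    rewrite -negb_and; apply: contra dv => /andP[/eqP h1 /eqP h2].
    by rewrite -/al -/be h1 h2 mul0r mulr0 subr0.
  case/orP: ab => h.
    by exists (1%:M : 'M[C]_2); rewrite !mxE /= mul1r mul0r addr0.
  by exists (\matrix_(i, j) (i != j)%:R : 'M[C]_2); rewrite !mxE /= mul0r mul1r add0r.
move=> T dT PT.
pose f' := plc (T 0 0) (T 0 1) f g; pose g' := plc (T 1 0) (T 1 1) f g.
have E1 : \forall z \near (0 : C2), pfun f' (p1 z, p2 z) =
    (T 0 0 : C) * s1 (cusp_model z) + (T 0 1 : C) * s2 (cusp_model z).
  apply: near_C2_imp2 FE (near_C2_all 0 (fun=> I)) _ => z hz _; rewrite phE.
  by rewrite -[LHS]/((T 0 0 : C) * pfun f (phi z) + (T 0 1 : C) * pfun g (phi z)) /s1 /s2 -hz.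
have E2 : \forall z \near (0 : C2), pfun g' (p1 z, p2 z) =
    (T 1 0 : C) * s1 (cusp_model z) + (T 1 1 : C) * s2 (cusp_model z).
  apply: near_C2_imp2 FE (near_C2_all 0 (fun=> I)) _ => z hz _; rewrite phE.
  by rewrite -[LHS]/((T 1 0 : C) * pfun f (phi z) + (T 1 1 : C) * pfun g (phi z)) /s1 /s2 -hz.
have p0 : (p1 0, p2 0) = a by rewrite phE.
have m0 : cusp_model (0 : C2) = 0 by rewrite cusp_modelE /pfun /= !mulr0 addr0.
have cs1' := C1_lincomb (T 0 0) (T 0 1) cs1 cs2.
have cs2' := C1_lincomb (T 1 0) (T 1 1) cs1 cs2.
have [|||J0 K0 hdet hu] := cusp_gradients cp1 cp2 cs1' cs2' p0 E1 E2.
- exact: dd.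
- cbv beta; rewrite m0; move: dT dv; rewrite (det_mx2 T).
  move: (pdx s1 0 : C) (pdx s2 0 : C) (pdy s1 0 : C) (pdy s2 0 : C)
    (T 0 0 : C) (T 0 1 : C) (T 1 0 : C) (T 1 1 : C).
  move=> x1 x2 x3 x4 y1 y2 y3 y4 h1 h2.
  have -> : (y1 * x1 + y2 * x2) * (y3 * x3 + y4 * x4) - (y1 * x3 + y2 * x4) * (y3 * x1 + y4 * x2)
    = (y1 * y4 - y2 * y3) * (x1 * x4 - x3 * x2) by ring.
  by rewrite mulf_neq0.
- exact: PT.
cbv zeta; rewrite (plcE (T 0 0) (T 0 1)) (plcE (T 1 0) (T 1 1)) -/f' -/g'.
split; first exact: grad_ok_regular.
exists 0%N; rewrite Jac_pfun J11_pfun pdx_pfun pdy_pfun; split.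
  exact: quot_dim1_intro.
by apply/(quot_dim_unit (holo_pfun _ a) (holo_pfun _ a) hu).
Qed.

End IndexOfCusp.

Theorem theorem2p9 (R : realType) (d1 d2 : nat) (f g : C2 R -> CC R) (a : C2 R) :
  (0 < d1)%N -> (0 < d2)%N -> Omega2 d1 d2 f g ->
  gen_cusp f g a ->
  (has_cusp (fun p => (f p, g p)) a <-> mu_eq1 f g a).
Proof.
move=> _ _ [/poly2_pfun[ef ->] /poly2_pfun[eg ->]] _.
by split; [exact: cusp_index_one|exact: index_one_cusp].
Qed.
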